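(* Let $(a_n)_n$ be an approximately uncorrelated triangular scheme (with constants $C(k)$ and sequences $(C^{(\ell)}_n)_n$), let $(h_n)_n$ be a sequence of $n$-halfwidths, and let $(X_n^{NP})_n$ be the non-periodic random matrices based on $(a_n)_n$ with halfwidths $(h_n)_n$. Assume that $$h_n\to\infty\qquad\text{but}\qquad \lim_{n\to\infty}\frac{h_n}{n}\in\{0,1\}.$$ Then: (i) The semicircle law holds for $(X_n^{NP})_n$ in probability. (ii) If $(h_n^{-p})_n$ is summable for some $p\in\mathbb{N}$, and the sequences $(C^{(\ell)}_n)_n$ are summable for all $\ell\in\mathbb{N}$, then the semicircle law holds for $(X_n^{NP})_n$ almost surely.
   Context: All random variables are real-valued and defined on a common probability space. Write $[\ell]=\{1,\ldots,\ell\}$. Index pairs $(p_1,q_1),\ldots,(p_\ell,q_\ell)\in[n]^2$ are called fundamentally different if $\{p_i,q_i\}\neq\{p_j,q_j\}$ for all $i\neq j$. Approximately uncorrelated triangular scheme: a sequence $(a_n)_n$ where $a_n$ is a real symmetric $n\times n$ random matrix, such that there are constants $(C(k))_{k\in\mathbb N}$ and sequences $(C^{(\ell)}_n)_n$, $\ell\in\mathbb{N}$, with $\lim_{n\to\infty}C^{(\ell)}_n=0$ for each $\ell$, such that for all $n,\ell\in\mathbb{N}$, all fundamentally different $P_1,\ldots,P_\ell\in[n]^2$ and all $\delta_1,\ldots,\delta_\ell\in\mathbb{N}=\{1,2,\dots\}$: $$\left|\mathbb{E}\, a_n(P_1)^{\delta_1}\cdots a_n(P_\ell)^{\delta_\ell}\right|\le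 \frac{C(\delta_1+\ldots+\delta_\ell)}{n^{\frac12\#\{i\in[\ell]:\delta_i=1\}}},\qquad \left|\mathbb{E}\, a_n(P_1)^2\cdots a_n(P_\ell)^2-1\right|\le C^{(\ell)}_n .$$ An $n$-halfwidth is an element $h_n\in\{1,\ldots,n\}$; its associated bandwidth is $b_n=\min(2h_n-1,n)$. The non-periodic random matrices based on $(a_n)_n$ with halfwidths $(h_n)_n$ are given by $X_n^{NP}(i,j)=\frac{1}{\sqrt{b_n}}a_n(i,j)$ if $|i-j|\le h_n-1$ and $X_n^{NP}(i,j)=0$ otherwise, for $(i,j)\in[n]^2$. The empirical spectral distribution (ESD) of an $n\times n$ symmetric matrix is the uniform probability measure on its $n$ eigenvalues (with multiplicity). The semicircle law holds for $(X_n^{NP})_n$ in probability (resp. almost surely) if the ESDs converge weakly to the measure with density $\frac{1}{2\pi}\sqrt{4-x^2}\,1_{[-2,2]}(x)$ in probability, i.e. the integral of every bounded continuous function converges in probability (resp. almost surely). *)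

(* Defs.v *)
From HB Require Import structures.
From mathcomp Require Import all_boot all_order all_algebra.
From mathcomp Require Import all_classical all_reals all_analysis.
From mathcomp Require Import measurable_realfun.
From mathcomp Require polyrcf.

Set Implicit Arguments.
Unset Strict Implicit.
Unset Printing Implicit Defensive.
Import Order.TTheory GRing.Theory Num.Theory.
Import numFieldNormedType.Exports.

Local Open Scope classical_set_scope.
Local Open Scope ring_scope.

Section EmpiricalSpectralDistribution.
Context {R : realType}.

(* The real roots of the characteristic polynomial, each one repeated
   according to its multiplicity; if A is symmetric this list has length n. *)
Definition eigenvalues n (A : 'M[R]_n) : seq R :=
  flatten [seq nseq (mup x (char_poly A)) x
          | x <- polyrcf.rootsR (char_poly A)].

Definition esd n (A : 'M[R]_n) : {measure set R -> \bar R} :=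
  mscale (n%:R^-1)%:nng
    (msum (fun k => \d_((eigenvalues A)`_k)) (size (eigenvalues A))).

End EmpiricalSpectralDistribution.

Section SemicircleDistribution.
Context {R : realType}.

Definition semicircle_pdf (x : R) : R :=
  if -2 <= x <= 2 then Num.sqrt (4 - x ^+ 2) / (2 * pi) else 0.

Lemma semicircle_pdf_ge0 x : 0 <= semicircle_pdf x.
Proof.
by rewrite /semicircle_pdf; case: ifP => // _; rewrite divr_ge0 ?sqrtr_ge0//
  mulr_ge0// pi_ge0.
Qed.

Lemma measurable_semicircle_pdf : measurable_fun setT semicircle_pdf.
Proof.
rewrite /semicircle_pdf; apply: measurable_fun_if => //=.
  apply: measurable_and; exact: measurable_fun_ler.
apply: measurable_funTS; apply: measurable_funM => //.
apply: continuous_measurable_fun => x.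
apply: (@continuous_comp _ _ _ (fun y : R => 4 - y ^+ 2) Num.sqrt).
  by apply: cvgB; [exact: cvg_cst|exact: exprn_continuous].
exact: sqrt_continuous.
Qed.

Definition semicircle (A : set R) : \bar R :=
  \int[lebesgue_measure]_(x in A) (semicircle_pdf x)%:E.

Let semicircle0 : semicircle set0 = 0%E.
Proof. by rewrite /semicircle integral_set0. Qed.

Let semicircle_ge0 A : (0 <= semicircle A)%E.
Proof. by apply: integral_ge0 => x _; rewrite lee_fin semicircle_pdf_ge0. Qed.

Let semicircle_sigma_additive : semi_sigma_additive semicircle.
Proof.
move=> /= F mF tF mUF; rewrite /semicircle; apply: cvg_toP.
  apply: ereal_nondecreasing_is_cvgn => m n mn.
  apply: lee_sum_nneg_natr => // k _ _.
  by apply: integral_ge0 => x _; rewrite lee_fin semicircle_pdf_ge0.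
rewrite ge0_integral_bigcup//=.
- apply: measurable_funTS; apply: measurableT_comp => //.
  exact: measurable_semicircle_pdf.
- by move=> x _; rewrite lee_fin semicircle_pdf_ge0.
Qed.

HB.instance Definition _ := isMeasure.Build _ _ _ semicircle
  semicircle0 semicircle_ge0 semicircle_sigma_additive.

End SemicircleDistribution.

Section Convergence.
Context {d : measure_display} {T : measurableType d} {R : realType}.
Variable P : probability T R.

Definition cvg_in_probability (Y : nat -> T -> R) (l : R) : Prop :=
  forall eps : R, 0 < eps ->
    P [set w | eps <= `|Y n w - l|] @[n --> \oo] --> 0%E.

Definition cvg_almost_surely (Y : nat -> T -> R) (l : R) : Prop :=
  {ae P, forall w, Y n w @[n --> \oo] --> l}.

Definition semicircle_law
    (cvg : (nat -> T -> R) -> R -> Prop) (X : forall n, T -> 'M[R]_n) : Prop :=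
  forall f : R -> R, continuous f -> [bounded f x | x in setT] ->
    cvg (fun n w => \int[esd (X n w)]_x f x) (\int[semicircle]_x f x).

Definition semicircle_law_in_probability := semicircle_law cvg_in_probability.

Definition semicircle_law_almost_surely := semicircle_law cvg_almost_surely.

End Convergence.

Section RandomBandMatrices.
Context {d : measure_display} {T : measurableType d} {R : realType}.
Context {P : probability T R}.

Definition fundamentally_different n l (p : 'I_l -> 'I_n * 'I_n) : Prop :=
  forall i j, i != j ->
    [set (p i).1; (p i).2]%SET != [set (p j).1; (p j).2]%SET.

(* The bounds are stated in \bar R, where the expectation of a random variable
   that is not integrable is infinite; they therefore contain the existence of
   all the moments involved. *)
Record approx_uncorrelated (a : forall n, 'I_n -> 'I_n -> {RV P >-> R})
    (C : nat -> R) (Cl : nat -> nat -> R) : Prop := ApproxUncorrelated {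
  scheme_sym : forall n (i j : 'I_n) (w : T), a n i j w = a n j i w ;
  scheme_cvg : forall l, (0 < l)%N -> Cl l n @[n --> \oo] --> (0 : R) ;
  scheme_moment : forall n l (p : 'I_l -> 'I_n * 'I_n) (delta : 'I_l -> nat),
    (0 < l)%N -> fundamentally_different p -> (forall i, (0 < delta i)%N) ->
    (`| 'E_P[fun w => (\prod_(i < l) a n (p i).1 (p i).2 w ^+ delta i)%R] |
     <= (C (\sum_(i < l) delta i)%N
         / n%:R `^ (2^-1 * #|[set i | delta i == 1%N]%SET|%:R))%:E)%E ;
  scheme_square : forall n l (p : 'I_l -> 'I_n * 'I_n),
    (0 < l)%N -> fundamentally_different p ->
    (`| 'E_P[fun w => (\prod_(i < l) a n (p i).1 (p i).2 w ^+ 2)%R] - 1 |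
     <= (Cl l n)%:E)%E }.

(* No condition at n = 0, where no halfwidth exists. *)
Definition halfwidths (h : nat -> nat) : Prop :=
  forall n, (0 < n)%N -> (1 <= h n <= n)%N.

Definition bandwidth (n h : nat) : nat := minn (2 * h - 1) n.

Definition nonperiodic_band_matrix (a : forall n, 'I_n -> 'I_n -> {RV P >-> R})
    (h : nat -> nat) (n : nat) (w : T) : 'M[R]_n :=
  \matrix_(i, j)
    if (`|i%:Z - j%:Z| <= h n - 1)%N
    then (Num.sqrt (bandwidth n (h n))%:R)^-1 * a n i j w else 0.

End RandomBandMatrices.

(* Main.v *)
Require Import Defs.
From HB Require Import structures.
From mathcomp Require Import all_boot all_order all_algebra.
From mathcomp Require Import all_classical all_reals all_analysis.
From mathcomp Require Import measurable_realfun.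
From mathcomp Require Import ring lra zify.
From mathcomp Require polyrcf complex.

(** The proof is the moment method. The k-th moment of the spectral
distribution of the band matrix is its normalised trace of the k-th power, that
is, a sum over the closed walks of length k that follow the band, each one with
the product of the entries along its steps, divided by n b^(k/2), where b is the
bandwidth. A vertex that a walk visits for the first time is chosen among at
most b neighbours, so walks with v vertices number O(n b^(v-1)), and their
contribution is decided by the relation of vertices and edges. There are three
classes.

- Walks with an edge that is used once ([has_single]). The mean of the product
  gains n^(-1/2) for every such edge, and a closed walk with such an edge has at
  most as many vertices as edges ([cycle_vertices_single_le]). This part of the
  trace has a second moment O(1/(n b)) ([mean_sqr_single]).
- Walks without such an edge, but with fewer than k/2 + 1 vertices
  ([degenerate]). They are too few by a factor b^(1/2), so the 2z-th moment of
  this part is O(b^-z) for every z ([mean_pow_degenerate]).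
- Walks that use the edges of a tree twice each ([tree_doubled]). Here the
  mean of the product is close to 1, and two of these walks are almost
  uncorrelated unless they share an edge, which is rare. So this part is close in
  mean square to the normalised number of its walks ([mean_sqr_tree]).

The number is computed through reducible walks, those that cancel completely
when every immediate return along the last pending edge is removed. Up to
degenerate ones these are the doubled trees ([tree_density_close]). Reading a
reducible walk from left to right, with the stack of edges that are still to be
walked back, a step either takes the top of the stack off, which is one choice,
or puts a new edge on it, which is about b choices. This is the recursion of
ballot numbers, up to the variation of the number of entries of the rows
([closings_le], [closings_ge]). The limit of h n / n is 0 or 1 in order that this
variation vanishes in the limit ([reducible_density_cvg]). The moments of the
semicircle distribution satisfy the same recursion: multiplication by x maps a
Chebyshev polynomial to the sum of its two neighbours
([Rintegral_expr_chebyshev]).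

Convergence of moments yields weak convergence by approximation: a bounded
continuous function differs from some polynomial by at most e + c x^(2m), where
c is so small that even the semicircle integral of c x^(2m) is at most e
([poly_approx_majorant], [tends_esd]). The majorant is a polynomial itself, so its
integral against the spectral distribution is under control as well, which takes
the place of a tightness argument.

Both modes of convergence result from one argument, in which only the
rates of the deviation probabilities differ ([null_class]): rates that vanish
give convergence in probability, and summable ones give almost sure convergence
by the Borel-Cantelli lemma. For the latter, 1/(n b) is at most
n^(-1-1/p) + h^-p, the sum of two summable sequences ([abs_summable_nbwV]). *)

Set Implicit Arguments.
Unset Strict Implicit.
Unset Printing Implicit Defensive.
Import Order.TTheory GRing.Theory Num.Theory.
Import numFieldNormedType.Exports.

Local Open Scope ring_scope.

(** * Vertices and edges of closed walks *)

Section Words.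
Context {V : finType}.
Implicit Types (x y : V) (p w : seq V) (H : {set V}) (E : {set {set V}}).

Definition step_pairs x p : seq (V * V) := pairmap pair x p.
Definition cycle_pairs w : seq (V * V) :=
  if w is x :: p then step_pairs x (rcons p x) else [::].
Definition edge (q : V * V) : {set V} := [set q.1; q.2]%SET.
Definition step_edges x p : seq {set V} := map edge (step_pairs x p).
Definition cycle_edges w : seq {set V} := map edge (cycle_pairs w).
Definition vset w : {set V} := [set x in w]%SET.
Definition eset (L : seq {set V}) : {set {set V}} := [set e in L]%SET.

(** A step to a new vertex always uses a new edge. Here H and E stand for the
vertices and edges that were met before the walk from x. *)
Lemma step_vertices_le x p H E : x \in H -> (forall e, e \in E -> e \subset H) ->
  (#|(H :|: vset p)%SET| + #|E| <= #|H| + #|(E :|: eset (step_edges x p))%SET|)%N.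
Proof.
elim: p x H E => [|y p IH] x H E xH EH.
  have -> : vset [::] = finset.set0 by apply/setP => z; rewrite !inE.
  have -> : eset (step_edges x [::]) = finset.set0 by apply/setP => z; rewrite !inE.
  by rewrite !finset.setU0.
set E' := (E :|: [set [set x; y]])%SET; set H' := (H :|: [set y])%SET.
have -> : (H :|: vset (y :: p) = H' :|: vset p)%SET.
  by apply/setP => z; rewrite !inE orbA.
have -> : (E :|: eset (step_edges x (y :: p)) = E' :|: eset (step_edges y p))%SET.
  by apply/setP => z; rewrite !inE orbA.
have yH' : y \in H' by rewrite !inE eqxx orbT.
have EH' : forall e, e \in E' -> e \subset H'.
  move=> e; rewrite !inE => /orP[eE|/eqP->].
    exact: fintype.subset_trans (EH _ eE) (finset.subsetUl _ _).
  by apply/fintype.subsetP => z; rewrite !inE => /orP[/eqP->|/eqP->];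
    rewrite ?xH ?eqxx ?orbT.
have := IH y H' E' yH' EH'.
have [yH|yH] := boolP (y \in H).
  have -> : H' = H by apply/setP => z; rewrite !inE; case: eqP => [->|]; rewrite ?yH ?orbF.
  have : (#|E| <= #|E'|)%N by apply: subset_leq_card; exact: finset.subsetUl.
  lia.
have -> : #|H'| = #|H|.+1 by rewrite /H' finset.setUC cardsU1 yH.
have -> : #|E'| = #|E|.+1.
  rewrite /E' finset.setUC cardsU1; suff -> : [set x; y]%SET \notin E by [].
  apply/negP => /EH /fintype.subsetP/(_ y); rewrite !inE eqxx orbT => /(_ isT).
  exact/negP.
lia.
Qed.

Lemma step_pairs_rcons x p y :
  step_pairs x (rcons p y) = rcons (step_pairs x p) (last x p, y).
Proof. by elim: p x => //= z p IH x; rewrite -IH. Qed.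

Lemma size_cycle_pairs w : size (cycle_pairs w) = size w.
Proof. by case: w => //= x p; rewrite size_pairmap size_rcons. Qed.

Lemma cycle_pairs_rot q w : cycle_pairs (rot q w) = rot q (cycle_pairs w).
Proof.
have rot1 u : cycle_pairs (rot 1 u) = rot 1 (cycle_pairs u).
  case: u => [|x [|y p]] //; rewrite /rot /= !cats1 /=.
  by rewrite step_pairs_rcons last_rcons drop0 take0 cats1.
have [qw|wq] := leqP q (size w); last first.
  by rewrite !rot_oversize ?size_cycle_pairs //; exact: ltnW.
elim: q qw => [|q IH] qw; first by rewrite !rot0.
by rewrite (rotS qw) rot1 (IH (ltnW qw)) -rotS ?size_cycle_pairs.
Qed.

Lemma cycle_edges_rot q w : cycle_edges (rot q w) = rot q (cycle_edges w).
Proof. by rewrite /cycle_edges cycle_pairs_rot map_rot. Qed.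

Lemma size_cycle_edges w : size (cycle_edges w) = size w.
Proof. by rewrite size_map size_cycle_pairs. Qed.

Lemma vset_rot q w : vset (rot q w) = vset w.
Proof. by apply/setP => z; rewrite !inE mem_rot. Qed.

Lemma eset_rot q (L : seq {set V}) : eset (rot q L) = eset L.
Proof. by apply/setP => z; rewrite !inE mem_rot. Qed.

Lemma vset_cons_rcons x p : vset (x :: p) = ([set x] :|: vset (rcons p x))%SET.
Proof. by apply/setP => z; rewrite !inE mem_rcons inE orbA orbb. Qed.

Lemma vset_cons x p : vset (x :: p) = ([set x] :|: vset p)%SET.
Proof. by apply/setP => z; rewrite !inE. Qed.

Lemma cycle_edges_sub w e : e \in cycle_edges w -> e \subset vset w.
Proof.
suff H x p e' : e' \in step_edges x p -> e' \subset vset (x :: p).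
  case: w => //= x p /H eH.
  by rewrite vset_cons_rcons -vset_cons.
elim: p x => //= y p IH x; rewrite inE => /orP[/eqP->|/IH eH].
  by apply/fintype.subsetP => z; rewrite !inE /= => /orP[/eqP->|/eqP->]; rewrite eqxx ?orbT.
by rewrite vset_cons; apply: fintype.subset_trans eH (finset.subsetUr _ _).
Qed.

Lemma cycle_vertices_le w : w != [::] ->
  (#|vset w| <= #|eset (cycle_edges w)|.+1)%N.
Proof.
case: w => // x p _.
have := @step_vertices_le x (rcons p x) [set x]%SET finset.set0.
rewrite !inE eqxx cards0 finset.set0U cards1 -vset_cons_rcons addn0 add1n; apply => //.
by move=> e; rewrite inE.
Qed.

(** The walk can be rotated to make the once-used edge its last step, which
returns to the start. Without this step the walk meets the same vertices over
one edge less. *)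
Lemma cycle_vertices_single_le w e : count_mem e (cycle_edges w) = 1%N ->
  (#|vset w| <= #|eset (cycle_edges w)|)%N.
Proof.
move=> e1.
have ew : e \in cycle_edges w by rewrite -has_pred1 has_count e1.
set t := index e (cycle_edges w).
have tw : (t < size (cycle_edges w))%N by rewrite index_mem.
rewrite -(vset_rot t.+1) -(eset_rot t.+1) -cycle_edges_rot.
have : count_mem e (cycle_edges (rot t.+1 w)) = 1%N.
  rewrite cycle_edges_rot -e1; apply/permP; exact/permPl/perm_rot.
have : last e (cycle_edges (rot t.+1 w)) = e.
  by rewrite cycle_edges_rot /rot last_cat (take_nth e tw) last_rcons nth_index.
case: (rot t.+1 w) => [//|x p] /=.
rewrite /cycle_edges /= step_pairs_rcons map_rcons last_rcons => ->.
rewrite -cats1 count_cat /= eqxx addn0 addn1 => -[/eqP].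
rewrite -leqn0 leqNgt -has_count has_pred1 => enp.
have := @step_vertices_le x p [set x]%SET finset.set0.
rewrite !inE eqxx cards0 finset.set0U cards1 -vset_cons addn0 add1n => H.
apply: leq_trans (H isT _) _; first by move=> ?; rewrite inE.
have -> : eset (map edge (step_pairs x p) ++ [:: e]) = (e |: eset (step_edges x p))%SET.
  by apply/setP => z; rewrite !inE mem_cat inE orbC.
by rewrite cardsU1 !inE enp.
Qed.

(** Rotated to start at a common vertex, the second walk only extends the
connected graph of the first one. *)
Lemma cycle_vertices_union_le w w' : has (mem w) w' ->
  (#|(vset w :|: vset w')%SET| + #|eset (cycle_edges w)| <=
   #|vset w| + #|(eset (cycle_edges w) :|: eset (cycle_edges w'))%SET|)%N.
Proof.
case/hasP => x xw' xw.
set t := index x w'.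
have tw : (t < size w')%N by rewrite index_mem.
rewrite -(vset_rot t w') -(eset_rot t (cycle_edges w')) -cycle_edges_rot.
rewrite /rot (drop_nth x)// nth_index//=; move: (drop _ _ ++ _) => p.
have -> : (vset w :|: vset (x :: p) = vset w :|: vset (rcons p x))%SET.
  rewrite vset_cons_rcons finset.setUA; congr finset.setU; apply/setP => z.
  by rewrite !inE orbC; case: eqP => // ->.
apply: (@step_vertices_le x (rcons p x)); first by rewrite inE.
by move=> e; rewrite inE; exact: cycle_edges_sub.
Qed.

End Words.

Definition nsingle {E : finType} (L : seq E) : nat :=
  #|[set e | count_mem e L == 1%N]%SET|.

Lemma sum_count_mem (E : finType) (L : seq E) :
  (\sum_e count_mem e L = size L)%N.
Proof.
elim: L => [|x L IH] /=; first by rewrite big1.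
by rewrite big_split/= IH (bigD1 x)//= eqxx big1 ?addn0// => y /negbTE; rewrite eq_sym => ->.
Qed.

(** An element that occurs only once is counted a second time in [nsingle]. *)
Lemma card_le_nsingle (E : finType) (L : seq E) :
  (2 * #|[set e in L]%SET| <= size L + nsingle L)%N.
Proof.
rewrite -sum_count_mem /nsingle -!sum1_card [X in (_ <= _ + X)%N]big_mkcond/=.
rewrite [X in (2 * X <= _)%N]big_mkcond/= -big_split/= big_distrr/=.
apply: leq_sum => e _; rewrite !inE -has_pred1 has_count.
by case: (count_mem e L) => [|[|m]].
Qed.

(** * Counting closed walks by their vertices *)

Lemma leq_wexp2r m n k : (m <= n -> m ^ k <= n ^ k)%N.
Proof. by case: k => // k mn; rewrite leq_exp2r. Qed.

Lemma sum_tuple_cons (V : finType) (M : nmodType) r (P : pred (seq V))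
    (F : seq V -> M) :
  \sum_(w : r.+1.-tuple V | P w) F w =
  \sum_x \sum_(p : r.-tuple V | P (x :: p)) F (x :: p).
Proof.
rewrite pair_big_dep/=.
rewrite (reindex (fun q : V * r.-tuple V => cons_tuple q.1 q.2))//=.
exists (fun w : r.+1.-tuple V => (thead w, behead_tuple w)).
  by case=> x p _; rewrite theadE; congr pair; apply: val_inj.
by move=> w _; rewrite [RHS]tuple_eta; apply: val_inj.
Qed.

Arguments sum_tuple_cons {V M r} P F.

Section WeightedCounting.
Context {R : realFieldType} {V : finType} (adj : rel V) (B : R).
Hypotheses (B_ge1 : 1 <= B) (degB : forall x, #|[pred y | adj x y]|%:R <= B).

Let B_gt0 : 0 < B. Proof. exact: lt_le_trans B_ge1. Qed.

Let Bi_ge0 : 0 <= B^-1. Proof. by rewrite invr_ge0 ltW. Qed.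
Let Bi_le1 : B^-1 <= 1. Proof. by rewrite invf_le1. Qed.

(** The weight 1 / B of a new vertex makes up for the number of its choices, so
that at every step all new vertices together contribute at most 1; each of the
vertices met before, at most #|H| + r in number, contributes at most 1 too. *)
Lemma sum_new_vertices_le x (H : {set V}) r : x \in H ->
  \sum_(p : r.-tuple V | path adj x p) B^-1 ^+ (#|(H :|: vset p)%SET| - #|H|)
  <= ((#|H| + r).+1 ^ r)%:R.
Proof.
elim: r x H => [|r IH] x H xH.
  rewrite expn0 (big_pred1 [tuple]); last by move=> p; rewrite tuple0 /= eqxx.
  exact: exprn_ile1.
rewrite (sum_tuple_cons (path adj x)
  (fun p => B^-1 ^+ (#|(H :|: vset p)%SET| - #|H|)))/=.
pose N := ((#|H| + r.+1).+1 ^ r)%:R : R.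
have step y : \sum_(p : r.-tuple V | adj x y && path adj y p)
    B^-1 ^+ (#|(H :|: vset (y :: p))%SET| - #|H|) <=
    N * ((y \in H)%:R + B^-1 * (adj x y)%:R).
  have [xy|xy] /= := boolP (adj x y); last first.
    by rewrite big_pred0_eq mulr_ge0// addr_ge0// mulr_ge0// invr_ge0 ltW.
  have [yH|yH] := boolP (y \in H).
    apply: (@le_trans _ _ N); last first.
      by rewrite mulr1 ler_peMr// lerDl invr_ge0 ltW.
    apply: le_trans (le_trans (IH y H yH) _); last first.
      by rewrite /N ler_nat leq_wexp2r// addnS.
    apply: ler_sum => p _; rewrite vset_cons finset.setUA.
    rewrite [(H :|: [set y])%SET](_ : _ = H)//.
    by apply/setP => z; rewrite !inE; case: eqP => [->|]; rewrite ?yH ?orbF.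
  rewrite add0r mulr1 mulrC.
  have yH' : y \in (H :|: [set y])%SET by rewrite !inE eqxx orbT.
  have cH' : #|(H :|: [set y])%SET| = #|H|.+1 by rewrite finset.setUC cardsU1 yH.
  have := IH y (H :|: [set y])%SET yH'; rewrite cH' => IHy.
  apply: le_trans (ler_wpM2l (ltW _) (le_trans IHy _)); last 2 first.
  - by rewrite invr_gt0.
  - by rewrite /N ler_nat -addSnnS.
  rewrite big_distrr/=; apply: ler_sum => p _.
  rewrite vset_cons finset.setUA -exprS -subSn; last first.
    by rewrite -cH' subset_leq_card// finset.subsetUl.
  by rewrite subSS.
apply: le_trans (ler_sum _ (fun y _ => step y)) _.
rewrite -mulr_sumr big_split/= -mulr_sumr -!natr_sum.
rewrite expnS natrM mulrC ler_wpM2r//.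
apply: (@le_trans _ _ (#|H|%:R + 1)); last first.
  by rewrite natr1 ler_nat ltnS leq_addr.
apply: lerD.
  by rewrite ler_nat -sum1_card [X in (_ <= X)%N]big_mkcond/= leq_sum// => y _; case: ifP.
rewrite mulrC ler_pdivrMr// mul1r.
apply: le_trans (degB x); rewrite ler_nat -sum1_card [X in (_ <= X)%N]big_mkcond/=.
by rewrite leq_sum// => y _; rewrite inE; case: ifP.
Qed.

(** The start of the walk is not chosen among neighbours and has no weight. *)
Definition walk_weight (w : seq V) := B^-1 ^+ (#|vset w|.-1).

Definition walk_const k : nat := k.+1 ^ k.

Lemma sum_cycles_le k :
  \sum_(w : k.+1.-tuple V | cycle adj w) walk_weight w
  <= (walk_const k.+1 * #|V|)%:R.
Proof.
rewrite (sum_tuple_cons (cycle adj) walk_weight).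
rewrite mulnC -sum1_card big_distrl/= natr_sum; apply: ler_sum => x _.
rewrite mul1n.
have xx : x \in [set x]%SET by rewrite inE.
have := @sum_new_vertices_le x [set x]%SET k xx; rewrite cards1 => H.
apply: le_trans (le_trans H _); last first.
  by rewrite /walk_const ler_nat (leq_trans (_ : _ <= k.+2 ^ k)%N)// leq_pexp2l.
rewrite [leRHS](bigID (fun p : k.-tuple V => path adj x (rcons p x)))/=.
rewrite ler_wpDr ?sumr_ge0//.
  by move=> p _; rewrite exprn_ge0// invr_ge0 ltW.
rewrite [leRHS](eq_bigl (fun p : k.-tuple V => path adj x (rcons p x))); last first.
  by move=> p /=; rewrite rcons_path; case: (path adj x p).
by apply: ler_sum => p _; rewrite -vset_cons subn1.
Qed.

(** The factor k * size w accounts for the position of a common vertex in w'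
and for its choice. After a rotation w' starts at this vertex. *)
Lemma sum_meeting_cycles_le (w : seq V) k :
  \sum_(w' : k.-tuple V | cycle adj w' && has (mem w) w')
     B^-1 ^+ (#|(vset w :|: vset w')%SET| - #|vset w|)
  <= (k * size w * (size w + k).+1 ^ k)%:R.
Proof.
case: k => [|k].
  by rewrite big_pred0// => w'; rewrite [w']tuple0.
pose F (w' : seq V) := B^-1 ^+ (#|(vset w :|: vset w')%SET| - #|vset w|).
have F0 w' : 0 <= F w' by rewrite exprn_ge0// invr_ge0 ltW.
(* rotation by q brings the q-th vertex to the head *)
have rot_sum (q : 'I_k.+1) :
    \sum_(w' : k.+1.-tuple V | cycle adj w' && (tnth w' q \in w)) F w' =
    \sum_(w' : k.+1.-tuple V | cycle adj w' && (head (tnth w' q) w' \in w)) F w'.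
  rewrite [RHS](reindex_inj (h := fun w' : k.+1.-tuple V => rot_tuple q w'))/=; last first.
    by move=> u v /(congr1 val)/= /rot_inj; exact: val_inj.
  apply: eq_big => [u|u _]; last by rewrite /F vset_rot.
  rewrite rot_cycle; congr (_ && (_ \in w)).
  rewrite (tnth_nth (thead u)) /rot (drop_nth (thead u))//=.
  by rewrite size_tuple.
have -> : (k.+1 * size w * (size w + k.+1).+1 ^ k.+1)%:R =
    \sum_(q < k.+1) (size w * (size w + k.+1).+1 ^ k.+1)%:R :> R.
  by rewrite sumr_const card_ord -[RHS]mulr_natl -natrM mulnA.
apply: (@le_trans _ _ (\sum_(q < k.+1)
    \sum_(w' : k.+1.-tuple V | cycle adj w' && (tnth w' q \in w)) F w')).
  under [leRHS]eq_bigr do rewrite big_mkcond/=.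
  rewrite exchange_big/= [leLHS]big_mkcond/=; apply: ler_sum => w' _.
  case: ifP => [/andP[cw /hasP[x /tnthP[q ->] qw]]|_]; last first.
    by apply: sumr_ge0 => q _; case: ifP.
  by rewrite (bigD1 q)//= cw (qw : _ \in _) lerDl sumr_ge0// => i _; case: ifP.
apply: ler_sum => q _; rewrite rot_sum.
apply: (@le_trans _ _ (\sum_(w' : k.+1.-tuple V |
     cycle adj w' && (head (thead w') w' \in w)) F w')).
  by rewrite (eq_bigl (fun w' : k.+1.-tuple V =>
     cycle adj w' && (head (thead w') w' \in w)))// => w'; case/tupleP: w'.
rewrite (eq_bigl (fun w' : k.+1.-tuple V =>
   (fun s => cycle adj s && (if s is x :: _ then x \in w else false)) w')); last first.
  by move=> w'; case/tupleP: w'.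
rewrite (sum_tuple_cons
   (fun s => cycle adj s && (if s is x :: _ then x \in w else false)) F)/=.
apply: (@le_trans _ _ (\sum_(x in vset w) ((size w + k.+1).+1 ^ k.+1)%:R)); last first.
  rewrite sumr_const -[leLHS]mulr_natl -natrM ler_nat leq_mul2r; apply/orP; right.
  by rewrite cardsE card_size.
rewrite [leRHS]big_mkcond/=; apply: ler_sum => x _; rewrite inE.
case: ifPn => xw; last first.
  by rewrite big_pred0// => p /=; rewrite andbF.
have xw' : x \in vset w by rewrite inE.
have := @sum_new_vertices_le x (vset w) k xw' => H.
apply: le_trans (le_trans H _); last first.
  rewrite ler_nat.
  have sw : (#|vset w| <= size w)%N by rewrite cardsE card_size.
  rewrite (leq_trans (_ : _ <= (size w + k.+1).+1 ^ k)%N)// ?leq_pexp2l//.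
  by rewrite leq_wexp2r//; lia.
rewrite [leRHS](bigID (fun p : k.-tuple V => path adj x (rcons p x)))/=.
rewrite ler_wpDr ?sumr_ge0//.
  by move=> p _; rewrite exprn_ge0// invr_ge0 ltW.
rewrite [leRHS](eq_bigl (fun p : k.-tuple V => path adj x (rcons p x))); last first.
  by move=> p /=; rewrite rcons_path; case: (path adj x p).
rewrite (eq_bigl (fun p : k.-tuple V => path adj x (rcons p x))); last first.
  by move=> p /=; rewrite andbT.
apply: ler_sum => p _; rewrite /F vset_cons finset.setUA.
rewrite [(vset w :|: [set x])%SET](_ : _ = vset w)//.
by apply/setP => z; rewrite !inE; case: eqP => [->|]; rewrite ?xw ?orbF.
Qed.

End WeightedCounting.

(** * Walks that cancel by immediate returns *)

(** The number of paths of r steps up or down by one that lead from height d to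
height 0 and stay nonnegative. *)
Fixpoint ballot (r d : nat) : nat :=
  if r is r'.+1 then ballot r' d.+1 + (if d is d'.+1 then ballot r' d' else 0)
  else d == 0%N.

Section Backtracking.
Context {V : finType}.
Implicit Types (x y : V) (p s w : seq V).

(** The stack s holds the vertices on the way back from x to the start, the
nearest first; a step from x to its head is a return, any other step extends it. *)
Definition turn x s y : seq V :=
  if s is z :: s' then if z == y then s' else x :: s else [:: x].

Fixpoint reduce x s p : seq V :=
  if p is y :: p' then reduce y (turn x s y) p' else s.

Definition reducible w : bool :=
  if w is x :: p then reduce x [::] (rcons p x) == [::] else false.

Lemma reduce_last x s p : reduce x s p = [::] -> last x p = last x s.
Proof.
elim: p x s => [|y p IH] x s /=; first by move=> ->.
move=> /IH ->; case: s => //= z s.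
by case: eqP => [->|].
Qed.

(** A return cancels two uses of the same edge, which preserves all parities. *)
Lemma odd_count_reduce x s p e : reduce x s p = [::] ->
  odd (count_mem e (step_edges x p)) = odd (count_mem e (step_edges x s)).
Proof.
elim: p x s => [|y p IH] x s; first by move=> /= ->.
move=> /= H; rewrite /step_edges/= -/(step_edges _ _) oddD (IH _ _ H).
have push : odd (edge (x, y) == e) (+)
    odd (count_mem e (step_edges y (x :: s))) = odd (count_mem e (step_edges x s)).
  rewrite /step_edges/= -/(step_edges _ _) oddD addbA.
  have -> : edge (y, x) = edge (x, y) by rewrite /edge/= finset.setUC.
  by rewrite addbb.
case: s H push => [|z s] //= H push.
case: (z =P y) => [->|_]; last exact: push.
by rewrite /step_edges/= -/(step_edges _ _) oddD.
Qed.

Lemma reducible_nsingle w : reducible w -> nsingle (cycle_edges w) = 0%N.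
Proof.
case: w => // x p /eqP H; apply/eqP; rewrite /nsingle cards_eq0; apply/eqP/setP => e.
have /= := odd_count_reduce e H.
rewrite !inE => odde; apply/eqP => c1.
by move: odde; rewrite -/(cycle_edges (x :: p)) /step_edges -/(cycle_edges (x :: p)) c1.
Qed.

(** With par as parent map of a tree rooted at x0, the stack s lists the ancestors
of x. *)
Fixpoint ancestry (par : V -> V) x0 x s : bool :=
  if s is z :: s' then [&& x != x0, z == par x & ancestry par x0 z s'] else x == x0.

(** The assumption on cardinalities is opposite to [step_vertices_le], so it leaves
no room for a new edge between old vertices: all edges met so far are those
between z and par z. An old edge thus leads to the parent, a return, or to a
child, and the stack remains the list of ancestors. *)
Lemma ancestry_reduce (par : V -> V) x0 x s p (H : {set V}) (E : {set {set V}}) :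
  x0 \in H -> {subset x :: s <= H} -> ancestry par x0 x s ->
  (forall e, e \in E -> exists z, [/\ z \in H, z != x0, par z \in H & e = [set z; par z]%SET]) ->
  (#|H| + #|(E :|: eset (step_edges x p))%SET| <= #|(H :|: vset p)%SET| + #|E|)%N ->
  exists par', ancestry par' x0 (last x p) (reduce x s p).
Proof.
elim: p par x s H E => [|y p IH] par x s H E x0H xsH anc EH; first by exists par.
have xH : x \in H by apply: xsH; rewrite inE eqxx.
have EsubH e : e \in E -> e \subset H.
  move=> /EH[z [zH _ pH ->]]; apply/fintype.subsetP => u.
  by rewrite !inE => /orP[/eqP->|/eqP->].
set E' := (E :|: [set [set x; y]])%SET; set H' := (H :|: [set y])%SET.
have -> : (H :|: vset (y :: p) = H' :|: vset p)%SET.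
  by apply/setP => z; rewrite !inE orbA.
have -> : (E :|: eset (step_edges x (y :: p)) = E' :|: eset (step_edges y p))%SET.
  by apply/setP => z; rewrite !inE orbA.
have yH' : y \in H' by rewrite !inE eqxx orbT.
have EH' : forall e, e \in E' -> e \subset H'.
  move=> e; rewrite !inE => /orP[eE|/eqP->].
    exact: fintype.subset_trans (EsubH _ eE) (finset.subsetUl _ _).
  by apply/fintype.subsetP => z; rewrite !inE => /orP[/eqP->|/eqP->];
    rewrite ?xH ?eqxx ?orbT.
have := @step_vertices_le _ y p H' E' yH' EH'.
have [yH|yH] := boolP (y \in H) => /=.
  have HH' : H' = H by apply/setP => z; rewrite !inE; case: eqP => [->|]; rewrite ?yH ?orbF.
  (* a new edge between old vertices contradicts the bound on cardinalities *)
  have [xyE|xyE] := boolP ([set x; y]%SET \in E); last first.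
    have -> : #|E'| = #|E|.+1 by rewrite /E' finset.setUC cardsU1 xyE.
    by rewrite HH' => le1 le2; have := leq_trans le1 le2; rewrite addnS ltnn.
  have EE' : E' = E by apply/setP => z; rewrite !inE; case: eqP => [->|]; rewrite ?xyE ?orbF.
  rewrite HH' EE' => _.
  have [z [zH zx0 pzH exy]] := EH _ xyE.
  have : (x = z /\ y = par z) \/ (y = z /\ x = par z).
    have : x \in [set z; par z]%SET by rewrite -exy !inE eqxx.
    have : y \in [set z; par z]%SET by rewrite -exy !inE eqxx orbT.
    have : z \in [set x; y]%SET by rewrite exy !inE eqxx.
    have : par z \in [set x; y]%SET by rewrite exy !inE eqxx orbT.
    rewrite !inE => /orP[]/eqP e1 /orP[]/eqP e2 /orP[]/eqP e3 /orP[]/eqP e4;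
      first [by left; split; congruence|by right; split; congruence].
  (* the step goes to the parent, or else to a child *)
  case=> [[xz yz]|[yz xz]].
    subst z; case: s xsH anc => [|z s] xsH /=; first by rewrite (negbTE zx0).
    move=> /and3P[_ /eqP zx anc]; rewrite zx -yz eqxx.
    apply: (IH par) => //; last by rewrite yz -zx.
    by move=> u us; apply: xsH; rewrite inE zx -yz us orbT.
  subst z; case: s xsH anc => [|z s] xsH /= anc.
    apply: (IH par) => //=; last by rewrite zx0 -xz eqxx.
    by move=> u; rewrite !inE => /orP[/eqP->|/eqP->].
  (* par may exchange x and y, in which case the step is a return as well *)
  have [zy|zy] := eqVneq z y.
    apply: (IH par) => //; last by case/and3P: anc => _ _; rewrite zy.
    by move=> u us; apply: xsH; rewrite inE zy us orbT.
  apply: (IH par) => //=; last by rewrite zx0 -xz eqxx anc.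
  by move=> u; rewrite inE => /orP[/eqP->//|]; exact: xsH.
(* y is a new vertex, which becomes a child of x *)
have xyE : [set x; y]%SET \notin E.
  apply/negP => /EsubH /fintype.subsetP/(_ y); rewrite !inE eqxx orbT => /(_ isT).
  exact/negP.
have cH' : #|H'| = #|H|.+1 by rewrite /H' finset.setUC cardsU1 yH.
have cE' : #|E'| = #|E|.+1 by rewrite /E' finset.setUC cardsU1 xyE.
move=> _ le1; pose par' z := if z == y then x else par z.
have turnE : turn x s y = x :: s.
  case: s xsH {anc} => //= z s xsH; case: eqP => // zy.
  by move: yH; rewrite -zy xsH// !inE eqxx orbT.
have HH' : {subset H <= H'} by move=> u uH; rewrite !inE uH.
rewrite turnE; apply: (IH par' y (x :: s) H' E').
- exact: HH'.
- by move=> u; rewrite inE => /orP[/eqP->//|/xsH/HH'].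
- have yx0 : y != x0 by apply: contraNneq yH => ->.
  have anc' : forall u s', {subset u :: s' <= H} -> ancestry par x0 u s' ->
      ancestry par' x0 u s'.
    move=> u s'; elim: s' u => //= v s' IHs u us /and3P[-> /eqP vu av].
    have uy : u != y by apply: contraNneq yH => <-; apply: us; rewrite inE eqxx.
    rewrite /par' (negbTE uy) -vu eqxx/=; apply: IHs => //.
    by move=> t ts; apply: us; rewrite inE ts orbT.
  by rewrite /= yx0 {1}/par' eqxx eqxx/= anc'.
- move=> e; rewrite !inE => /orP[/EH[z [zH zx0 pzH ->]]|/eqP->].
    exists z; have zy : z != y by apply: contraNneq yH => <-.
    by rewrite /par' (negbTE zy); split => //; exact: HH'.
  exists y; rewrite /par' eqxx; split => //; last by rewrite finset.setUC.
    by apply: contraNneq yH => ->.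
  exact: HH'.
- by rewrite cH' cE' addSn addnS ltnS.
Qed.

(** The walk ends at its start, the root, whose list of ancestors is empty. *)
Lemma tree_reducible w : w != [::] ->
  (#|eset (cycle_edges w)| < #|vset w|)%N -> reducible w.
Proof.
case: w => // x p _; rewrite vset_cons_rcons => lt1.
have [] := @ancestry_reduce id x x [::] (rcons p x) [set x]%SET finset.set0.
- by rewrite inE.
- by move=> u; rewrite !inE.
- exact: eqxx.
- by move=> e; rewrite inE.
- by rewrite cards0 finset.set0U cards1 addn0 add1n.
move=> par; rewrite last_rcons /=; case: reduce => //= z s.
by rewrite eqxx.
Qed.

End Backtracking.

(** * Counting reducible walks *)

Section CountReducible.
Context {R : realFieldType} {V : finType} (adj : rel V).
Implicit Types (x y : V) (s : seq V).

(** The stack is a parameter because the recursion on the length meets all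
stacks. *)
Definition closings r x s : R :=
  \sum_(p : r.-tuple V | path adj x p && (reduce x s p == [::])) 1.

Lemma closings0 x s : closings 0 x s = (s == [::])%:R.
Proof.
rewrite /closings; case: (s =P [::]) => [->|/eqP sN].
  by rewrite (big_pred1 [tuple])// => p; rewrite tuple0 /= eqxx.
by rewrite big_pred0// => p; rewrite tuple0 /= (negbTE sN).
Qed.

Lemma closingsS r x s :
  closings r.+1 x s = \sum_(y | adj x y) closings r y (turn x s y).
Proof.
rewrite /closings (sum_tuple_cons
  (fun p => path adj x p && (reduce x s p == [::])) (fun=> 1))/=.
rewrite [RHS]big_mkcond/=; apply: eq_bigr => y _.
case: ifP => xy; last by rewrite big_pred0.
by apply: eq_bigl.
Qed.

(** The recursion of [closings_le] from below, where ok r x stands for a vertex from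
which r steps meet only vertices of large degree. One of the b^2 + 1 neighbours
may be the head of the stack, a step to which does not extend it. *)
Lemma closings_ge0 r x s : 0 <= closings r x s.
Proof. by rewrite sumr_ge0. Qed.

Lemma card_reducible k :
  \sum_(w : k.+1.-tuple V | cycle adj w && reducible w) 1 =
  \sum_x closings k.+1 x [::].
Proof.
rewrite (sum_tuple_cons (fun w => cycle adj w && reducible w) (fun=> 1))/=.
apply: eq_bigr => x _; rewrite /closings.
rewrite [RHS](reindex_onto (fun p : k.-tuple V => rcons_tuple p x)
  (fun p : k.+1.-tuple V => belast_tuple (thead p) (behead_tuple p)))/=.
  apply: eq_bigl => p.
  rewrite [X in _ = _ && X](_ : _ = true) ?andbT//; apply/eqP/val_inj => /=.
  rewrite /thead (tnth_nth x)/=; case: (tval p) => //= y q.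
  by rewrite belast_rcons.
move=> p /andP[_ /eqP/reduce_last]; case/tupleP: p => y q /= lq.
by apply: val_inj; rewrite /= theadE [RHS]lastI lq.
Qed.

(** A step that extends the stack has at most b^2 choices and a return has one.
The weight b ^+ size s of the stack distributes this evenly, a factor b to each
step, and what remains is the recursion of ballot numbers. *)
Lemma closings_le (b : R) r x s : 0 < b ->
  (forall x, #|[pred y | adj x y]|%:R <= b ^+ 2) ->
  closings r x s * b ^+ size s <= (ballot r (size s))%:R * b ^+ r.
Proof.
move=> b0 deg; elim: r x s => [|r IH] x s.
  rewrite closings0 expr0 mulr1 /=; case: s => [|z s] /=; first by rewrite expr0 mulr1.
  by rewrite mul0r.
have push y : closings r y (x :: s) * b ^+ (size s) * b <=
     (ballot r (size s).+1)%:R * b ^+ r.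
  by have := IH y (x :: s); rewrite /= exprSr mulrA.
have sum_push (D : pred V) : (\sum_(y | adj x y && D y) closings r y (x :: s)) * b ^+ size s
    <= (ballot r (size s).+1)%:R * b ^+ r.+1.
  have b20 : 0 < b ^+ 2 by rewrite exprn_gt0.
  have pushy y : closings r y (x :: s) * b ^+ (size s) <=
      (ballot r (size s).+1)%:R * b ^+ r.+1 / b ^+ 2.
    rewrite ler_pdivlMr// [b ^+ r.+1]exprSr [leRHS]mulrA expr2 [leLHS]mulrA.
    by rewrite ler_pM2r.
  rewrite mulr_suml; apply: le_trans (ler_sum _ (fun y _ => pushy y)) _.
  rewrite sumr_const -[leLHS]mulr_natr -[leLHS]mulrA ler_piMr//.
    by rewrite mulr_ge0// exprn_ge0// ltW.
  rewrite mulrC ler_pdivrMr// mul1r; apply: le_trans (deg x); rewrite ler_nat.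
  by apply: subset_leq_card; apply/fintype.subsetP => y /andP[].
rewrite closingsS; case: s push sum_push => [|z s] push sum_push.
  rewrite /= addn0; apply: le_trans (sum_push predT).
  by rewrite (eq_bigl (fun y => adj x y && true))// => y; rewrite andbT.
rewrite (bigID (fun y => z == y))/= mulrDl natrD mulrDl addrC lerD//.
  rewrite (eq_bigr (fun y => closings r y (x :: z :: s))); first exact: sum_push.
  by move=> y /andP[_ /negbTE ->].
have [xz|xz] := boolP (adj x z); last first.
  rewrite big_pred0; first by rewrite mul0r mulr_ge0// exprn_ge0// ltW.
  by move=> y; apply/negbTE; apply: contra xz => /andP[xy /eqP ->].
rewrite (big_pred1 z); last first.
  by move=> y; rewrite eq_sym /=; case: eqP => [->|]; rewrite ?xz ?andbF.
by rewrite eqxx exprSr mulrA [b ^+ r.+1]exprSr [leRHS]mulrA ler_pM2r.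
Qed.

Lemma closings_ge (b : R) (ok : nat -> pred V) r x s : 0 < b -> symmetric adj ->
  (forall r x, ok r.+1 x -> b ^+ 2 + 1 <= #|[pred y | adj x y]|%:R) ->
  (forall r x y, ok r.+1 x -> adj x y -> ok r y) ->
  ok r x -> path adj x s ->
  (ballot r (size s))%:R * b ^+ r <= closings r x s * b ^+ size s.
Proof.
move=> b0 sym deg step; elim: r x s => [|r IH] x s okx xs.
  by rewrite closings0 expr0 mulr1 /=; case: s xs => [|z s] /=; rewrite ?mul0r// expr0 mulr1.
have sum_push (z : V) : (ballot r (size s).+1)%:R * b ^+ r.+1 <=
     (\sum_(y | adj x y && (z != y)) closings r y (x :: s)) * b ^+ size s.
  have b20 : 0 < b ^+ 2 by rewrite exprn_gt0.
  have pushy y : adj x y -> (ballot r (size s).+1)%:R * b ^+ r.+1 / b ^+ 2 <=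
      closings r y (x :: s) * b ^+ (size s).
    move=> xy; have := IH y (x :: s); rewrite /= sym xy => /(_ (step _ _ _ okx xy) xs) H.
    rewrite ler_pdivrMr// [b ^+ r.+1]exprSr [leLHS]mulrA expr2 [leRHS]mulrA ler_pM2r//.
    by rewrite -mulrA -exprSr.
  rewrite mulr_suml.
  apply: le_trans (ler_sum _ (fun y (h : adj x y && (z != y)) => pushy y (proj1 (andP h)))).
  rewrite sumr_const -[leRHS]mulr_natr -[leRHS]mulrA ler_peMr//.
    by rewrite mulr_ge0// exprn_ge0// ltW.
  rewrite mulrC ler_pdivlMr// mul1r -(lerD2r 1).
  apply: le_trans (deg _ _ okx) _; rewrite natr1 ler_nat -[leqRHS]add1n.
  rewrite (cardD1 z [pred y | adj x y]) leq_add ?leq_b1//.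
  by apply: subset_leq_card; apply/fintype.subsetP => y; rewrite !inE => /andP[yz xy]; rewrite unfold_in /= eq_sym yz andbT.
rewrite closingsS; case: s xs sum_push => [|z s] xs sum_push.
  rewrite /= addn0; apply: le_trans (sum_push x) _.
  rewrite ler_wpM2r ?expr0//.
  rewrite [leRHS](bigID (fun y => x == y))/= addrC lerDl sumr_ge0// => y _.
  exact: closings_ge0.
move: xs => /= /andP[xz zs].
rewrite (bigID (fun y => z == y))/= mulrDl natrD mulrDl addrC lerD//.
  rewrite (big_pred1 z); last first.
    by move=> y; rewrite eq_sym /=; case: eqP => [->|]; rewrite ?xz ?andbF.
  rewrite eqxx exprSr mulrA [b ^+ (size s).+1]exprSr [leRHS]mulrA ler_pM2r//.
  exact: (IH z s (step _ _ _ okx xz) zs).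
apply: le_trans (sum_push z) _; rewrite le_eqVlt; apply/orP; left; apply/eqP.
by congr (_ * _); apply: eq_bigr => y /andP[_ /negbTE ->].
Qed.

End CountReducible.

Local Open Scope classical_set_scope.
Local Open Scope ring_scope.

(** * Reducible walks in the band *)

Definition band {n} (m : nat) (i j : 'I_n) : bool := (`|i%:Z - j%:Z| <= m - 1)%N.

Lemma band_sym n m : symmetric (@band n m).
Proof. by move=> i j; rewrite /band distnC. Qed.

Lemma card_ord_interval n a c :
  #|[pred j : 'I_n | (a <= j < c)%N]| = (minn c n - a)%N.
Proof.
rewrite -sum1_card big_mkcond/=.
elim: n => [|n IH]; first by rewrite big_ord0 minn0 sub0n.
by rewrite big_ord_recr/= IH inE /=; case: ifP; lia.
Qed.

Lemma card_band n m (i : 'I_n) : (0 < m)%N ->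
  #|[pred j | band m i j]| = (minn (i + m) n - (i - (m - 1)))%N.
Proof.
move=> m0; rewrite -card_ord_interval; apply: eq_card => j.
by rewrite !inE /band; lia.
Qed.

Lemma cvg_exprn (R : realType) (u : nat -> R) (l : R) k :
  u n @[n --> \oo] --> l -> u n ^+ k @[n --> \oo] --> l ^+ k.
Proof.
by move=> ul; apply: (cvg_comp u (fun x => x ^+ k) ul); exact: exprn_continuous.
Qed.

Section BandCount.
Context {R : realType} (h : nat -> nat).
Hypotheses (hh : halfwidths h) (h_oo : h n @[n --> \oo] --> \oo)
  (h_lim : (h n)%:R / n%:R @[n --> \oo] --> (0 : R)
        \/ (h n)%:R / n%:R @[n --> \oo] --> (1 : R)).

Definition bw n : R := (bandwidth n (h n))%:R.

Lemma bw_ge1 n : (0 < n)%N -> 1 <= bw n.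
Proof. by move=> n0; have := hh n0; rewrite /bw /bandwidth ler1n; lia. Qed.

Lemma card_band_le n (i : 'I_n) : #|[pred j | band (h n) i j]|%:R <= bw n.
Proof.
have n0 : (0 < n)%N by apply: leq_trans (ltn_ord i).
have /andP[h1 hn] := hh n0; rewrite card_band// /bw /bandwidth ler_nat.
by have := ltn_ord i; lia.
Qed.

Lemma h_le_bw n : (0 < n)%N -> (h n)%:R <= bw n.
Proof. by move=> n0; have := hh n0; rewrite /bw /bandwidth ler_nat; lia. Qed.

Lemma bw_le n : bw n <= n%:R.
Proof. by rewrite /bw /bandwidth ler_nat geq_minr. Qed.

Lemma hV_cvg0 : (h n)%:R^-1 @[n --> \oo] --> (0 : R).
Proof.
apply/gtr0_cvgV0; last exact/cvgrnyP.
near=> n; rewrite ltr0n.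
have n0 : (0 < n)%N by near: n; exists 1%N.
by have /andP[] := hh n0.
Unshelve. all: end_near. Qed.

Definition reducible_density k n : R :=
  (\sum_(w : k.+1.-tuple 'I_n | cycle (band (h n)) w && reducible w) 1) /
  (n%:R * Num.sqrt (bw n) ^+ k.+1).

Lemma reducible_density_le k n : (0 < n)%N ->
  reducible_density k n <= (ballot k.+1 0)%:R.
Proof.
move=> n0; have b1 := bw_ge1 n0.
have sb0 : 0 < Num.sqrt (bw n) by rewrite sqrtr_gt0 (lt_le_trans _ b1).
rewrite /reducible_density card_reducible ler_pdivrMr; last first.
  by rewrite mulr_gt0 ?ltr0n// exprn_gt0.
have H (x : 'I_n) : closings (band (h n)) k.+1 x [::] <=
    (ballot k.+1 0)%:R * Num.sqrt (bw n) ^+ k.+1.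
  have := @closings_le R _ (band (h n)) _ k.+1 x [::] sb0.
  rewrite expr0 mulr1; apply => i.
  by rewrite sqr_sqrtr ?card_band_le// (le_trans _ b1).
apply: le_trans (ler_sum _ (fun x _ => H x)) _.
by rewrite sumr_const card_ord -[leLHS]mulr_natl mulrCA.
Qed.

(** Only walks that start in ok k.+1 are counted. All rows from which they take a
step have at least g + 1 entries in the band, one of which is left to returns. *)
Lemma reducible_density_ge k n (g : R) (ok : nat -> pred 'I_n) : (0 < n)%N -> 0 < g ->
  g <= bw n ->
  (forall r x, ok r.+1 x -> g + 1 <= #|[pred y | band (h n) x y]|%:R) ->
  (forall r x y, ok r.+1 x -> band (h n) x y -> ok r y) ->
  #|ok k.+1|%:R / n%:R * (ballot k.+1 0)%:R * (g / bw n) ^+ k.+1 <=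
  reducible_density k n.
Proof.
move=> n0 g0 gb deg step; have b1 := bw_ge1 n0.
have sb0 : 0 < Num.sqrt (bw n) by rewrite sqrtr_gt0 (lt_le_trans _ b1).
have sg0 : 0 < Num.sqrt g by rewrite sqrtr_gt0.
have b0 := lt_le_trans ltr01 b1.
apply: (@le_trans _ _ (#|ok k.+1|%:R / n%:R * (ballot k.+1 0)%:R *
    (Num.sqrt g / Num.sqrt (bw n)) ^+ k.+1)).
  rewrite ler_wpM2l// ?mulr_ge0// ?invr_ge0//.
  rewrite lerXn2r ?nnegrE ?divr_ge0 ?(ltW b0) ?(ltW g0) ?sqrtr_ge0//.
  have -> : g / bw n = (Num.sqrt g / Num.sqrt (bw n)) ^+ 2.
    by rewrite expr_div_n !sqr_sqrtr// ltW.
  rewrite expr2 ler_piMr ?divr_ge0 ?sqrtr_ge0//.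
  by rewrite ler_pdivrMr// mul1r ler_sqrt// ltW.
rewrite /reducible_density card_reducible ler_pdivlMr; last first.
  by rewrite mulr_gt0 ?ltr0n// exprn_gt0.
rewrite expr_div_n.
have H (x : 'I_n) : x \in ok k.+1 -> (ballot k.+1 0)%:R * Num.sqrt g ^+ k.+1 <=
    closings (band (h n)) k.+1 x [::].
  move=> okx.
  have := @closings_ge R _ (band (h n)) _ ok k.+1 x [::] sg0 (@band_sym _ _).
  rewrite expr0 mulr1; apply => //.
  by move=> r y oky; rewrite sqr_sqrtr ?(ltW g0)//; exact: deg oky.
rewrite [leRHS](bigID (mem (ok k.+1))).
rewrite ler_wpDr ?sumr_ge0// => [x _|]; first exact: closings_ge0.
apply: (@le_trans _ _ (\sum_(x in ok k.+1) closings (band (h n)) k.+1 x [::])) => //.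
apply: le_trans (ler_sum _ H); rewrite (sumr_const (ok k.+1)) -[leRHS]mulr_natl.
rewrite le_eqVlt; apply/orP; left; apply/eqP; field.
by rewrite ?pnatr_eq0 -?lt0n ?n0 ?gt_eqF ?exprn_gt0.
Qed.

(** If h n / n tends to 0, all but a vanishing share of the rows are so far from
both ends that k.+1 steps do not leave the rows with 2 h n - 1 entries. If it
tends to 1, every row has at least h n entries, while the bandwidth is at most n.
In both cases the bounds on the degrees are equivalent to the bandwidth. *)
Lemma reducible_density_cvg k :
  reducible_density k n @[n --> \oo] --> ((ballot k.+1 0)%:R : R).
Proof.
set D : R := (ballot k.+1 0)%:R.
have h1V : \forall n \near \oo, (h n)%:R^-1 <= 1 :> R.
  exists 1%N => // n /= n0; have /andP[h1 _] := hh n0.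
  by rewrite invf_le1 ?ltr0n ?ler1n.
have nV : n%:R^-1 @[n --> \oo] --> (0 : R).
  by apply/gtr0_cvgV0; [exists 1%N => // n /=; rewrite ltr0n|exact/cvgrnyP/cvg_id].
have h_ge2 : \forall n \near \oo, (2 <= h n)%N by move/cvgnyPge : h_oo; exact.
case: h_lim => hl.
- pose l n := (1 - 2 * (k.+1)%:R * ((h n)%:R / n%:R)) * D * (1 - (h n)%:R^-1) ^+ k.+1 : R.
  have lD : l n @[n --> \oo] --> D.
    rewrite -[X in _ --> X](_ : (1 - 2 * (k.+1)%:R * 0) * D * (1 - 0) ^+ k.+1 = D); last first.
      by rewrite mulr0 subr0 expr1n mul1r mulr1.
    apply: cvgM; first by apply: cvgMl; apply: cvgB; [exact: cvg_cst|exact: cvgMr].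
    by apply: cvg_exprn; apply: cvgB; [exact: cvg_cst|exact: hV_cvg0].
  apply: (@squeeze_cvgr _ _ _ _ l (cst D)) => //; last exact: cvg_cst.
  near=> n.
  have n0 : (0 < n)%N by near: n; exists 1%N.
  have h2 : (2 <= h n)%N by near: n.
  have /andP[_ hn] := hh n0.
  rewrite reducible_density_le// andbT.
  have b1 := bw_ge1 n0; have b0 := lt_le_trans ltr01 b1.
  have hV1 : (h n)%:R^-1 <= 1 :> R by near: n.
  have g0 : 0 < (2 * h n - 2)%:R :> R by rewrite ltr0n; lia.
  (* r steps, each one by less than h n, are taken from full rows only *)
  pose ok r := [pred i : 'I_n | (r * h n <= i < n - r * h n)%N].
  have cok : 1 - 2 * k.+1%:R * ((h n)%:R / n%:R) <= #|ok k.+1|%:R / n%:R :> R.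
    rewrite card_ord_interval ler_pdivlMr ?ltr0n// mulrBl mul1r.
    rewrite -[X in _ - X <= _]mulrA divfK ?pnatr_eq0 -?lt0n// lerBlDr -natrM -natrM -natrD ler_nat.
    by rewrite (minn_idPl (leq_subr _ _)); lia.
  have h2n : (2 * h n <= n)%N.
    have : (h n)%:R / n%:R < 2^-1 :> R by near: n; apply: (cvgr_lt 0 hl).
    rewrite ltr_pdivrMr ?ltr0n// mulrC ltr_pdivlMr// -natrM ltr_nat; lia.
  have gb : (2 * h n - 2)%:R <= bw n.
    by rewrite /bw /bandwidth ler_nat; lia.
  apply: le_trans (@reducible_density_ge k n _ ok n0 g0 gb _ _); last 2 first.
  - move=> r x /andP[/= rx xr]; rewrite natr1 ler_nat card_band; last by lia.
    by move: rx xr; rewrite mulSn; move: (r * h n)%N => rh; lia.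
  - move=> r x y /andP[/= rx xr]; rewrite /band => xy; rewrite /ok/=.
    by move: rx xr; rewrite mulSn; move: (r * h n)%N => rh; lia.
  rewrite /l -/D -[leLHS]mulrA -[leRHS]mulrA.
  apply: (@le_trans _ _ (#|ok k.+1|%:R / n%:R * (D * (1 - (h n)%:R^-1) ^+ k.+1))).
    by rewrite ler_wpM2r// mulr_ge0 ?exprn_ge0 ?subr_ge0 ?ler0n.
  rewrite ler_wpM2l ?divr_ge0 ?ler0n// ler_wpM2l ?ler0n//.
  rewrite lerXn2r ?nnegrE ?subr_ge0 ?divr_ge0 ?(ltW b0)//.
  have h0 : 0 < (h n)%:R :> R by rewrite ltr0n; lia.
  rewrite ler_pdivlMr//.
  apply: (@le_trans _ _ ((1 - (h n)%:R^-1) * (2 * h n - 1)%:R)).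
    rewrite ler_wpM2l ?subr_ge0// /bw /bandwidth ler_nat; lia.
  rewrite -(ler_pM2l h0) mulrA mulrBr mulr1 mulfV ?gt_eqF//.
  have -> : (h n)%:R - 1 = (h n - 1)%:R :> R by rewrite natrB//; lia.
  by rewrite -!natrM ler_nat; nia.
- pose l n := D * ((h n)%:R / n%:R - n%:R^-1) ^+ k.+1 : R.
  have lD : l n @[n --> \oo] --> D.
    rewrite -[X in _ --> X](_ : D * (1 - 0) ^+ k.+1 = D); last first.
      by rewrite subr0 expr1n mulr1.
    apply: cvgMr.
    by apply: cvg_exprn; exact: cvgB.
  apply: (@squeeze_cvgr _ _ _ _ l (cst D)) => //; last exact: cvg_cst.
  near=> n.
  have n0 : (0 < n)%N by near: n; exists 1%N.
  have h2 : (2 <= h n)%N by near: n.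
  have /andP[_ hn] := hh n0.
  rewrite reducible_density_le// andbT.
  have b1 := bw_ge1 n0; have b0 := lt_le_trans ltr01 b1.
  have g0 : 0 < (h n - 1)%:R :> R by rewrite ltr0n; lia.
  have gb : (h n - 1)%:R <= bw n by rewrite /bw /bandwidth ler_nat; lia.
  apply: le_trans (@reducible_density_ge k n _ (fun=> predT) n0 g0 gb _ _); last 2 first.
  - move=> _ x _; rewrite natr1 ler_nat card_band; last by lia.
    by have := ltn_ord x; lia.
  - by [].
  rewrite -[#|_|]/(#|'I_n|) card_ord mulfV ?pnatr_eq0 -?lt0n// mul1r ler_wpM2l//.
  have n0' : 0 < n%:R :> R by rewrite ltr0n.
  rewrite -[X in _ - X]mul1r -mulrBl.
  have -> : (h n)%:R - 1 = (h n - 1)%:R :> R by rewrite natrB//; lia.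
  rewrite lerXn2r ?nnegrE ?divr_ge0 ?(ltW b0)//.
  by rewrite ler_wpM2l// lef_pV2 ?posrE// bw_le.
Unshelve. all: end_near. Qed.

End BandCount.

(** * Mean of the product of entries along a walk *)

Lemma trace_expr (R : comNzRingType) n (A : 'M[R]_n) k :
  \tr (A ^+ k.+1) =
  \sum_(w : k.+1.-tuple 'I_n) \prod_(q <- cycle_pairs w) A q.1 q.2.
Proof.
have entry x y : (A ^+ k.+1) x y = \sum_(p : k.-tuple 'I_n)
    \prod_(q <- step_pairs x (rcons p y)) A q.1 q.2.
  elim: k x => [|k IH] x.
    rewrite (big_pred1 [tuple]) /= ?big_seq1// => p.
    by rewrite [p]tuple0 /= eqxx.
  rewrite exprS -[A * _]/(A *m _) mxE.
  rewrite (sum_tuple_cons predT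
    (fun p => \prod_(q <- step_pairs x (rcons p y)) A q.1 q.2))/=.
  apply: eq_bigr => z _; rewrite IH big_distrr/=.
  by apply: eq_bigr => p _; rewrite big_cons.
rewrite /mxtrace (sum_tuple_cons predT (fun w => \prod_(q <- cycle_pairs w) A q.1 q.2)).
by apply: eq_bigr => x _; rewrite entry.
Qed.

Lemma cycle_all (V : finType) (e : rel V) (w : seq V) :
  cycle e w = all (fun q => e q.1 q.2) (cycle_pairs w).
Proof.
case: w => //= x p; move: (rcons p x) => s.
by elim: s x => //= y s IH z; rewrite IH.
Qed.

Section WordMoments.
Context {d : measure_display} {T : measurableType d} {R : realType}
  {P : probability T R}
  (a : forall n, 'I_n -> 'I_n -> {RV P >-> R})
  (C : nat -> R) (Cl : nat -> nat -> R) (ha : approx_uncorrelated a C Cl).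

Definition word n (L : seq ('I_n * 'I_n)) (t : T) : R := \prod_(q <- L) a q.1 q.2 t.

Lemma word_cat n (L L' : seq ('I_n * 'I_n)) t : word (L ++ L') t = word L t * word L' t.
Proof. by rewrite /word big_cat. Qed.

Lemma measurable_word n (L : seq ('I_n * 'I_n)) : measurable_fun setT (word L).
Proof. by apply: measurable_prod => q _. Qed.

(** Steps over the same edge carry the same entry because of symmetry. Grouped by
edges, the product is one of powers of entries at fundamentally different
positions, to which the hypotheses on mixed moments apply. *)
Lemma word_factor n (L : seq ('I_n * 'I_n)) : L != [::] ->
  exists l (p : 'I_l -> 'I_n * 'I_n) (delta : 'I_l -> nat),
  [/\ (0 < l)%N, fundamentally_different p & l = #|eset (map edge L)|] /\
  [/\ forall i, exists2 e, e \in map edge L & delta i = count_mem e (map edge L),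
      forall t, word L t = \prod_(i < l) a (p i).1 (p i).2 t ^+ delta i,
      (\sum_(i < l) delta i = size L)%N &
      #|[set i | delta i == 1%N]%SET| = nsingle (map edge L)].
Proof.
case: L => // q0 L0 _; set L := q0 :: L0; set M := map edge L.
(* rep chooses an orientation for every edge *)
pose u := undup M; pose rep e := odflt q0 [pick q | edge q == e].
have repE q : edge (rep (edge q)) = edge q.
  by rewrite /rep; case: pickP => [q' /eqP//|/(_ q)]; rewrite eqxx.
have edge_eq (q q' : 'I_n * 'I_n) : edge q = edge q' -> (q = q') \/ (q = (q'.2, q'.1)).
  case: q q' => [x y] [x' y']; rewrite /edge /= => E.
  have : x \in [set x'; y']%SET by rewrite -E !inE eqxx.
  have : y \in [set x'; y']%SET by rewrite -E !inE eqxx orbT.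
  have : x' \in [set x; y]%SET by rewrite E !inE eqxx.
  have : y' \in [set x; y]%SET by rewrite E !inE eqxx orbT.
  rewrite !inE => /orP[]/eqP e1 /orP[]/eqP e2 /orP[]/eqP e3 /orP[]/eqP e4;
    first [by left; congr pair; congruence|by right; congr pair; congruence].
have arep q t : a q.1 q.2 t = a (rep (edge q)).1 (rep (edge q)).2 t.
  by case: (edge_eq _ _ (repE q)) => -> //=; rewrite (scheme_sym ha).
have uM e : (e \in u) = (e \in M) by rewrite mem_undup.
have uu : uniq u by exact: undup_uniq.
have su (i : 'I_(size u)) : nth finset.set0 u i \in M by rewrite -uM mem_nth.
have ep (i : 'I_(size u)) : edge (rep (nth finset.set0 u i)) = nth finset.set0 u i.
  by have /mapP[q _ ->] := su i; exact: repE.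
have big_u (F : {set 'I_n} -> nat) :
    (\sum_(i < size u) F (nth finset.set0 u i) = \sum_(e <- u) F e)%N.
  by rewrite (big_nth finset.set0) big_mkord.
exists (size u), (fun i => rep (nth finset.set0 u i)),
  (fun i => count_mem (nth finset.set0 u i) M); split; split.
- by rewrite lt0n size_eq0 /u; apply/eqP => /undup_nil.
- move=> i j ij; rewrite -!/(edge _) !ep; apply: contra ij => /eqP eij; apply/eqP.
  apply: val_inj => /=.
  by have := nth_uniq finset.set0 (ltn_ord i) (ltn_ord j) uu; rewrite eij eqxx => /esym/eqP.
- rewrite -(card_uniqP uu) /eset cardsE; apply: eq_card => e.
  by rewrite uM.
- by move=> i; exists (nth finset.set0 u i).
- move=> t; rewrite /word (eq_bigr _ (fun q _ => arep q t)).
  rewrite -(big_map edge xpredT (fun e => a (rep e).1 (rep e).2 t))/=.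
  rewrite -/M -big_undup_iterop_count/= -/u (big_nth finset.set0) big_mkord.
  by apply: eq_bigr => i _; rewrite Monoid.iteropE iter_mulr_1.
- rewrite (big_u (fun e => count_mem e M)) -(size_map edge L) -/M.
  rewrite -[RHS]sum1_size -[RHS]big_undup_iterop_count/=; apply: eq_bigr => e _.
  by rewrite Monoid.iteropE iter_addn_0 mul1n.
- rewrite /nsingle -sum1_card -[RHS]sum1_card big_mkcond.
  rewrite (eq_bigr (fun i : 'I_(size u) => nat_of_bool
     (count_mem (nth finset.set0 u i) M == 1%N))); last first.
    by move=> i _; rewrite inE; case: eqP.
  rewrite (big_u (fun e => nat_of_bool (count_mem e M == 1%N))).
  rewrite big_uniq// [LHS]big_mkcond [RHS]big_mkcond; apply: eq_bigr => e _.
  rewrite uM -[e \in M]has_pred1 has_count inE -/M.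
  by case: (count_mem e M) => [|[|m]].
Qed.

(** The integral of a function that is not integrable is infinite, even if both
its positive and its negative part have infinite integrals. *)
Lemma integrable_of_expectation (g : T -> R) (c : R) : measurable_fun setT g ->
  (`| 'E_P[g] | <= c%:E)%E -> P.-integrable setT (EFin \o g).
Proof.
move=> mg; rewrite unlock => Eg.
have mEg : measurable_fun [set: T] (EFin \o g) by exact/measurable_EFinP.
have : (\int[P]_t (g t)%:E)%E \is a fin_num.
  by rewrite fin_num_abs; apply: le_lt_trans Eg _; rewrite ltry.
rewrite integralE => H; apply/integrableP; split => //.
rewrite (_ : (fun t => `|(EFin \o g) t|%E) = abse \o (EFin \o g))// fune_abse.
rewrite ge0_integralD//; last 2 first.
  - exact: measurable_funepos.
  - exact: measurable_funeneg.
move: H; rewrite fin_numB => /andP[pf nf].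
by apply: lte_add_pinfty; rewrite ltey_eq ?pf ?nf.
Qed.

Definition mean (g : T -> R) : R := \int[P]_t g t.

Lemma nsingle_powR n (m : nat) : n%:R `^ (2^-1 * m%:R) = Num.sqrt n%:R ^+ m :> R.
Proof. by rewrite powRrM powR12_sqrt// powR_mulrn ?sqrtr_ge0. Qed.

Lemma word_moment n (L : seq ('I_n * 'I_n)) : L != [::] ->
  P.-integrable setT (EFin \o word L) /\
  `|mean (word L)| <= `|C (size L)| / Num.sqrt n%:R ^+ nsingle (map edge L).
Proof.
move=> L0; have [l [p [delta [[l0 fd _] [dM wE dsum dsing]]]]] := word_factor L0.
have d0 i : (0 < delta i)%N.
  by have [e eM ->] := dM i; rewrite -has_count has_pred1.
have := scheme_moment ha l0 fd d0.
rewrite dsum dsing nsingle_powR -(funext wE) => bound.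
have iL := integrable_of_expectation (measurable_word L) bound; split => //.
rewrite -lee_fin /mean EFin_normr_Rintegral//.
move: bound; rewrite unlock => /le_trans; apply.
by rewrite lee_fin ler_wpM2r ?ler_norm// invr_ge0 exprn_ge0// sqrtr_ge0.
Qed.

Lemma word_square n (L : seq ('I_n * 'I_n)) : L != [::] ->
  (forall e, e \in map edge L -> count_mem e (map edge L) = 2%N) ->
  `|mean (word L) - 1| <= `|Cl #|eset (map edge L)| n|.
Proof.
move=> L0 two; have [iL _] := word_moment L0.
have [l [p [delta [[l0 fd lE] [dM wE dsum dsing]]]]] := word_factor L0.
have := scheme_square ha l0 fd.
have <- : word L = (fun t => \prod_(i < l) a (p i).1 (p i).2 t ^+ 2).
  by apply/funext => t; rewrite wE; apply: eq_bigr => i _; have [e /two <- ->] := dM i.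
rewrite lE unlock => bound.
rewrite -lee_fin -[leLHS]/(`|(_ - _)%:E|%E) EFinB /mean /Rintegral fineK; last exact: integrable_fin_num iL.
by apply: le_trans bound _; rewrite lee_fin ler_norm.
Qed.

End WordMoments.

(** * Convergence at a prescribed rate *)

Section NullClasses.
Context {R : realType}.

(** The properties of rates on which the estimates rely. They are shared by
[vanishing] and [abs_summable] sequences, so that one proof serves both modes of
convergence. *)
Record null_class (N : (nat -> R) -> Prop) : Prop := NullClass {
  null_add : forall u v, N u -> N v -> N (fun n => u n + v n) ;
  null_scale : forall c u, N u -> N (fun n => c * u n) ;
  null_le : forall u v, N u -> (\forall n \near \oo, `|v n| <= `|u n|) -> N v }.

Definition vanishing (u : nat -> R) : Prop := u n @[n --> \oo] --> (0 : R).

Definition abs_summable (u : nat -> R) : Prop :=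
  exists M, forall n, \sum_(i < n) `|u i| <= M.

Lemma vanishing_null : null_class vanishing.
Proof.
split=> [u v u0 v0|c u u0|u v u0 uv]; rewrite /vanishing.
- by rewrite -[X in _ --> X](addr0 0); exact: cvgD.
- by rewrite -[X in _ --> X](mulr0 c); exact: cvgMr.
- apply/norm_cvg0P; have u0' := (norm_cvg0P u).2 u0.
  apply: (@squeeze_cvgr _ _ _ _ (cst 0) (fun n => `|u n|)); [|exact: cvg_cst|exact: u0'].
  by near=> n; rewrite normr_ge0/=; near: n.
Unshelve. all: end_near. Qed.

Lemma abs_summable_null : null_class abs_summable.
Proof.
split=> [u v [M uM] [K vK]|c u [M uM]|u v [M uM] [m _ mH]].
- exists (M + K) => n; apply: le_trans (lerD (uM n) (vK n)).
  by rewrite -big_split/=; apply: ler_sum => i _; exact: ler_normD.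
- exists (`|c| * M) => n; under eq_bigr do rewrite normrM.
  by rewrite -mulr_sumr ler_wpM2l.
- exists (\sum_(i < m) `|v i| + M) => n.
  apply: (@le_trans _ _ (\sum_(i < n) ((if (i < m)%N then `|v i| else 0) + `|u i|))).
    apply: ler_sum => i _; case: ltnP => im; first by rewrite lerDl.
    by rewrite add0r; exact: mH.
  rewrite big_split/=; apply: lerD; last exact: uM.
  have [nm|mn] := leqP n m.
    rewrite [leLHS](eq_bigr (fun i : 'I_n => `|v i|)); last first.
      by move=> i _; rewrite (leq_trans (ltn_ord i) nm).
    by rewrite -[in leRHS](subnKC nm) big_split_ord/= lerDl; exact: sumr_ge0.
  by rewrite -big_mkcond/= -(big_ord_widen _ (fun i => `|v i|) (ltnW mn)).
Qed.

Lemma cvg_series_abs_summable (u : nat -> R) :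
  (\forall n \near \oo, 0 <= u n) -> cvgn (series u) -> abs_summable u.
Proof.
move=> [m _ mH] cu.
have /cvg_seq_bounded[M [_ MH]] := cu.
have bM n : series u n <= M + 1.
  by apply: le_trans (ler_norm _) _; apply: MH; rewrite // ltrDl.
exists (M + 1 + \sum_(i < m) (2 * `|u i|)) => n.
rewrite -lerBlDr; apply: le_trans (bM n).
rewrite seriesEord lerBlDr.
apply: (@le_trans _ _ (\sum_(i < n) (u i + (if (i < m)%N then 2 * `|u i| else 0)))).
  apply: ler_sum => i _; case: ltnP => im.
    by have := ler_norm (- u i); rewrite normrN; lra.
  by rewrite addr0 ger0_norm// mH.
rewrite big_split/= lerD2l.
have [nm|mn] := leqP n m.
  rewrite [leLHS](eq_bigr (fun i : 'I_n => 2 * `|u i|)); last first.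
    by move=> i _; rewrite (leq_trans (ltn_ord i) nm).
  rewrite -[in leRHS](subnKC nm) big_split_ord/= lerDl; apply: sumr_ge0 => i _.
  by rewrite mulr_ge0.
by rewrite -big_mkcond/= -(big_ord_widen _ (fun i => 2 * `|u i|) (ltnW mn)).
Qed.

End NullClasses.

Section Tends.
Context {d : measure_display} {T : measurableType d} {R : realType}
  {P : probability T R} (N : (nat -> R) -> Prop) (nN : null_class N).

(** Convergence in probability if N stands for [vanishing] sequences, and complete
convergence in the sense of Hsu and Robbins if it stands for [abs_summable]
ones. *)
Definition tends (Y : nat -> T -> R) (l : R) : Prop :=
  forall eps, 0 < eps -> N (fun n => fine (P [set t | eps <= `|Y n t - l|])).

Lemma measurable_deviation (g : T -> R) (l eps : R) : measurable_fun setT g ->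
  measurable [set t | eps <= `|g t - l|].
Proof.
move=> mg; rewrite -[X in measurable X]setTI.
apply: (measurable_fun_le measurableT); first exact: measurable_cst.
by apply: measurableT_comp => //; apply: measurable_funB => //; exact: measurable_cst.
Qed.

Lemma fine_prob_ge0 (A : set T) : 0 <= fine (P A).
Proof. exact/fine_ge0/measure_ge0. Qed.

Lemma fine_prob_leU (A B D : set T) : measurable A -> measurable B -> measurable D ->
  A `<=` B `|` D -> fine (P A) <= fine (P B) + fine (P D).
Proof.
move=> mA mB mD AB; rewrite -fineD ?fin_num_measure//; apply: fine_le.
- exact: fin_num_measure.
- by rewrite fin_numD !fin_num_measure.
apply: le_trans (measureU2 _ mB mD).
by apply: le_measure => //; rewrite inE//; exact: measurableU.
Qed.

(** A large deviation of W requires one of Y or one of Z. *)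
Lemma tends2_le (Y Z W : nat -> T -> R) (l m k e1 e2 eps : R) :
  (forall n, measurable_fun setT (Y n)) -> (forall n, measurable_fun setT (Z n)) ->
  (forall n, measurable_fun setT (W n)) -> 0 < e1 -> 0 < e2 ->
  tends Y l -> tends Z m ->
  (\forall n \near \oo, forall t, `|Y n t - l| < e1 -> `|Z n t - m| < e2 ->
    `|W n t - k| < eps) ->
  N (fun n => fine (P [set t | eps <= `|W n t - k|])).
Proof.
move=> mY mZ mW e10 e20 tY tZ [n0 _ H].
apply: (null_le nN (null_add nN (tY _ e10) (tZ _ e20))).
exists n0 => // n /= n0n; rewrite !ger0_norm ?addr_ge0 ?fine_prob_ge0//.
apply: fine_prob_leU; try exact: measurable_deviation.
move=> t /= eW; have [Yl|lY] := leP e1 `|Y n t - l|; first by left.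
have [Zl|lZ] := leP e2 `|Z n t - m|; first by right.
by have := H _ n0n t lY lZ; rewrite ltNge eW.
Qed.

Lemma null_zero (u : nat -> R) : N u -> N (fun=> 0).
Proof. by move=> Nu; apply: (null_le nN Nu); apply: nearW => n; rewrite normr0. Qed.

Lemma tends_cst (Y : nat -> R) (l : R) (u : nat -> R) : N u ->
  Y n @[n --> \oo] --> l -> tends (fun n _ => Y n) l.
Proof.
move=> Nu Yl eps eps0; apply: (null_le nN (null_zero Nu)).
have /cvgrPdist_lt/(_ _ eps0) := Yl; apply: filterS => n Yn.
rewrite (_ : [set _ | _] = set0) ?measure0//.
by apply/seteqP; split => // t /=; rewrite leNgt distrC Yn.
Qed.

Lemma tends_le (Y W : nat -> T -> R) (l k e1 eps : R) :
  (forall n, measurable_fun setT (Y n)) ->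
  (forall n, measurable_fun setT (W n)) -> 0 < e1 -> tends Y l ->
  (\forall n \near \oo, forall t, `|Y n t - l| < e1 -> `|W n t - k| < eps) ->
  N (fun n => fine (P [set t | eps <= `|W n t - k|])).
Proof.
move=> mY mW e10 tY H; apply: (tends2_le mY mY mW e10 e10 tY tY).
by move: H; apply: filterS => n H t Yl _; exact: H.
Qed.

Lemma tendsD (Y Z : nat -> T -> R) (l m : R) :
  (forall n, measurable_fun setT (Y n)) -> (forall n, measurable_fun setT (Z n)) ->
  tends Y l -> tends Z m -> tends (fun n t => Y n t + Z n t) (l + m).
Proof.
move=> mY mZ tY tZ eps eps0; have e2 : 0 < eps / 2 by rewrite divr_gt0.
apply: (tends2_le mY mZ _ e2 e2 tY tZ) => [n|]; first exact: measurable_funD.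
apply: nearW => n t Yl Zm; rewrite opprD addrACA.
by apply: le_lt_trans (ler_normD _ _) _; rewrite [ltRHS]splitr ltrD.
Qed.

Lemma tendsZ (Y : nat -> T -> R) (c l : R) :
  (forall n, measurable_fun setT (Y n)) ->
  tends Y l -> tends (fun n t => c * Y n t) (c * l).
Proof.
move=> mY tY eps eps0; have c0 : 0 < `|c| + 1 by rewrite ltr_wpDl.
apply: (tends_le mY _ (divr_gt0 eps0 c0) tY) => [n|].
  by apply: measurable_funM => //; exact: measurable_cst.
apply: nearW => n t; rewrite ltr_pdivlMr// => Yl.
rewrite -mulrBr normrM; apply: le_lt_trans Yl; rewrite mulrC ler_wpM2l// lerDl.
exact: ler01.
Qed.

Lemma markov_pow (g : T -> R) (z : nat) (eps : R) : measurable_fun setT g -> 0 < eps ->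
  P.-integrable setT (EFin \o (fun t => g t ^+ (2 * z))) ->
  fine (P [set t | eps <= `|g t|]) <= (\int[P]_t (g t ^+ (2 * z))) / eps ^+ (2 * z).
Proof.
move=> mg e0 ig; rewrite ler_pdivlMr ?exprn_gt0//.
set A := [set t | eps <= `|g t|].
have mA : measurable A.
  have := measurable_deviation 0 eps mg; rewrite /A; congr measurable.
  by apply/seteqP; split => t /=; rewrite subr0.
have -> : fine (P A) * eps ^+ (2 * z) = \int[P]_(t in A) (eps ^+ (2 * z)).
  by rewrite Rintegral_cst// mulrC.
have ge0 t : 0 <= g t ^+ (2 * z) by rewrite exprM exprn_ge0// sqr_ge0.
have fin : (\int[P]_t (g t ^+ (2 * z))%:E)%E \is a fin_num.
  exact: integrable_fin_num ig.
have le1 : (\int[P]_(t in A) (eps ^+ (2 * z))%:E <= \int[P]_t (g t ^+ (2 * z))%:E)%E.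
  apply: (@le_trans _ _ (\int[P]_(t in A) (g t ^+ (2 * z))%:E)%E).
    apply: ge0_le_integral => //.
    - by move=> t _; rewrite lee_fin exprn_ge0// ltW.
    - by apply/measurable_EFinP/measurable_funTS; exact: measurable_funX.
    - move=> t; rewrite /A/= => et; rewrite lee_fin [leRHS]exprM -real_normK ?num_real//.
      by rewrite -exprM lerXn2r// nnegrE// ltW.
  apply: ge0_subset_integral => //; first by apply/measurable_EFinP; exact: measurable_funX.
  by move=> t _; rewrite lee_fin.
apply: fine_le => //.
rewrite ge0_fin_numE; first by apply: le_lt_trans le1 _; rewrite ltey_eq fin.
by apply: integral_ge0 => t _; rewrite lee_fin exprn_ge0// ltW.
Qed.

Lemma tends_moment (Y : nat -> T -> R) (z : nat) (u : nat -> R) :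
  (forall n, measurable_fun setT (Y n)) -> N u ->
  (\forall n \near \oo, P.-integrable setT (EFin \o (fun t => Y n t ^+ (2 * z))) /\
     \int[P]_t (Y n t ^+ (2 * z)) <= u n) ->
  tends Y 0.
Proof.
move=> mY Nu [n0 _ H] eps e0.
apply: (null_le nN (null_scale nN (eps ^+ (2 * z))^-1 Nu)).
exists n0 => // n /= /H[iY Yu]; rewrite ger0_norm ?fine_prob_ge0//.
under eq_set do rewrite subr0.
apply: le_trans (markov_pow (mY n) e0 iY) _; rewrite mulrC.
by apply: le_trans (ler_norm _); rewrite ler_wpM2l// invr_ge0 exprn_ge0// ltW.
Qed.

End Tends.

(** * The three classes of closed walks *)

Section WalkClasses.
Context {V : finType}.
Implicit Types w : seq V.

Definition has_single w : bool := (0 < nsingle (cycle_edges w))%N.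
(** A walk without once-used edge has at most size w / 2 edges, hence at most
(size w).+2 / 2 vertices. If it attains this bound, its edges form a tree and are
used twice each; [degenerate] walks are those that do not. *)
Definition tree_doubled w : bool :=
  ~~ has_single w && (2 * #|vset w| == (size w).+2)%N.
Definition degenerate w : bool :=
  ~~ has_single w && (2 * #|vset w| < (size w).+2)%N.

Lemma has_single_vertices w : has_single w ->
  (#|vset w| <= #|eset (cycle_edges w)|)%N.
Proof.
rewrite /has_single /nsingle card_gt0 => /set0Pn[e]; rewrite inE => /eqP.
exact: cycle_vertices_single_le.
Qed.

Lemma no_single_edges w : ~~ has_single w ->
  (2 * #|eset (cycle_edges w)| <= size w)%N.
Proof.
rewrite /has_single -leqNgt leqn0 => /eqP s0.
by have := card_le_nsingle (cycle_edges w); rewrite s0 addn0 size_cycle_edges.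
Qed.

Lemma no_singleP w : w != [::] -> ~~ has_single w = tree_doubled w || degenerate w.
Proof.
move=> w0; rewrite /tree_doubled /degenerate -andb_orr -leq_eqVlt.
case: (boolP (has_single w)) => //= /no_single_edges; have := cycle_vertices_le w0.
by move=> le1 le2; apply/esym; lia.
Qed.

Lemma tree_doubled_edges w : w != [::] -> tree_doubled w ->
  #|vset w| = #|eset (cycle_edges w)|.+1 /\ (2 * #|eset (cycle_edges w)| = size w)%N.
Proof.
move=> w0 /andP[/no_single_edges le1 /eqP eq1].
by have := cycle_vertices_le w0; lia.
Qed.

(** The edges are half as many as the steps, and each is used at least twice. *)
Lemma tree_doubled_count w e : w != [::] -> tree_doubled w -> e \in cycle_edges w ->
  count_mem e (cycle_edges w) = 2%N.
Proof.
move=> w0 tw ew; have [_ eq2] := tree_doubled_edges w0 tw.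
have := sum_count_mem (cycle_edges w); rewrite size_cycle_edges -eq2.
have ge2 e' : e' \in cycle_edges w -> (2 <= count_mem e' (cycle_edges w))%N.
  move=> e'w; move: tw => /andP[]; rewrite /has_single -leqNgt leqn0 cards_eq0 => /eqP s0 _.
  have : e' \notin [set e0 | count_mem e0 (cycle_edges w) == 1%N]%SET by rewrite s0 inE.
  rewrite inE; move: e'w; rewrite -has_pred1 has_count.
  by case: (count_mem _ _) => [|[|m]].
rewrite (bigID (mem (eset (cycle_edges w))))/= [X in (_ + X)%N]big1; last first.
  by move=> e'; rewrite inE => /count_memPn.
rewrite addn0 mulnC -sum_nat_const => sE.
have ew' : e \in eset (cycle_edges w) by rewrite inE.
move: sE; rewrite (bigD1 e)//= [RHS](bigD1 e)//=.
have : (\sum_(i in eset (cycle_edges w) | i != e) 2 <=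
        \sum_(i in eset (cycle_edges w) | i != e) count_mem i (cycle_edges w))%N.
  by apply: leq_sum => i /andP[]; rewrite inE => /ge2.
move=> leS eqS; apply/eqP; rewrite eqn_leq ge2// andbT.
by rewrite -(leq_add2r (\sum_(i in eset (cycle_edges w) | i != e)
  count_mem i (cycle_edges w))) eqS leq_add2l.
Qed.

Lemma tree_doubled_reducible w : w != [::] -> tree_doubled w -> reducible w.
Proof.
move=> w0 tw; apply: tree_reducible => //.
by have [-> _] := tree_doubled_edges w0 tw.
Qed.

Lemma reducible_no_single w : reducible w -> ~~ has_single w.
Proof. by move=> /reducible_nsingle; rewrite /has_single => ->. Qed.

Lemma eset_cat (L L' : seq {set V}) : eset (L ++ L') = (eset L :|: eset L')%SET.
Proof. by apply/setP => e; rewrite !inE mem_cat. Qed.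

Lemma card_eset_cat_le w w' :
  (2 * #|(eset (cycle_edges w) :|: eset (cycle_edges w'))%SET| <=
   size w + size w' + nsingle (cycle_edges w ++ cycle_edges w'))%N.
Proof.
rewrite -eset_cat -(size_cycle_edges w) -(size_cycle_edges w') -size_cat.
exact: card_le_nsingle.
Qed.

Lemma common_edge_meet w w' e : e \in cycle_edges w -> e \in cycle_edges w' ->
  has (mem w) w'.
Proof.
move=> ew ew'; have := cycle_edges_sub ew; have := cycle_edges_sub ew'.
have /mapP[[x y] _ ->] := ew.
move=> /fintype.subsetP/(_ x); rewrite !inE eqxx => /(_ isT) xw'.
move=> /fintype.subsetP/(_ x); rewrite !inE eqxx => /(_ isT) xw.
by apply/hasP; exists x.
Qed.

Lemma nsingle_disjoint w w' : ~~ has (mem w) w' ->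
  nsingle (cycle_edges w ++ cycle_edges w') =
  (nsingle (cycle_edges w) + nsingle (cycle_edges w'))%N.
Proof.
move=> ww'; rewrite /nsingle -cardsUI.
rewrite [X in (_ + #|pred_of_set X|)%N](_ : _ = finset.set0) ?cards0 ?addn0.
  apply: eq_card => e; rewrite !inE count_cat.
  have [ew|ew] := boolP (e \in cycle_edges w).
    have /count_memPn -> : e \notin cycle_edges w'.
      by apply: contra ww' => ew'; exact: common_edge_meet ew ew'.
    by rewrite addn0 orbF.
  by move/count_memPn : ew => ->.
apply/setP => e; rewrite !inE; apply/negP => /andP[/eqP c1 /eqP c2].
move/negP: ww'; apply; apply: (@common_edge_meet _ _ e);
  by rewrite -has_pred1 has_count ?c1 ?c2.
Qed.

(** The union of the two walks is connected and has at most as many vertices as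
edges, since this is true of the first walk. *)
Lemma single_pair_meet w w' : has_single w -> has (mem w) w' ->
  (2 * #|(vset w :|: vset w')%SET| <=
   size w + size w' + nsingle (cycle_edges w ++ cycle_edges w'))%N.
Proof.
move=> /has_single_vertices le1 /cycle_vertices_union_le.
by have := card_eset_cat_le w w'; lia.
Qed.

Lemma single_vertices w : has_single w ->
  (2 * #|vset w| <= size w + nsingle (cycle_edges w))%N.
Proof.
move=> /has_single_vertices le1; rewrite -[size w]size_cycle_edges.
by apply: leq_trans (card_le_nsingle _); rewrite leq_mul2l.
Qed.

(** The union of the two trees is connected, and it counts the common edge only
once. *)
Lemma tree_doubled_pair_meet w w' e : w != [::] -> w' != [::] ->
  tree_doubled w -> tree_doubled w' ->
  e \in cycle_edges w -> e \in cycle_edges w' ->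
  (2 * #|(vset w :|: vset w')%SET| <= size w + size w')%N.
Proof.
move=> w0 w'0 tw tw' ew ew'.
have [v1 e1] := tree_doubled_edges w0 tw; have [v2 e2] := tree_doubled_edges w'0 tw'.
have := cycle_vertices_union_le (common_edge_meet ew ew').
have := cardsUI (eset (cycle_edges w)) (eset (cycle_edges w')).
have : (0 < #|(eset (cycle_edges w) :&: eset (cycle_edges w'))%SET|)%N.
  by rewrite card_gt0; apply/set0Pn; exists e; rewrite !inE ew.
by lia.
Qed.

End WalkClasses.

(** In the sums below the vertices number nu^2 and the degrees are at most b^2;
the square roots keep all exponents integral. *)

Section WalkSums.
Context {R : realFieldType} {V : finType} (adj : rel V) (b nu : R) (k : nat).
Hypotheses (b_ge1 : 1 <= b) (b_nu : b <= nu) (card_nu : #|V|%:R = nu ^+ 2)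
  (degb : forall x, #|[pred y | adj x y]|%:R <= b ^+ 2).
Local Notation walks := (k.+1.-tuple V).

Let b_gt0 : 0 < b. Proof. exact: lt_le_trans b_ge1. Qed.
Let nu_ge1 : 1 <= nu. Proof. exact: le_trans b_ge1 b_nu. Qed.
Let nu_gt0 : 0 < nu. Proof. exact: lt_le_trans nu_ge1. Qed.
Let b2_ge1 : 1 <= b ^+ 2. Proof. exact: exprn_ege1. Qed.

Definition meet_const : nat := k.+1 * k.+1 * (k.+1 + k.+1).+1 ^ k.+1.

Lemma weightE (m : nat) : (b ^+ 2)^-1 ^+ m = (b ^+ (2 * m))^-1.
Proof. by rewrite exprVn -exprM. Qed.

Lemma sum_weights_le :
  \sum_(w : walks | cycle adj w) walk_weight (b ^+ 2) w <=
  (walk_const k.+1)%:R * nu ^+ 2.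
Proof. by rewrite -card_nu -natrM; exact: sum_cycles_le. Qed.

Lemma card_walks_le (D : pred (seq V)) (m : nat) :
  (forall w : walks, D w -> (2 * #|vset w|.-1 <= m)%N) ->
  \sum_(w : walks | cycle adj w && D w) 1 <= b ^+ m * ((walk_const k.+1)%:R * nu ^+ 2).
Proof.
move=> Dm; apply: le_trans (ler_wpM2l (exprn_ge0 _ (ltW b_gt0)) sum_weights_le).
rewrite mulr_sumr [leRHS](bigID (fun w : walks => D w))/= ler_wpDr//.
  by apply: sumr_ge0 => w _; rewrite mulr_ge0 ?exprn_ge0 ?invr_ge0 ?exprn_ge0 ?ltW.
apply: ler_sum => w /andP[_ Dw]; rewrite /walk_weight weightE.
rewrite ler_pdivlMr ?exprn_gt0// mul1r ler_weXn2l//; exact: Dm.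
Qed.

Lemma sum_meeting_le :
  \sum_(w : walks | cycle adj w) \sum_(w' : walks | cycle adj w' && has (mem w) w')
    (b ^+ 2)^-1 ^+ (#|(vset w :|: vset w')%SET|.-1) <=
  meet_const%:R * ((walk_const k.+1)%:R * nu ^+ 2).
Proof.
apply: le_trans (ler_wpM2l (ler0n _ _) sum_weights_le).
rewrite mulr_sumr; apply: ler_sum => w _.
have := @sum_meeting_cycles_le _ _ adj (b ^+ 2) b2_ge1 degb w k.+1.
rewrite size_tuple -/meet_const => H.
apply: le_trans (ler_wpM2r _ H); last by rewrite exprn_ge0// invr_ge0 ltW// exprn_gt0.
rewrite mulr_suml; apply: ler_sum => w' _.
rewrite -exprD.
have v0 : (0 < #|vset w|)%N.
  by apply/card_gt0P; exists (thead w); rewrite inE mem_tnth.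
have vv : (#|vset w| <= #|(vset w :|: vset w')%SET|)%N.
  exact: subset_leq_card (finset.subsetUl _ _).
by rewrite (_ : (_ + _ = #|(vset w :|: vset w')%SET|.-1)%N)//; lia.
Qed.

(** Since b <= nu, the factor 1 / nu of a once-used edge makes up for the factor b
by which it may raise the number of walks. The bound is of order nu^2 and not
nu^4: walks that meet have only one free start in common, and walks that do not
meet have a once-used edge each, which together give another factor 1 / nu^2. *)
Lemma sum_single_pairs_le :
  \sum_(w : walks | cycle adj w && has_single w)
  \sum_(w' : walks | cycle adj w' && has_single w')
    (nu ^+ nsingle (cycle_edges w ++ cycle_edges w'))^-1 <=
  b ^+ (2 * k) * nu ^+ 2 * ((meet_const * walk_const k.+1 + walk_const k.+1 ^ 2)%:R).
Proof.
set c1 := walk_const k.+1.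
pose W (w : seq V) := walk_weight (b ^+ 2) w.
have W0 (w : seq V) : 0 <= W w by rewrite exprn_ge0// invr_ge0 exprn_ge0// ltW.
pose M (w w' : seq V) := (b ^+ 2)^-1 ^+ (#|(vset w :|: vset w')%SET|.-1).
have M0 (w w' : seq V) : 0 <= M w w' by rewrite exprn_ge0// invr_ge0 exprn_ge0// ltW.
have wN0 (w : walks) : (0 < #|vset w|)%N.
  by apply/card_gt0P; exists (thead w); rewrite inE mem_tnth.
have step (w w' : walks) : has_single w -> has_single w' ->
    (nu ^+ nsingle (cycle_edges w ++ cycle_edges w'))^-1 <=
    b ^+ (2 * k) * ((if has (mem w) w' then M w w' else 0) + (nu ^+ 2)^-1 * (W w * W w')).
  move=> sw sw'; set s := nsingle _.
  have [ww'|ww'] := boolP (has (mem w) w').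
    apply: (@le_trans _ _ (b ^+ (2 * k) * M w w')); last first.
      by rewrite ler_wpM2l ?exprn_ge0 ?(ltW b_gt0)// lerDl !mulr_ge0// invr_ge0 exprn_ge0// ltW.
    have := single_pair_meet sw ww'; rewrite !size_tuple -/s => le1.
    have vv : (#|vset w| <= #|(vset w :|: vset w')%SET|)%N.
      exact: subset_leq_card (finset.subsetUl _ _).
    rewrite /M weightE ler_pdivlMr ?exprn_gt0// mulrC ler_pdivrMr ?exprn_gt0//.
    apply: (@le_trans _ _ (b ^+ (2 * k) * b ^+ s)).
      by rewrite -exprD ler_weXn2l//; have := wN0 w; lia.
    by rewrite ler_wpM2l ?exprn_ge0 ?(ltW b_gt0)// lerXn2r// nnegrE ltW.
  rewrite add0r.
  have := nsingle_disjoint ww'; rewrite -/s => sE.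
  have := single_vertices sw; have := single_vertices sw'; rewrite !size_tuple => le1 le2.
  have le3 := leq_add le2 le1; rewrite addnACA -sE in le3.
  have s2 : (2 <= s)%N by rewrite sE; exact: (leq_add (sw : (1 <= _)%N) (sw' : (1 <= _)%N)).
  rewrite /W /walk_weight !weightE -invfM -exprD -invfM.
  rewrite ler_pdivlMr ?mulr_gt0 ?exprn_gt0// mulrC ler_pdivrMr ?exprn_gt0//.
  have -> : nu ^+ s = nu ^+ 2 * nu ^+ (s - 2) by rewrite -exprD subnKC.
  rewrite mulrCA ler_wpM2l ?exprn_ge0 ?(ltW nu_gt0)//.
  apply: (@le_trans _ _ (b ^+ (2 * k) * b ^+ (s - 2))).
    by rewrite -exprD ler_weXn2l//; have := wN0 w; have := wN0 w'; lia.
  by rewrite ler_wpM2l ?exprn_ge0 ?(ltW b_gt0)// lerXn2r// nnegrE ltW.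
apply: (@le_trans _ _ (\sum_(w : walks | cycle adj w) \sum_(w' : walks | cycle adj w')
    b ^+ (2 * k) * ((if has (mem w) w' then M w w' else 0) + (nu ^+ 2)^-1 * (W w * W w')))).
  have pos (w w' : walks) : 0 <= b ^+ (2 * k) *
     ((if has (mem w) w' then M w w' else 0) + (nu ^+ 2)^-1 * (W w * W w')).
    rewrite mulr_ge0 ?exprn_ge0 ?(ltW b_gt0)// addr_ge0//; first by case: ifP.
    by rewrite !mulr_ge0// invr_ge0 exprn_ge0// ltW.
  rewrite [leRHS](bigID (fun w : walks => has_single w))/= ler_wpDr//.
    by apply: sumr_ge0 => w _; apply: sumr_ge0.
  apply: ler_sum => w /andP[_ sw].
  rewrite [leRHS](bigID (fun w : walks => has_single w))/= ler_wpDr//.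
    by apply: sumr_ge0.
  by apply: ler_sum => w' /andP[_ sw']; exact: step.
under eq_bigr do rewrite -mulr_sumr big_split/=.
rewrite -mulr_sumr big_split/= -mulrA ler_wpM2l ?exprn_ge0 ?(ltW b_gt0)//.
rewrite natrD mulrDr lerD//.
  under eq_bigr do rewrite -big_mkcondr/=.
  by apply: le_trans sum_meeting_le _; rewrite natrM mulrA mulrC.
under eq_bigr do rewrite -mulr_sumr -mulr_sumr.
rewrite -mulr_sumr -mulr_suml.
have S1 := sum_weights_le; have S0 : 0 <= \sum_(w : walks | cycle adj w) W w.
  exact: sumr_ge0.
apply: (@le_trans _ _ ((nu ^+ 2)^-1 * ((c1%:R * nu ^+ 2) * (c1%:R * nu ^+ 2)))).
  rewrite ler_wpM2l ?invr_ge0 ?exprn_ge0 ?(ltW nu_gt0)//.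
  exact: ler_pM.
rewrite le_eqVlt; apply/orP; left; apply/eqP; rewrite natrX; field.
by rewrite gt_eqF.
Qed.

(** Two such walks have at most k.+1 vertices together, one of which is a free
start. *)
Lemma sum_doubled_pairs_le :
  \sum_(w : walks | cycle adj w && tree_doubled w)
  \sum_(w' : walks | cycle adj w' && tree_doubled w')
    (has (mem (cycle_edges w)) (cycle_edges w'))%:R <=
  b ^+ (2 * k) * nu ^+ 2 * ((meet_const * walk_const k.+1)%:R).
Proof.
pose M (w w' : seq V) := (b ^+ 2)^-1 ^+ (#|(vset w :|: vset w')%SET|.-1).
have M0 (w w' : seq V) : 0 <= M w w' by rewrite exprn_ge0// invr_ge0 exprn_ge0// ltW.
apply: (@le_trans _ _ (b ^+ (2 * k) * \sum_(w : walks | cycle adj w)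
   \sum_(w' : walks | cycle adj w' && has (mem w) w') M w w')); last first.
  rewrite -mulrA ler_wpM2l ?exprn_ge0 ?(ltW b_gt0)//.
  by apply: le_trans sum_meeting_le _; rewrite natrM mulrA mulrC.
rewrite mulr_sumr [leRHS](bigID (fun w : walks => tree_doubled w))/= ler_wpDr//.
  apply: sumr_ge0 => w _; rewrite mulr_ge0 ?exprn_ge0 ?(ltW b_gt0)//.
  exact: sumr_ge0.
apply: ler_sum => w /andP[_ tw]; rewrite mulr_sumr.
rewrite [leLHS](bigID (fun w' : walks => has (mem (cycle_edges w)) (cycle_edges w')))/=.
rewrite [X in _ + X]big1 ?addr0; last first.
  by move=> w' /andP[_ /negbTE ->].
rewrite [leRHS](bigID (fun w' : walks => tree_doubled w' &&
   has (mem (cycle_edges w)) (cycle_edges w')))/= ler_wpDr//.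
  by apply: sumr_ge0 => w' _; rewrite mulr_ge0// exprn_ge0// ltW.
have wN (u : walks) : (u : seq V) != [::] by rewrite -size_eq0 size_tuple.
rewrite [leRHS](eq_bigl (fun w' : walks => cycle adj w' && tree_doubled w' &&
   has (mem (cycle_edges w)) (cycle_edges w'))); last first.
  move=> w'; apply/idP/idP => [/andP[/andP[-> _] /andP[-> ->]]//|].
  move=> /andP[/andP[-> ->] hE]; rewrite hE /= andbT.
  by have /hasP[e ew' ew] := hE; exact: common_edge_meet ew ew'.
apply: ler_sum => w' /andP[/andP[_ tw'] /[dup] sh ->].
have /hasP[e ew' ew] := sh.
have := tree_doubled_pair_meet (wN w) (wN w') tw tw' ew ew'; rewrite !size_tuple => le1.
rewrite /M weightE ler_pdivlMr ?exprn_gt0// mul1r ler_weXn2l//.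
by lia.
Qed.

End WalkSums.

(** * Moments of the three parts of the trace *)

Section MeanSum.
Context {d : measure_display} {T : measurableType d} {R : realType}
  (P : probability T R).

Lemma integrable_sumR (I : finType) (D : pred I) (g : I -> T -> R) :
  (forall i, D i -> P.-integrable setT (EFin \o g i)) ->
  P.-integrable setT (EFin \o (fun t => \sum_(i | D i) g i t)).
Proof.
move=> ig.
have -> : EFin \o (fun t => \sum_(i | D i) g i t) =
    (fun t => \sum_(i | D i) (EFin \o g i) t)%E.
  by apply/funext => t /=; rewrite sumEFin.
exact: integrable_sum.
Qed.

Lemma integrableZ (c : R) (g : T -> R) : P.-integrable setT (EFin \o g) ->
  P.-integrable setT (EFin \o (fun t => c * g t)).
Proof.
move=> ig; have -> : EFin \o (fun t => c * g t) = (fun t => c%:E * (EFin \o g) t)%E.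
  by apply/funext => t.
exact: integrableZl.
Qed.

Lemma mean_sum (I : finType) (D : pred I) (g : I -> T -> R) :
  (forall i, D i -> P.-integrable setT (EFin \o g i)) ->
  mean (P := P) (fun t => \sum_(i | D i) g i t) = \sum_(i | D i) mean (P := P) (g i).
Proof.
move=> ig; rewrite /mean.
suff H (s : seq I) : P.-integrable setT (EFin \o (fun t => \sum_(i <- s | D i) g i t)) /\
    \int[P]_t (\sum_(i <- s | D i) g i t) = \sum_(i <- s | D i) \int[P]_t g i t.
  by have [] := H (index_enum I).
elim: s => [|i s [IHi IHs]].
  split.
    rewrite (_ : EFin \o _ = cst 0%E); first exact: integrable0.
    by apply/funext => t /=; rewrite big_nil.
  rewrite big_nil; under eq_Rintegral do rewrite big_nil.
  by rewrite Rintegral_cst// mul0r.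
have [Di|nDi] := boolP (D i); last first.
  have -> : (fun t => \sum_(j <- i :: s | D j) g j t) =
      (fun t => \sum_(j <- s | D j) g j t).
    by apply/funext => t; rewrite big_cons (negbTE nDi).
  by rewrite big_cons (negbTE nDi).
split.
  have -> : EFin \o (fun t => \sum_(j <- i :: s | D j) g j t) =
    ((EFin \o g i) \+ (EFin \o (fun t => (\sum_(j <- s | D j) g j t)%R)))%E.
    by apply/funext => t /=; rewrite big_cons Di.
  by apply: integrableD => //; exact: ig.
rewrite big_cons Di -IHs -RintegralD//; last exact: ig.
by apply: eq_Rintegral => t _; rewrite big_cons Di.
Qed.

Lemma meanZ (c : R) (g : T -> R) : P.-integrable setT (EFin \o g) ->
  mean (P := P) (fun t => c * g t) = c * mean (P := P) g.
Proof. by move=> ig; rewrite /mean RintegralZl. Qed.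

Lemma mean_one : \int[P]_(t in setT) (1 : R) = 1.
Proof. by have := expectation_cst P 1; rewrite unlock /Rintegral => ->. Qed.

End MeanSum.

Section Parts.
Context {d : measure_display} {T : measurableType d} {R : realType}
  {P : probability T R}
  (a : forall n, 'I_n -> 'I_n -> {RV P >-> R})
  (C : nat -> R) (Cl : nat -> nat -> R) (ha : approx_uncorrelated a C Cl)
  (h : nat -> nat) (hh : halfwidths h).
Local Notation bw := (@bw R h).
Local Notation mean := (@mean _ _ _ P).

Definition norming n k : R := n%:R * Num.sqrt (bw n) ^+ k.+1.

Definition walk_part n k (D : pred (seq 'I_n)) (t : T) : R :=
  (norming n k)^-1 * \sum_(w : k.+1.-tuple 'I_n | cycle (band (h n)) w && D w)
     word a (cycle_pairs w) t.

Definition tree_density n k : R :=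
  (norming n k)^-1 * \sum_(w : k.+1.-tuple 'I_n | cycle (band (h n)) w && tree_doubled w) 1.

Lemma measurable_walk_part n k (D : pred (seq 'I_n)) : measurable_fun setT (walk_part k D).
Proof.
apply: measurable_funM; first exact: measurable_cst.
under eq_fun do rewrite big_mkcond/=.
by apply: measurable_sum => w; case: (_ && _); [exact: measurable_word|exact: measurable_cst].
Qed.

Lemma trace_band_matrix n k (t : T) : (0 < n)%N ->
  n%:R^-1 * \tr (nonperiodic_band_matrix a h n t ^+ k.+1) = walk_part (n := n) k predT t.
Proof.
move=> n0; rewrite /walk_part /norming invfM -mulrA trace_expr; congr (_ * _).
rewrite mulr_sumr [RHS]big_mkcond/=; apply: eq_bigr => w _; rewrite andbT cycle_all.
have sw : size (cycle_pairs w) = k.+1 by rewrite size_cycle_pairs size_tuple.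
case: allP => [bandw|nbandw].
  have -> : Num.sqrt (bw n) ^- k.+1 = \prod_(q <- cycle_pairs w) (Num.sqrt (bw n))^-1.
    by rewrite big_const_seq count_predT iter_mulr_1 sw exprVn.
  rewrite /word -big_split/=.
  rewrite big_seq [RHS]big_seq; apply: eq_bigr => q qw.
  by rewrite mxE -/(band (h n) q.1 q.2) bandw.
have /allPn[q qw nq] : ~~ all (fun q => band (h n) q.1 q.2) (cycle_pairs w).
  by apply/negP => /allP.
rewrite (big_rem q qw)/= mxE -/(band (h n) q.1 q.2) (negbTE nq).
by rewrite mul0r.
Qed.

Lemma walk_part_split n k (t : T) :
  walk_part (n := n) k predT t = walk_part (n := n) k has_single t +
    walk_part (n := n) k degenerate t + walk_part (n := n) k tree_doubled t.
Proof.
rewrite /walk_part -!mulrDr; congr (_ * _).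
rewrite (bigID (fun w : k.+1.-tuple 'I_n => has_single w))/= -addrA; congr (_ + _).
  by apply: eq_bigl => w; rewrite andbT.
rewrite (bigID (fun w : k.+1.-tuple 'I_n => degenerate w))/=; congr (_ + _).
  apply: eq_bigl => w; rewrite andbT -andbA; congr (_ && _).
  by rewrite /degenerate andbA andbb.
apply: eq_bigl => w; rewrite andbT -andbA; congr (_ && _).
have wN : (w : seq 'I_n) != [::] by rewrite -size_eq0 size_tuple.
rewrite (no_singleP wN); case tw : (tree_doubled w) => /=; last first.
  by case: (degenerate w).
move: tw; rewrite /tree_doubled /degenerate => /andP[-> /eqP ->].
by rewrite ltnn.
Qed.

Section FixedN.
Variables (n k : nat).
Hypothesis n0 : (0 < n)%N.
Let b := Num.sqrt (bw n).
Let nu : R := Num.sqrt n%:R.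
Local Notation walks := (k.+1.-tuple 'I_n).

Let bw_gt0 : 0 < bw n. Proof. by apply: lt_le_trans (bw_ge1 hh n0). Qed.
Let b_sqr : b ^+ 2 = bw n. Proof. by rewrite sqr_sqrtr// ltW. Qed.
Let b_ge1 : 1 <= b. Proof. by rewrite -sqrtr1 ler_sqrt ?bw_ge1// ltW. Qed.
Let b_nu : b <= nu. Proof. by rewrite ler_sqrt ?ler0n// bw_le. Qed.
Let nu_sqr : nu ^+ 2 = n%:R. Proof. by rewrite sqr_sqrtr. Qed.
Let card_nu : #|'I_n|%:R = nu ^+ 2. Proof. by rewrite card_ord nu_sqr. Qed.
Let degb (x : 'I_n) : #|[pred y | band (h n) x y]|%:R <= b ^+ 2.
Proof. by rewrite b_sqr; exact: card_band_le. Qed.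
Let b_gt0 : 0 < b. Proof. exact: lt_le_trans b_ge1. Qed.
Let nu_ge1 : 1 <= nu. Proof. exact: le_trans b_ge1 b_nu. Qed.
Let nu_gt0 : 0 < nu. Proof. exact: lt_le_trans nu_ge1. Qed.
Let n_gt0 : 0 < n%:R :> R. Proof. by rewrite ltr0n. Qed.
Let norming_gt0 : 0 < norming n k.
Proof. by rewrite mulr_gt0 ?exprn_gt0. Qed.
Let wN (w : walks) : cycle_pairs w != [::].
Proof. by rewrite -size_eq0 size_cycle_pairs size_tuple. Qed.
Let wcN (w w' : walks) : cycle_pairs w ++ cycle_pairs w' != [::].
Proof. by rewrite -size_eq0 size_cat addn_eq0 size_eq0 (negbTE (wN w)). Qed.
Let swc (w w' : walks) : size (cycle_pairs w ++ cycle_pairs w') = (2 * k.+1)%N.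
Proof. by rewrite size_cat !size_cycle_pairs !size_tuple mul2n addnn. Qed.

Let iword (L : seq ('I_n * 'I_n)) : L != [::] -> P.-integrable setT (EFin \o word a L).
Proof. by move=> /(word_moment ha)[]. Qed.

Let meanw (L : seq ('I_n * 'I_n)) : L != [::] -> `|mean (word a L)| <= `|C (size L)|.
Proof.
move=> /(word_moment ha)[_ /le_trans]; apply.
by rewrite ler_piMr// invf_le1 ?exprn_gt0// exprn_ege1.
Qed.

Let sqr_walk_part (D : pred (seq 'I_n)) (t : T) :
  walk_part k D t ^+ 2 = (norming n k) ^- 2 *
    \sum_(w : walks | cycle (band (h n)) w && D w)
      \sum_(w' : walks | cycle (band (h n)) w' && D w')
        word a (cycle_pairs w ++ cycle_pairs w') t.
Proof.
rewrite exprMn exprVn; congr (_ * _); rewrite expr2 mulr_suml.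
apply: eq_bigr => w _; rewrite mulr_sumr; apply: eq_bigr => w' _.
by rewrite word_cat.
Qed.

Lemma mean_sqr_single :
  P.-integrable setT (EFin \o (fun t => walk_part (n := n) k has_single t ^+ 2)) /\
  mean (fun t => walk_part (n := n) k has_single t ^+ 2) <=
  `|C (2 * k.+1)%N| * ((meet_const k * walk_const k.+1 + walk_const k.+1 ^ 2)%:R)
  * (n%:R * bw n)^-1.
Proof.
have ii (w : walks) : P.-integrable setT (EFin \o (fun t =>
    \sum_(w' : walks | cycle (band (h n)) w' && has_single w')
       word a (cycle_pairs w ++ cycle_pairs w') t)).
  by apply: integrable_sumR => w' _; exact: iword.
under eq_fun do rewrite sqr_walk_part.
split; first by apply: integrableZ; apply: integrable_sumR => w _; exact: ii.
rewrite meanZ; last by apply: integrable_sumR => w _; exact: ii.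
rewrite mean_sum; last by move=> w _; exact: ii.
set K := (_ + _)%:R.
apply: (@le_trans _ _ (norming n k ^- 2 * (`|C (2 * k.+1)%N| *
   (b ^+ (2 * k) * nu ^+ 2 * K)))).
  rewrite ler_wpM2l ?invr_ge0 ?exprn_ge0 ?(ltW norming_gt0)//.
  apply: le_trans (ler_wpM2l (normr_ge0 _)
    (sum_single_pairs_le k b_ge1 b_nu card_nu degb)).
  rewrite mulr_sumr; apply: ler_sum => w _; rewrite mulr_sumr mean_sum; last first.
    by move=> w' _; exact: iword.
  apply: ler_sum => w' _; apply: le_trans (ler_norm _) _.
  by have [_] := word_moment ha (wcN w w'); rewrite swc map_cat.
rewrite le_eqVlt; apply/orP; left; apply/eqP.
rewrite nu_sqr -b_sqr /norming -/b exprMn -exprM [(k.+1 * 2)%N]mulnC.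
rewrite (_ : (2 * k.+1 = 2 * k + 2)%N); last by lia.
rewrite exprD; move: (b ^+ (2 * k)) (exprn_gt0 (2 * k) b_gt0) => bk bk0.
field; rewrite !gt_eqF ?exprn_gt0//.
Qed.

Lemma card_degenerate_le (D : pred (seq 'I_n)) :
  (forall w, D w -> degenerate w) ->
  \sum_(w : walks | cycle (band (h n)) w && D w) 1 <=
   b ^+ k * ((walk_const k.+1)%:R * n%:R) :> R.
Proof.
move=> Dd; rewrite -nu_sqr.
apply: (card_walks_le b_ge1 card_nu degb) => w /Dd /andP[_].
by rewrite size_tuple; lia.
Qed.

(** The mean of a product of 2z words is bounded, so it is enough to count. The
number of degenerate walks is smaller than the norming by a factor b^(1/2), for
each of the 2z words. High powers are needed for summability, because only some
power of 1 / b is summable. *)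
Lemma mean_pow_degenerate z : (0 < z)%N ->
  P.-integrable setT (EFin \o (fun t => walk_part (n := n) k degenerate t ^+ (2 * z))) /\
  mean (fun t => walk_part (n := n) k degenerate t ^+ (2 * z)) <=
  `|C (2 * z * k.+1)%N| * (walk_const k.+1)%:R ^+ (2 * z) * (bw n) ^- z.
Proof.
move=> z0; set m := (2 * z)%N.
pose D : pred walks := fun w => cycle (band (h n)) w && degenerate w.
pose L (f : {ffun 'I_m -> walks}) := flatten [seq cycle_pairs (f i) | i <- enum 'I_m].
have sL f : size (L f) = (m * k.+1)%N.
  rewrite size_flatten /shape -map_comp sumnE big_map big_enum/=.
  rewrite (eq_bigr (fun=> k.+1)); last by move=> i _; rewrite size_cycle_pairs size_tuple.
  by rewrite sum_nat_const card_ord.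
have LN f : L f != [::] by rewrite -size_eq0 sL muln_eq0 /m; lia.
have powE t : walk_part (n := n) k degenerate t ^+ m =
    norming n k ^- m * \sum_(f in ffun_on D) word a (L f) t.
  rewrite exprMn exprVn; congr (_ * _).
  rewrite -[m in LHS]card_ord -prodr_const.
  rewrite (bigA_distr_big _ (fun _ (w : walks) => word a (cycle_pairs w) t))/=.
  apply: eq_bigr => f _; rewrite /word /L big_flatten/= big_map.
  by rewrite big_enum.
under eq_fun do rewrite powE.
have ii f : f \in ffun_on D -> P.-integrable setT (EFin \o word a (L f)).
  by move=> _; exact: iword.
split; first by apply: integrableZ; exact: integrable_sumR.
rewrite meanZ; last exact: integrable_sumR.
rewrite mean_sum//.
have H : \sum_(f in ffun_on D) mean (word a (L f)) <=
    `|C (m * k.+1)%N| * (b ^+ k * ((walk_const k.+1)%:R * n%:R)) ^+ m.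
  apply: (@le_trans _ _ (\sum_(f in ffun_on D) `|C (m * k.+1)%N|)).
    apply: ler_sum => f _; apply: le_trans (ler_norm _) _.
    by have := meanw (LN f); rewrite sL.
  rewrite sumr_const -[leLHS]mulr_natr ler_wpM2l// card_ffun_on card_ord natrX.
  rewrite lerXn2r ?nnegrE ?ler0n ?mulr_ge0 ?exprn_ge0 ?(ltW b_gt0)//.
  apply: le_trans (card_degenerate_le (D := degenerate) _) => //.
  by rewrite sumr_const.
apply: le_trans (ler_wpM2l _ H) _; first by rewrite invr_ge0 exprn_ge0// ltW.
rewrite le_eqVlt; apply/orP; left; apply/eqP.
rewrite -b_sqr -exprM -/m /norming -/b !exprMn -!exprM.
rewrite (_ : (k.+1 * m = k * m + m)%N) ?mulSn 1?addnC// exprD.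
move: (b ^+ (k * m)) (exprn_gt0 (k * m) b_gt0) => x x0.
move: (b ^+ m) (exprn_gt0 m b_gt0) => y y0.
move: (n%:R ^+ m) (exprn_gt0 m n_gt0) => u u0.
by field; rewrite !gt_eqF.
Qed.

(** After subtraction of 1 from each word, a pair of walks without common edge
has a mean controlled by the rates Cl, since the walks and their union use all
their edges twice. Pairs with a common edge are counted in
[sum_doubled_pairs_le]. *)
Lemma mean_sqr_tree :
  P.-integrable setT
    (EFin \o (fun t => (walk_part (n := n) k tree_doubled t - tree_density n k) ^+ 2)) /\
  mean (fun t => (walk_part (n := n) k tree_doubled t - tree_density n k) ^+ 2) <=
  (walk_const k.+1)%:R ^+ 2 * (`|Cl k.+1 n| + 2 * `|Cl (k.+1)./2 n|) +
  (`|C (2 * k.+1)%N| + 2 * `|C k.+1| + 1) * (meet_const k * walk_const k.+1)%:R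
  * (n%:R * bw n)^-1.
Proof.
pose D : pred walks := fun w => cycle (band (h n)) w && tree_doubled w.
pose X (w : walks) t := word a (cycle_pairs w) t.
(* the means of the three words on the right are known separately *)
have X2 (w w' : walks) t : (X w t - 1) * (X w' t - 1) =
    word a (cycle_pairs w ++ cycle_pairs w') t - X w t - X w' t + 1.
  by rewrite word_cat /X; ring.
have ione : P.-integrable setT (EFin \o cst (1 : R)).
  by apply: finite_measure_integrable_cst.
have i2 (w w' : walks) :
    P.-integrable setT (EFin \o (fun t => (X w t - 1) * (X w' t - 1))).
  under eq_fun do rewrite X2.
  have -> : EFin \o (fun t => word a (cycle_pairs w ++ cycle_pairs w') t - X w t - X w' t + 1)
    = ((EFin \o word a (cycle_pairs w ++ cycle_pairs w')) \- (EFin \o X w) \- (EFin \o X w')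
       \+ (EFin \o cst 1%R))%E by apply/funext.
  by apply: integrableD => //; apply: integrableB => //; first apply: integrableB => //;
    apply: iword.
have m2 (w w' : walks) : mean (fun t => (X w t - 1) * (X w' t - 1)) =
    mean (word a (cycle_pairs w ++ cycle_pairs w')) - mean (X w) - mean (X w') + 1.
  rewrite /mean; under eq_Rintegral do rewrite X2.
  have iw := iword (wN w); have iw' := iword (wN w'); have iww := iword (wcN w w').
  have j1 : P.-integrable setT (EFin \o
      (fun t => word a (cycle_pairs w ++ cycle_pairs w') t - X w t)).
    by have := integrableB measurableT iww iw; congr (integrable _ _); apply/funext.
  have j2 : P.-integrable setT (EFin \o
      (fun t => word a (cycle_pairs w ++ cycle_pairs w') t - X w t - X w' t)).
    by have := integrableB measurableT j1 iw'; congr (integrable _ _); apply/funext.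
  have ione' : P.-integrable setT (EFin \o (fun=> 1 : R)) by exact: ione.
  rewrite (RintegralD measurableT j2 ione') (RintegralB measurableT j1 iw').
  rewrite (RintegralB measurableT iww iw).
  by rewrite mean_one.
have sumE t : (walk_part (n := n) k tree_doubled t - tree_density n k) ^+ 2 =
    norming n k ^- 2 * \sum_(w | D w) \sum_(w' | D w') (X w t - 1) * (X w' t - 1).
  rewrite /walk_part /tree_density -mulrBr exprMn exprVn; congr (_ * _).
  rewrite -sumrB expr2 mulr_suml; apply: eq_bigr => w _.
  by rewrite mulr_sumr.
under eq_fun do rewrite sumE.
have ii w : P.-integrable setT (EFin \o
    (fun t => \sum_(w' | D w') (X w t - 1) * (X w' t - 1))).
  by apply: integrable_sumR.
split; first by apply: integrableZ; apply: integrable_sumR.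
rewrite meanZ; last exact: integrable_sumR.
rewrite mean_sum//.
pose c1 := `|Cl k.+1 n| + 2 * `|Cl (k.+1)./2 n|.
pose c2 := `|C (2 * k.+1)%N| + 2 * `|C k.+1| + 1.
have c10 : 0 <= c1 by rewrite addr_ge0// mulr_ge0.
have c20 : 0 <= c2 by rewrite !addr_ge0// mulr_ge0.
have wN' (w : walks) : (w : seq 'I_n) != [::] by rewrite -size_eq0 size_tuple.
have half (w : walks) : tree_doubled w -> #|eset (cycle_edges w)| = (k.+1)./2.
  move=> tw; have [_] := tree_doubled_edges (wN' w) tw.
  by rewrite size_tuple => /(congr1 half); rewrite mul2n doubleK.
have X1 (w : walks) : tree_doubled w -> `|mean (X w) - 1| <= `|Cl (k.+1)./2 n|.
  move=> tw; rewrite -(half _ tw); apply: (word_square ha (wN w)).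
  by move=> e; exact: tree_doubled_count.
have pair (w w' : walks) : D w -> D w' -> mean (fun t => (X w t - 1) * (X w' t - 1)) <=
    c1 + c2 * (has (mem (cycle_edges w)) (cycle_edges w'))%:R.
  move=> /andP[_ tw] /andP[_ tw']; rewrite m2; case: hasP => [_|nohas].
    rewrite mulr1; apply: (@le_trans _ _ c2); last by rewrite lerDr.
    have := meanw (wcN w w'); rewrite swc => b1.
    have := meanw (wN w); have := meanw (wN w').
    rewrite !size_cycle_pairs !size_tuple -/(X w) -/(X w').
    move: b1; rewrite !ler_norml => /andP[? ?] /andP[? ?] /andP[? ?].
    by rewrite /c2; lra.
  rewrite mulr0 addr0.
  have nocommon e : e \in cycle_edges w -> e \notin cycle_edges w'.
    by move=> ew; apply/negP => ew'; apply: nohas; exists e.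
  have ecard : #|eset (map edge (cycle_pairs w ++ cycle_pairs w'))| = k.+1.
    have kE : (2 * (k.+1)./2 = k.+1)%N.
      by have [_] := tree_doubled_edges (wN' w) tw; rewrite size_tuple half.
    rewrite map_cat eset_cat.
    have := cardsUI (eset (cycle_edges w)) (eset (cycle_edges w')).
    rewrite [X in (_ + #|pred_of_set X|)%N](_ : _ = finset.set0); last first.
      apply/setP => e; rewrite !inE; apply/negP => /andP[ew ew'].
      by have := nocommon e ew; rewrite ew'.
    by rewrite cards0 addn0 !half// addnn -mul2n => ->.
  have cnt e : e \in map edge (cycle_pairs w ++ cycle_pairs w') ->
      count_mem e (map edge (cycle_pairs w ++ cycle_pairs w')) = 2%N.
    rewrite map_cat mem_cat count_cat -/(cycle_edges w) -/(cycle_edges w').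
    have [ew _|ew /= ew'] := boolP (e \in cycle_edges w).
      rewrite (tree_doubled_count (wN' w) tw ew).
      by have /count_memPn -> := nocommon e ew; rewrite addn0.
    by move/count_memPn : ew => ->; rewrite (tree_doubled_count (wN' w') tw' ew').
  have := word_square ha (wcN w w') cnt; rewrite ecard.
  have := X1 w tw; have := X1 w' tw'.
  rewrite !ler_norml => /andP[? ?] /andP[? ?] /andP[? ?].
  by rewrite /c1; lra.
have cntD : \sum_(w | D w) 1 <= b ^+ k.+1 * ((walk_const k.+1)%:R * nu ^+ 2) :> R.
  apply: (card_walks_le b_ge1 card_nu degb) => w /andP[_ /eqP].
  by rewrite size_tuple; case: #|vset w| => [//|v]; rewrite mulnS !add2n => -[->].
have cntD0 : 0 <= \sum_(w | D w) 1 :> R by apply: sumr_ge0.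
apply: (@le_trans _ _ (norming n k ^- 2 *
  (c1 * (b ^+ k.+1 * ((walk_const k.+1)%:R * nu ^+ 2)) ^+ 2 +
   c2 * (b ^+ (2 * k) * nu ^+ 2 * (meet_const k * walk_const k.+1)%:R)))).
  rewrite ler_wpM2l ?invr_ge0 ?exprn_ge0 ?(ltW norming_gt0)//.
  apply: (@le_trans _ _ (\sum_(w | D w) \sum_(w' | D w')
    (c1 + c2 * (has (mem (cycle_edges w)) (cycle_edges w'))%:R))).
    by apply: ler_sum => w Dw; rewrite mean_sum//; apply: ler_sum => w' Dw'; exact: pair.
  under eq_bigr do rewrite big_split/= -mulr_sumr.
  rewrite big_split/= -mulr_sumr; apply: lerD; last first.
    by rewrite ler_wpM2l//; exact: (sum_doubled_pairs_le k b_ge1 b_nu card_nu degb).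
  rewrite (eq_bigr (fun=> c1 * \sum_(w' | D w') 1)); last first.
    by move=> w _; rewrite mulr_sumr; apply: eq_bigr => w' _; rewrite mulr1.
  rewrite (eq_bigr (fun=> (c1 * \sum_(w' | D w') 1) * 1)); last by move=> w _; rewrite mulr1.
  rewrite -mulr_sumr -mulrA -expr2 ler_wpM2l//.
  by rewrite lerXn2r// nnegrE// (le_trans cntD0).
rewrite le_eqVlt; apply/orP; left; apply/eqP.
rewrite -/c1 -/c2 nu_sqr -b_sqr /norming -/b !exprMn -!exprM [(k.+1 * 2)%N]mulnC.
rewrite [(2 * k.+1)%N]mulnS exprD; move: (b ^+ (2 * k)) (exprn_gt0 (2 * k) b_gt0) => bk bk0.
by field; rewrite !gt_eqF ?exprn_gt0.
Qed.

(** A reducible walk has no once-used edge, so it is degenerate unless it is a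
doubled tree, and doubled trees are reducible. *)
Lemma tree_density_close :
  `|reducible_density h k n - tree_density n k| <= (walk_const k.+1)%:R / b.
Proof.
have wN' (w : walks) : (w : seq 'I_n) != [::] by rewrite -size_eq0 size_tuple.
rewrite /reducible_density -/(norming n k) mulrC -mulrBr.
rewrite (bigID (fun w : walks => tree_doubled w))/=.
rewrite (eq_bigl (fun w : walks => cycle (band (h n)) w && tree_doubled w)); last first.
  move=> w; rewrite -andbA; congr (_ && _); case tw : (tree_doubled w) => //=.
    by rewrite tree_doubled_reducible.
  by rewrite andbF.
rewrite addrAC subrr add0r normrM ger0_norm ?invr_ge0 ?(ltW norming_gt0)//.
rewrite ger0_norm ?sumr_ge0// mulrC ler_pdivrMr//.
apply: le_trans (_ : _ <= b ^+ k * ((walk_const k.+1)%:R * n%:R)) _.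
  rewrite (eq_bigl (fun w : walks => cycle (band (h n)) w &&
     (reducible w && ~~ tree_doubled w && (w != [::] :> seq _)))); last first.
    by move=> w; rewrite wN' andbT andbA.
  apply: (@card_degenerate_le (fun w => reducible w && ~~ tree_doubled w && (w != [::]))).
  move=> w /andP[/andP[/reducible_no_single ns nt] wnil].
  by have := no_singleP wnil; rewrite ns (negbTE nt).
rewrite le_eqVlt; apply/orP; left; apply/eqP; rewrite /norming -/b exprS.
by field; rewrite gt_eqF.
Qed.

End FixedN.
End Parts.

(** * Integration against the semicircle distribution *)

Section SemicircleIntegral.
Context {R : realType}.
Local Notation mu := (@lebesgue_measure R).
Import HBNNSimple.

Let pdf_ge0 (x : R) : (0 <= (semicircle_pdf x)%:E)%E.
Proof. by rewrite lee_fin semicircle_pdf_ge0. Qed.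

Let mpdf : measurable_fun [set: R] (EFin \o (@semicircle_pdf R)).
Proof. by apply/measurable_EFinP; exact: measurable_semicircle_pdf. Qed.

Let integral_semicircle_nnsfun (f : {nnsfun _ >-> R}) :
  (\int[semicircle]_x (f x)%:E =
   \int[mu]_x ((f x)%:E * (semicircle_pdf x)%:E))%E.
Proof.
have mfr r : measurable (f @^-1` [set r]) by [].
under [LHS]eq_integral do rewrite fimfunE -fsumEFin//.
rewrite [LHS]ge0_integral_fsum//; last 2 first.
  - by move=> r; exact/measurable_EFinP/measurableT_comp.
  - by move=> n x _; rewrite EFinM nnfun_muleindic_ge0.
under [RHS]eq_integral.
  move=> x xD; rewrite fimfunE -fsumEFin// ge0_mule_fsuml; last first.
    by move=> r; rewrite EFinM nnfun_muleindic_ge0.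
  over.
rewrite [RHS]ge0_integral_fsum//; last 2 first.
  - move=> r; apply: emeasurable_funM; last exact: mpdf.
    apply/measurable_EFinP; apply: measurable_funM; first exact: measurable_cst.
    by apply: measurable_indic; exact: mfr.
  - by move=> n x _; rewrite mule_ge0// EFinM nnfun_muleindic_ge0.
apply: eq_fsbigr => r _; under [RHS]eq_integral do rewrite EFinM -muleA.
have [r0|r0] := leP 0 r; last first.
  have -> : f @^-1` [set r] = set0.
    by apply/seteqP; split => // x /= fxr; have : 0 <= f x by []; rewrite fxr leNgt r0.
  by rewrite !integral0_eq// => x _; rewrite indic0 ?mulr0 ?mul0e ?mule0.
rewrite integralZl_indic_nnsfun// integral_indic// setIT ge0_integralZl//; last 2 first.
  - apply: emeasurable_funM; last exact: mpdf.
    by apply/measurable_EFinP; apply: measurable_indic; exact: mfr.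
  - by move=> x _; rewrite mule_ge0.
congr (_ * _)%E; rewrite [LHS]integral_mkcond; apply: eq_integral => x _.
by rewrite patchE indicE; case: ifP => _; rewrite ?mul1e ?mul0e.
Qed.

(** The distribution is given on sets by its density; integrals follow from simple
functions by monotone convergence. *)
Lemma ge0_integral_semicircle (f : R -> \bar R) :
  measurable_fun setT f -> (forall x, 0 <= f x)%E ->
  (\int[semicircle]_x f x = \int[mu]_x (f x * (semicircle_pdf x)%:E))%E.
Proof.
move=> mf f0.
pose f_ := nnsfun_approx measurableT mf.
have mf_ n : measurable_fun [set: R] (fun x => (f_ n x)%:E).
  exact/measurable_EFinP/measurable_funTS.
have nd_f x p q : (p <= q)%N -> f_ p x <= f_ q x.
  by move=> pq; exact/lefP/nd_nnsfun_approx.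
transitivity (lim (\int[semicircle]_x (f_ n x)%:E @[n --> \oo])%E).
  rewrite -monotone_convergence//=.
  - apply: eq_integral => ? /[!inE] xD; apply/esym/cvg_lim => //=.
    exact: cvg_nnsfun_approx.
  - by move=> n ? _; rewrite lee_fin.
  - by move=> x _ p q pq; rewrite lee_fin; exact: nd_f.
rewrite [RHS](_ : _ = lim
    (\int[mu]_x ((f_ n x)%:E * (semicircle_pdf x)%:E) @[n --> \oo])%E); last first.
  rewrite -monotone_convergence//=.
  - apply: eq_integral => ? /[!inE] xD; apply/esym/cvg_lim => //.
    by apply: cvgeZr => //; exact: cvg_nnsfun_approx.
  - by move=> n; apply: emeasurable_funM; [exact: mf_|exact: mpdf].
  - by move=> n ? _; rewrite mule_ge0// lee_fin.
  - by move=> x _ p q pq; rewrite lee_wpmul2r// lee_fin; exact: nd_f.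
by apply: congr_lim; apply/funext => n; exact: integral_semicircle_nnsfun.
Qed.

Let pdfE (x : R) : semicircle_pdf x =
  ((fun x => Num.sqrt (4 - x ^+ 2) / (2 * pi)) \_ `[(-2), 2]) x.
Proof. by rewrite /semicircle_pdf patchE mem_setE in_itv. Qed.

Lemma continuous_semicircle_sqrt : continuous (fun x : R => Num.sqrt (4 - x ^+ 2) / (2 * pi)).
Proof.
move=> x; apply: cvgMl.
apply: (@continuous_comp _ _ _ (fun y : R => 4 - y ^+ 2) Num.sqrt).
  by apply: cvgB; [exact: cvg_cst|exact: exprn_continuous].
exact: sqrt_continuous.
Qed.

Let integrable_mu_semicircle (f : R -> R) : continuous f ->
  mu.-integrable [set: R] (fun x => ((f x)%:E * (semicircle_pdf x)%:E)%E).
Proof.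
move=> cf.
pose g x := f x * (Num.sqrt (4 - x ^+ 2) / (2 * pi)).
have cg : continuous g.
  by move=> x; apply: cvgM; [exact: cf|exact: continuous_semicircle_sqrt].
have -> : (fun x => ((f x)%:E * (semicircle_pdf x)%:E)%E) = (EFin \o g) \_ `[(-2), 2].
  apply/funext => x; rewrite -EFinM pdfE !patchE /g /=.
  by case: ifP => //; rewrite mulr0.
rewrite -integrable_mkcond//.
apply: continuous_compact_integrable; first exact: segment_compact.
exact: continuous_subspaceT.
Qed.

Lemma integrable_semicircle (f : R -> R) : continuous f ->
  semicircle.-integrable [set: R] (EFin \o f).
Proof.
move=> cf; have mf : measurable_fun setT f by exact: continuous_measurable_fun.
apply/integrableP; split; first exact/measurable_EFinP.
rewrite ge0_integral_semicircle//; last by do 2 apply: measurableT_comp => //.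
have /integrableP[_] := integrable_mu_semicircle cf.
by under eq_integral do rewrite abseM [X in (_ * X)%E]gee0_abs//.
Qed.

Lemma Rintegral_semicircle (f : R -> R) : continuous f ->
  \int[semicircle]_x f x =
  \int[mu]_(x in `[(-2), 2]) (f x * (Num.sqrt (4 - x ^+ 2) / (2 * pi))).
Proof.
move=> cf; have mf : measurable_fun setT f by exact: continuous_measurable_fun.
have mEf : measurable_fun setT (EFin \o f) by exact/measurable_EFinP.
rewrite /Rintegral; congr fine; rewrite integralE.
rewrite ge0_integral_semicircle//; last exact: measurable_funepos.
rewrite ge0_integral_semicircle//; last exact: measurable_funeneg.
transitivity (\int[mu]_x ((f x)%:E * (semicircle_pdf x)%:E))%E; last first.
  rewrite [RHS]integral_mkcond; apply: eq_integral => x _.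
  by rewrite -EFinM pdfE !patchE; case: ifP => //; rewrite mulr0.
rewrite [RHS]integralE; congr (_ - _)%E; apply: eq_integral => x _.
- by rewrite !funeposE /= -EFinM -!EFin_max -EFinM maxr_pMl ?semicircle_pdf_ge0// mul0r.
- by rewrite !funenegE /= -!EFin_max -EFinM maxr_pMl
    ?semicircle_pdf_ge0// mul0r mulNr.
Qed.

End SemicircleIntegral.

(** * Moments of the semicircle distribution *)

Section SemicircleMoments.
Context {R : realType}.
Local Notation mu := (@lebesgue_measure R).

(** The Chebyshev polynomials of the second kind U_d, taken at x / 2. *)
Fixpoint chebyshev (d : nat) (x : R) : R :=
  if d is d'.+1 then
    if d' is d''.+1 then x * chebyshev d' x - chebyshev d'' x else x
  else 1.

Lemma chebyshevSS d x : chebyshev d.+2 x = x * chebyshev d.+1 x - chebyshev d x.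
Proof. by []. Qed.

Lemma continuous_chebyshev d : continuous (chebyshev d).
Proof.
suff : continuous (chebyshev d) /\ continuous (chebyshev d.+1) by case.
elim: d => [|d [IH1 IH2]]; first by split=> x; [exact: cvg_cst|exact: cvg_id].
split => // x; apply: cvgB; last exact: IH1.
by apply: cvgM; [exact: cvg_id|exact: IH2].
Qed.

Lemma chebyshev_cos d t : chebyshev d (2 * cos t) * sin t = sin (d.+1%:R * t).
Proof.
suff : chebyshev d (2 * cos t) * sin t = sin (d.+1%:R * t) /\
       chebyshev d.+1 (2 * cos t) * sin t = sin (d.+2%:R * t) by case.
elim: d => [|d [IH1 IH2]].
  by rewrite /= !mul1r; split => //; rewrite [2 * t]mulr_natl mulr2n sinD; ring.
split => //; rewrite chebyshevSS mulrBl -[_ * _ * sin t]mulrA IH2 IH1.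
have -> : d.+3%:R * t = d.+2%:R * t + t by rewrite -natr1 mulrDl mul1r.
have -> : d.+1%:R * t = d.+2%:R * t - t by rewrite -[d.+2%:R]natr1 mulrDl mul1r addrK.
by rewrite sinB sinD; ring.
Qed.

Let prim (d : nat) (t : R) : R :=
  pi^-1 * ((if d == 0%N then t else d%:R^-1 * sin (d%:R * t)) -
           d.+2%:R^-1 * sin (d.+2%:R * t)).

Let is_derive_sinM (c t : R) : is_derive t 1 (fun t => sin (c * t)) (c * cos (c * t)).
Proof.
have H : is_derive t 1 ( *%R c) c.
  by have := is_deriveZ (f := @id R) c (is_derive_id t 1); rewrite /GRing.scale/= mulr1.
have := is_derive1_comp (is_derive_sin (c * t)) H.
by rewrite mulrC.
Qed.

Let is_derive_prim (d : nat) (t : R) : is_derive t (1 : R) (prim d)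
  (pi^-1 * (cos (d%:R * t) - cos (d.+2%:R * t))).
Proof.
have H c : c != 0 -> is_derive t 1 (fun t : R => c^-1 * sin (c * t)) (cos (c * t)).
  move=> c0; have := is_deriveZ c^-1 (is_derive_sinM c t).
  by rewrite /GRing.scale/= mulrA mulVf// mul1r.
have H2 := H d.+2%:R; rewrite pnatr_eq0 in H2; have {}H2 := H2 isT.
have H1 : is_derive t 1 (fun t : R => if d == 0%N then t else d%:R^-1 * sin (d%:R * t))
    (cos (d%:R * t)).
  case: (eqVneq d 0%N) => [->|d0]; last by apply: H; rewrite pnatr_eq0.
  by rewrite mul0r cos0; exact: is_derive_id.
by have := is_deriveZ pi^-1 (is_deriveB H1 H2).
Qed.

Let integral_sin_sin d :
  (\int[mu]_(t in `[0%R, pi]) (pi^-1 * (cos (d%:R * t) - cos (d.+2%:R * t)))%:E =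
   (d == 0%N)%:R%:E)%E.
Proof.
have dp t : derivable (prim d) t 1 by case: (is_derive_prim d t).
have cp : continuous (prim d).
  by move=> t; apply/differentiable_continuous/derivable1_diffP.
rewrite (@continuous_FTC2 _ _ (prim d)) ?pi_gt0//.
- rewrite -EFinB /prim !mulr0 sin0 !mulr0.
  have sinpi m : sin (m%:R * pi) = 0 :> R.
    elim: m => [|m IH]; first by rewrite mul0r sin0.
    by rewrite -natr1 mulrDl mul1r sinDpi IH oppr0.
  rewrite !sinpi !mulr0 !subr0; case: eqP => _; last by rewrite mulr0 subr0.
  by rewrite mulr0 subr0 mulVf// gt_eqF// pi_gt0.
- have ccos (c : R) : continuous (fun t : R => cos (c * t)).
    move=> t; apply: (@cvg_comp _ _ _ ( *%R c) cos _ (nbhs (c * t)) _).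
      exact: mulrl_continuous.
    exact: continuous_cos.
  by apply: continuous_subspaceT => t; apply: cvgMr; apply: cvgB; exact: ccos.
- split => //; first by apply: cvg_at_right_filter; exact: cp.
  by apply: cvg_at_left_filter; exact: cp.
- by move=> t _; rewrite derive1E; case: (is_derive_prim d t).
Qed.

(** The substitution x = 2 cos t turns the integrand into a multiple of
sin ((d + 1) t) sin t, and these two sines are orthogonal on [0, pi] unless d = 0. *)
Lemma Rintegral_chebyshev d : \int[semicircle]_x chebyshev d x = (d == 0%N)%:R.
Proof.
rewrite Rintegral_semicircle; last exact: continuous_chebyshev.
rewrite /Rintegral.
pose G x := chebyshev d x * (Num.sqrt (4 - x ^+ 2) / (2 * pi)).
pose F (t : R) := 2 * cos t.
have dF (t : R) : is_derive t (1 : R) F (- (2 * sin t)).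
  by have := is_deriveZ 2 (is_derive_cos t); rewrite /GRing.scale/= mulrN.
have F'E : derive1 F = (fun t => - (2 * sin t)).
  by apply/funext => t; rewrite derive1E; case: (dF t).
have cF : continuous F.
  by move=> t; apply/differentiable_continuous/derivable1_diffP; case: (dF t).
have cF' : continuous (derive1 F).
  rewrite F'E => t; apply: cvgN; apply: cvgMr; exact: continuous_sin.
have FI : `[(-2), 2]%classic = `[F pi, F 0]%classic :> set R.
  by rewrite /F cospi cos0 mulrN1 mulr1.
transitivity (fine (\int[mu]_(x in `[F pi, F 0%R]) (G x)%:E)%E); first by rewrite FI.
rewrite (@integration_by_substitution_decreasing _ F G 0 pi) ?pi_ge0//; last 5 first.
- move=> x y; rewrite !in_itv/= => /andP[x0 xpi] /andP[y0 ypi] xy.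
  by rewrite /F ltr_pM2l// ltr_cos ?in_itv/= ?x0 ?y0.
- by apply/cvg_ex; exists (derive1 F 0); apply: cvg_at_right_filter; exact: cF'.
- by apply/cvg_ex; exists (derive1 F pi); apply: cvg_at_left_filter; exact: cF'.
- split; first by move=> x _; case: (dF x).
    by apply: cvg_at_right_filter; exact: cF.
  by apply: cvg_at_left_filter; exact: cF.
- apply: continuous_subspaceT => x; apply: cvgM; first exact: continuous_chebyshev.
  exact: continuous_semicircle_sqrt.
have -> : ((d == 0%N)%:R : R) = fine ((d == 0%N)%:R%:E : \bar R) by [].
rewrite -integral_sin_sin; congr fine; apply: eq_integral => t.
rewrite inE/= in_itv/= => /andP[t0 tpi]; congr EFin.
rewrite F'E /G /F /= !fctE opprK.
have st0 : 0 <= sin t by apply: sin_ge0_pi; rewrite t0.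
have -> : Num.sqrt (4 - (2 * cos t) ^+ 2) = 2 * sin t.
  have -> : 4 - (2 * cos t) ^+ 2 = (2 * sin t) ^+ 2.
    by rewrite !exprMn sin2cos2; ring.
  by rewrite sqrtr_sqr ger0_norm// mulr_ge0.
have dE : d.+1%:R = d%:R + 1 :> R by rewrite natr1.
have d2E : d.+2%:R = d%:R + 1 + 1 :> R by rewrite !natr1.
have -> : cos (d%:R * t) = cos (d.+1%:R * t - t).
  by rewrite dE mulrDl mul1r addrK.
have -> : cos (d.+2%:R * t) = cos (d.+1%:R * t + t).
  by rewrite d2E -dE mulrDl mul1r.
rewrite cosB cosD -chebyshev_cos.
have : (pi : R) != 0 by rewrite gt_eqF ?pi_gt0.
by move: (pi : R) => p p0; field.
Qed.

(** By the recursion of Chebyshev polynomials, a factor x moves the index d as one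
step of a ballot path moves the height. *)
Lemma Rintegral_expr_chebyshev r d :
  \int[semicircle]_x (x ^+ r * chebyshev d x) = (ballot r d)%:R.
Proof.
have cfun s e : continuous (fun x : R => x ^+ s * chebyshev e x).
  by move=> x; apply: cvgM; [exact: exprn_continuous|exact: continuous_chebyshev].
elim: r d => [|r IH] d.
  rewrite -Rintegral_chebyshev; apply: eq_Rintegral => x _.
  by rewrite expr0 mul1r.
case: d => [|d] /=.
  rewrite addn0 -IH; apply: eq_Rintegral => x _.
  by rewrite /= mulr1 exprSr.
rewrite natrD -!IH -RintegralD//; [|exact: integrable_semicircle..].
apply: eq_Rintegral => x _.
by rewrite chebyshevSS exprSr -/(chebyshev d.+1 x) -[LHS]mulrA mulrBr subrK.
Qed.

Lemma semicircle_moment r : \int[semicircle]_(x in [set: R]) (x ^+ r) = (ballot r 0)%:R.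
Proof.
rewrite -Rintegral_expr_chebyshev; apply: eq_Rintegral => x _.
by rewrite /= mulr1.
Qed.

End SemicircleMoments.

Lemma ballot_le r d : (ballot r d <= 2 ^ r)%N.
Proof.
elim: r d => [|r IH] d /=; first by case: (d == 0%N).
rewrite expnS mul2n -addnn leq_add//.
by case: d.
Qed.

(** * Approximation by polynomials *)

Section Weierstrass.
Context {R : realType}.
Implicit Types (f : R -> R) (g : nat -> R) (x : R).

(** The mean of g at a binomial variable with parameters n and x; the recursion
conditions on the first trial. *)
Fixpoint bernstein n g x : R :=
  if n is n'.+1 then x * bernstein n' (fun k => g k.+1) x + (1 - x) * bernstein n' g x
  else g 0%N.

Lemma bernstein_poly n g : exists q : {poly R}, forall x, q.[x] = bernstein n g x.
Proof.
elim: n g => [|n IH] g; first by exists (g 0%N)%:P => x; rewrite hornerC.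
have [q1 H1] := IH (fun k => g k.+1); have [q2 H2] := IH g.
by exists ('X * q1 + (1 - 'X) * q2) => x; rewrite !hornerE H1 H2.
Qed.

Lemma bernstein_le n g g' x : 0 <= x <= 1 ->
  (forall k, (k <= n)%N -> g k <= g' k) -> bernstein n g x <= bernstein n g' x.
Proof.
move=> /andP[x0 x1]; elim: n g g' => [|n IH] g g' gg' /=; first exact: gg'.
by apply: lerD; rewrite ler_wpM2l ?subr_ge0//; apply: IH => k kn; apply: gg'; lia.
Qed.

Lemma bernstein_affine n g a b x :
  bernstein n (fun k => a * g k + b) x = a * bernstein n g x + b.
Proof. by elim: n g => //= n IH g; rewrite !IH; ring. Qed.

(** The mean square distance of a binomial variable to c. *)
Lemma bernstein_sqr n c x :
  bernstein n (fun k => (k%:R - c) ^+ 2) x = (n%:R * x - c) ^+ 2 + n%:R * (x * (1 - x)).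
Proof.
elim: n c => [|n IH] c /=; first by ring.
have -> : (fun k => (k.+1%:R - c) ^+ 2) = (fun k => (k%:R - (c - 1)) ^+ 2).
  by apply/funext => k; rewrite -natr1; ring.
by rewrite !IH -natr1; ring.
Qed.

Lemma uniform_continuity01 f (e : R) : continuous f -> 0 < e ->
  exists2 d, 0 < d & forall x y, 0 <= x <= 1 -> `|x - y| < d -> `|f x - f y| <= e.
Proof.
move=> cf e0.
have /compact_near_coveringP : compact `[(0 : R), 1] by exact: segment_compact.
move=> /(_ R (0^'+) (fun d x => forall y, `|x - y| < d -> `|f x - f y| <= e)) H.
have {}H : \forall d \near 0^'+, `[0, 1] `<=`
    (fun x : R => forall y, `|x - y| < d -> `|f x - f y| <= e).
  apply: H => x _.
  have e2 : 0 < e / 2 by rewrite divr_gt0.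
  have := cf x => /cvgrPdist_lt/(_ _ e2)/nbhs_ballP[r /= r0 rf].
  have r2 : 0 < r / 2 by rewrite divr_gt0.
  exists (ball x (r / 2), [set d | 0 < d < r / 2]) => /=.
    split; first exact: nbhsx_ballx.
    near=> d; apply/andP; split; first by near: d; exact: nbhs_right_gt.
    by near: d; exact: nbhs_right_lt.
  move=> [x' d] /= [xx' /andP[d0 dr]] y yd.
  rewrite -(subrK (f x) (f x')) -addrA; apply: le_trans (ler_normD _ _) _.
  rewrite [e in leRHS](splitr e) lerD// ltW// ?[`|f x' - _|]distrC; apply: rf.
    by apply: (le_ball _ xx'); rewrite ler_pdivrMr// ler_peMr ?ler1n// ltW.
  rewrite /ball/=; have := ler_distD x' x y; move: xx'; rewrite /ball/= => xx' tri.
  apply: le_lt_trans tri _; rewrite [ltRHS]splitr ltrD//.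
  exact: lt_trans yd dr.
have [d [d0 dH]] : exists d, 0 < d /\ `[0, 1] `<=`
    (fun x : R => forall y, `|x - y| < d -> `|f x - f y| <= e).
  near (0 : R)^'+ => d; exists d; split; first by near: d; exact: nbhs_right_gt.
  by near: d.
exists d => // x y x01; apply: dH => /=; by rewrite in_itv.
Unshelve. all: end_near. Qed.

(** The value f (k / n) differs from f x by at most e / 2 if k / n is within d of
x, where d comes from uniform continuity, and by at most 2 M ((k / n - x) / d)^2
otherwise. The binomial mean of the second bound is of order 1 / n. *)
Lemma weierstrass01 f (M e : R) : continuous f -> (forall x, `|f x| <= M) -> 0 < e ->
  exists q : {poly R}, forall x, 0 <= x <= 1 -> `|f x - q.[x]| <= e.
Proof.
move=> cf fM e0.
have e2 : 0 < e / 2 by rewrite divr_gt0.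
have [d d0 df] := uniform_continuity01 cf e2.
have M0 : 0 <= M by apply: le_trans (fM 0).
pose n := (Num.truncn (4 * M / (d ^+ 2 * e))).+1.
have nM : 2 * M / d ^+ 2 / n%:R <= e / 2.
  have d20 : 0 < d ^+ 2 by rewrite exprn_gt0.
  rewrite ler_pdivrMr ?ltr0n//.
  have : 4 * M / (d ^+ 2 * e) <= n%:R by apply: ltW; exact: truncnS_gt.
  rewrite !ler_pdivrMr ?mulr_gt0// => H.
  have -> : e / 2 * n%:R * d ^+ 2 = (n%:R * (d ^+ 2 * e)) / 2 by field.
  by rewrite ler_pdivlMr//; lra.
have n0 : 0 < n%:R :> R by rewrite ltr0n.
have [q qE] := bernstein_poly n (fun k => f (k%:R / n%:R)).
exists q => x x01; rewrite qE distrC.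
have key k : `|f (k%:R / n%:R) - f x| <=
    (2 * M / d ^+ 2 / n%:R ^+ 2) * (k%:R - n%:R * x) ^+ 2 + e / 2.
  have -> : (2 * M / d ^+ 2 / n%:R ^+ 2) * (k%:R - n%:R * x) ^+ 2 =
      2 * M / d ^+ 2 * (x - k%:R / n%:R) ^+ 2.
    by field; rewrite !gt_eqF.
  have [lt_d|ge_d] := ltP `|x - k%:R / n%:R| d.
    rewrite distrC; apply: le_trans (df _ _ x01 lt_d) _.
    by rewrite lerDr mulr_ge0 ?sqr_ge0// divr_ge0 ?sqr_ge0// mulr_ge0.
  apply: (@le_trans _ _ (2 * M)).
    apply: le_trans (ler_normB _ _) _.
    by rewrite [2 * M]mulr_natl mulr2n lerD.
  rewrite ler_wpDr ?(ltW e2)// -mulrA ler_peMr ?mulr_ge0//.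
  rewrite mulrC ler_pdivlMr ?exprn_gt0// mul1r -[leRHS]real_normK ?num_real//.
  by rewrite ler_sqr ?nnegrE// ltW.
have [x0 x1] := andP x01.
have xx : x * (1 - x) <= 1.
  have : 0 <= x * x by rewrite mulr_ge0.
  by rewrite mulrBr mulr1; lra.
have bound : (2 * M / d ^+ 2 / n%:R ^+ 2) *
   bernstein n (fun k => (k%:R - n%:R * x) ^+ 2) x + e / 2 <= e.
  rewrite bernstein_sqr subrr expr0n add0r [leRHS]splitr lerD2r.
  apply: le_trans nM.
  have -> : 2 * M / d ^+ 2 / n%:R ^+ 2 * (n%:R * (x * (1 - x))) =
     (2 * M / d ^+ 2 / n%:R) * (x * (1 - x)) by field; rewrite !gt_eqF.
  by rewrite ler_piMr// !divr_ge0 ?sqr_ge0// ?mulr_ge0// ler0n.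
rewrite ler_norml; apply/andP; split.
  rewrite lerNl opprB.
  have := bernstein_affine n (fun k => f (k%:R / n%:R)) (-1) (f x) x.
  rewrite mulN1r addrC => <-; apply: le_trans bound.
  rewrite -bernstein_affine; apply: bernstein_le => // k _.
  by apply: le_trans (key k); rewrite mulN1r addrC distrC ler_norm.
have := bernstein_affine n (fun k => f (k%:R / n%:R)) 1 (- f x) x.
rewrite mul1r => <-; apply: le_trans bound.
rewrite -bernstein_affine; apply: bernstein_le => // k _.
by apply: le_trans (key k); rewrite mul1r ler_norm.
Qed.

Lemma weierstrass f (M K e : R) : continuous f -> (forall x, `|f x| <= M) ->
  0 < K -> 0 < e ->
  exists q : {poly R}, forall x, `|x| <= K -> `|f x - q.[x]| <= e.
Proof.
move=> cf fM K0 e0.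
have cg : continuous (fun x => f (2 * K * x - K)).
  move=> x; apply: (@cvg_comp _ _ _ (fun x => 2 * K * x - K) f _ (nbhs (2 * K * x - K))).
    by apply: cvgB; [exact: mulrl_continuous|exact: cvg_cst].
  exact: cf.
have [q qH] := weierstrass01 cg (fun x => fM _) e0.
exists (q \Po ((2 * K)^-1 *: ('X + K%:P))) => x; rewrite ler_norml => /andP[xK1 xK2].
rewrite horner_comp !hornerE.
have K20 : 0 < 2 * K by rewrite mulr_gt0.
have -> : f x = f (2 * K * ((2 * K)^-1 * (x + K)) - K).
  by congr f; rewrite mulrA mulfV ?gt_eqF// mul1r addrK.
apply: qH; rewrite mulrC ler_pdivrMr// divr_ge0 ?(ltW K20)//=; last by lra.
by lra.
Qed.

Lemma poly_norm_le (q : {poly R}) :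
  exists2 A, 0 <= A & forall x, 1 <= `|x| -> `|q.[x]| <= A * `|x| ^+ size q.
Proof.
exists (\sum_(i < size q) `|q`_i|); first by rewrite sumr_ge0.
move=> x x1; rewrite horner_coef mulr_suml; apply: le_trans (ler_norm_sum _ _ _) _.
apply: ler_sum => i _; rewrite normrM normrX ler_wpM2l//.
by rewrite ler_weXn2l// ltnW.
Qed.

(** The polynomial q is close to f on [-3, 3]. Beyond, both are bounded by a
multiple of |x|^N with N fixed, and therefore by the same multiple of
3^N (x / 3)^(2m) for large m. As 9 > 4, the coefficient of x^(2m) is small even
against 4^m, a bound for the 2m-th moment of the semicircle distribution; this
is why the radius 3 exceeds 2. *)
Lemma poly_approx_majorant f (M e : R) : continuous f -> (forall x, `|f x| <= M) ->
  0 < e ->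
  exists (q : {poly R}) (c : R) (m : nat),
    [/\ 0 <= c, c * 4 ^+ m <= e &
        forall x, `|f x - q.[x]| <= e + c * x ^+ (2 * m)].
Proof.
move=> cf fM e0; have M0 : 0 <= M by apply: le_trans (fM 0).
have [q qH] := weierstrass cf fM (ltr0n R 3) e0.
have [A A0 qA] := poly_norm_le q.
set N := size q in qA; pose D := (M + A) * 3 ^+ N.
have D0 : 0 <= D by rewrite mulr_ge0 ?exprn_ge0 ?addr_ge0.
have [m0 m0H] : exists m0, forall m, (m0 <= m)%N -> D * (4 / 9) ^+ m <= e.
  have : D * (4 / 9) ^+ m @[m --> \oo] --> (0 : R).
    rewrite -(mulr0 D); apply: cvgMr; apply: cvg_expr.
    by rewrite ger0_norm; lra.
  by move=> /(cvgr_lt 0)/(_ _ e0)[m0 _ m0H]; exists m0 => m mm; apply: ltW; exact: m0H.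
pose m := maxn m0 N; exists q, (D / 9 ^+ m), m; split.
- by rewrite divr_ge0 ?exprn_ge0.
- by rewrite mulrAC -mulrA -expr_div_n m0H// leq_maxl.
move=> x; have [x3|x3] := leP `|x| 3.
  apply: le_trans (qH x x3) _; rewrite lerDl; apply: mulr_ge0.
    by rewrite divr_ge0 ?exprn_ge0.
  by rewrite exprM exprn_ge0// sqr_ge0.
have x1 : 1 <= `|x| by apply: ltW; apply: lt_trans x3; rewrite ltr1n.
have x0 : 0 < `|x| by apply: lt_le_trans x1.
apply: le_trans (ler_normB _ _) _; rewrite ler_wpDl ?(ltW e0)//.
apply: (@le_trans _ _ ((M + A) * `|x| ^+ N)).
  rewrite mulrDl lerD ?qA//; apply: le_trans (fM x) _.
  by rewrite ler_peMr// exprn_ege1.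
rewrite /D -!mulrA ler_wpM2l ?addr_ge0//.
have -> : x ^+ (2 * m) = `|x| ^+ N * `|x| ^+ (2 * m - N).
  rewrite -exprD subnKC; last by rewrite /m; lia.
  by rewrite !exprM real_normK ?num_real.
have -> : 9 ^+ m = 3 ^+ N * 3 ^+ (2 * m - N) :> R.
  rewrite -exprD subnKC; last by rewrite /m; lia.
  by rewrite exprM; congr (_ ^+ _); ring.
have -> : 3 ^+ N * ((3 ^+ N * 3 ^+ (2 * m - N))^-1 * (`|x| ^+ N * `|x| ^+ (2 * m - N))) =
    `|x| ^+ N * (`|x| / 3) ^+ (2 * m - N).
  by rewrite expr_div_n; field; rewrite !expf_neq0.
rewrite ler_peMr ?exprn_ge0// exprn_ege1// ler_pdivlMr// mul1r.
exact: ltW.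
Qed.

End Weierstrass.

(** * The spectrum of a symmetric matrix *)

Section Spectral.
Import complex.
Context {R : realType}.

Lemma mup_prod_XsubC (s : seq R) y :
  mup y (\prod_(x <- s) ('X - x%:P)) = count_mem y s.
Proof.
elim: s => [|x s IH].
  by rewrite big_nil mupNroot// root1.
rewrite big_cons mupM ?polyXsubC_eq0//; last first.
  by rewrite monic_neq0// monic_prod_XsubC.
by rewrite IH /= -['X - _]expr1 mup_XsubCX; case: eqP => //= _; rewrite ?mul1n.
Qed.

Lemma perm_eigenvalues n (A : 'M[R]_n) (s : seq R) :
  char_poly A = \prod_(x <- s) ('X - x%:P) -> perm_eq (eigenvalues A) s.
Proof.
rewrite /eigenvalues => ->; set p := \prod_(x <- s) _.
have p0 : p != 0 by rewrite monic_neq0// monic_prod_XsubC.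
have inroots y : (y \in polyrcf.rootsR p) = (y \in s).
  have := polyrcf.roots_on_rootsR p0 y; rewrite in_itv/= => <-.
  by rewrite root_prod_XsubC.
have ur : uniq (polyrcf.rootsR p) by exact: polyrcf.uniq_roots.
apply/permP => a; rewrite count_flatten -map_comp sumnE big_map.
rewrite (eq_bigr (fun x => mup x p * a x)%N); last first.
  by move=> x _ /=; rewrite count_nseq mulnC.
under eq_bigr do rewrite mup_prod_XsubC.
rewrite -[RHS]size_filter -sum1_size big_filter.
rewrite [RHS]big_mkcond/= -[RHS]big_undup_iterop_count/=.
rewrite (perm_big (undup s))/=; last first.
  by apply: (uniq_perm ur (undup_uniq s)) => y; rewrite inroots mem_undup.
apply: eq_bigr => x _; rewrite Monoid.iteropE iter_addn_0 mulnC.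
by case: (a x); rewrite ?mul1n ?mul0n.
Qed.

Lemma char_poly_conj (F : fieldType) n (P D : 'M[F]_n) : P \in unitmx ->
  char_poly (invmx P *m D *m P) = char_poly D.
Proof.
move=> Pu; rewrite /char_poly /char_poly_mx.
set Q := map_mx polyC P; set Q' := map_mx polyC (invmx P).
have Q'Q : Q' *m Q = 1%:M by rewrite -map_mxM mulVmx// map_mx1.
have -> : 'X%:M - map_mx polyC (invmx P *m D *m P) =
    Q' *m ('X%:M - map_mx polyC D) *m Q.
  rewrite mulmxBr mulmxBl !map_mxM; congr (_ - _).
  by rewrite scalar_mxC -mulmxA Q'Q mulmx1.
by rewrite !det_mulmx mulrAC -det_mulmx Q'Q det1 mul1r.
Qed.

Lemma conj_expmx (F : fieldType) n (P D : 'M[F]_n) k : P \in unitmx ->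
  (invmx P *m D *m P) ^+ k = invmx P *m (D ^+ k) *m P.
Proof.
move=> Pu; elim: k => [|k IH]; first by rewrite !expr0 mulmx1 mulVmx.
rewrite !exprSr IH -[LHS]/(_ *m _) -[in RHS]/(D ^+ k *m D).
by rewrite !mulmxA mulmxK.
Qed.

Lemma diag_expmx (F : fieldType) n (d : 'rV[F]_n) k :
  diag_mx d ^+ k = diag_mx (\row_j d 0 j ^+ k).
Proof.
elim: k => [|k IH].
  by rewrite expr0; apply/matrixP => i j; rewrite !mxE expr0.
rewrite exprSr IH -[LHS]/(_ *m _) mulmx_diag; congr diag_mx.
by apply/rowP => j; rewrite !mxE exprSr.
Qed.

(** Over the complex numbers A is Hermitian, so it is diagonalised by a unitary
matrix and its eigenvalues are real. *)
Lemma symmetric_spectrum n (A : 'M[R]_n) : A^T = A ->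
  exists s : seq R, char_poly A = \prod_(x <- s) ('X - x%:P) /\
    forall k, \tr (A ^+ k) = \sum_(x <- s) x ^+ k.
Proof.
move=> Asym; pose C : numClosedFieldType := complex.complex R.
pose toC : {rmorphism R -> C} := complex.real_complex R.
have toC_inj : injective toC by exact: complex.complexI.
pose Ac : 'M[C]_n := map_mx toC A.
have Ac_herm : Ac \is hermsymmx.
  apply: realsym_hermsym.
    by apply/is_hermitianmxP; rewrite expr0 scale1r map_mx_id// /Ac map_trmx Asym.
  by apply/mxOverP => i j; rewrite mxE; apply/complex.complex_realP; exists (A i j).
have /orthomx_spectralP AcE := hermitian_normalmx Ac_herm.
have /mxOverP dreal := hermitian_spectral_diag_real Ac_herm.
have Pu := spectral_unit Ac; move: (spectralmx Ac) AcE Pu => P.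
move: (spectral_diag Ac) dreal => dc dreal AcE Pu.
pose d j := complex.Re (dc 0 j).
have dE j : dc 0 j = toC (d j) by rewrite /d /toC/= complex.RRe_real// dreal.
exists [seq d j | j <- enum 'I_n]; split.
  apply: (map_poly_inj toC); rewrite map_char_poly -/Ac AcE char_poly_conj//.
  rewrite char_poly_trig ?diag_mx_is_trig// big_map rmorph_prod/=.
  rewrite big_enum/=; apply: eq_bigr => j _.
  by rewrite rmorphB/= map_polyX map_polyC/= !mxE eqxx mulr1n dE.
move=> k; apply: toC_inj; rewrite -trace_map_mx.
have -> : map_mx toC (A ^+ k) = Ac ^+ k.
  elim: k => [|k IH]; first by rewrite !expr0 map_mx1.
  by rewrite !exprSr -IH; exact: map_mxM.
rewrite AcE conj_expmx// mxtrace_mulC mulmxA mulmxV// mul1mx diag_expmx mxtrace_diag.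
rewrite big_map rmorph_sum/= big_enum/=; apply: eq_bigr => j _.
by rewrite mxE rmorphXn/= dE.
Qed.

Lemma sum_eigenvalues_expr n (A : 'M[R]_n) k : A^T = A ->
  \sum_(x <- eigenvalues A) x ^+ k = \tr (A ^+ k).
Proof.
move=> /symmetric_spectrum[s [sA ->]].
by rewrite (perm_big _ (perm_eigenvalues sA)).
Qed.

Lemma size_eigenvalues n (A : 'M[R]_n) : A^T = A -> size (eigenvalues A) = n.
Proof.
move=> /symmetric_spectrum[s [sA _]].
rewrite (perm_size (perm_eigenvalues sA)).
have := size_char_poly A; rewrite sA size_prod_seq; last first.
  by move=> i _; rewrite polyXsubC_eq0.
rewrite (eq_bigr (fun=> 2%N)); last by move=> i _; rewrite size_XsubC.
by rewrite big_const_seq iter_addn_0 count_predT mul2n -addnn subSn ?leq_addr// addnK => -[].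
Qed.

End Spectral.

(** * Integration against the spectral distribution *)

Section EsdIntegral.
Context {R : realType}.

Lemma ge0_integral_esd n (A : 'M[R]_n) (f : R -> \bar R) :
  measurable_fun setT f -> (forall x, 0 <= f x)%E ->
  (\int[esd A]_x f x = (n%:R^-1)%:E * \sum_(k < size (eigenvalues A)) f (eigenvalues A)`_k)%E.
Proof.
move=> mf f0; rewrite /esd ge0_integral_mscale//; congr (_ * _)%E.
rewrite ge0_integral_measure_sum//; apply: eq_bigr => k _.
by rewrite integral_dirac// diracT mul1e.
Qed.

Lemma Rintegral_esd n (A : 'M[R]_n) (f : R -> R) : continuous f ->
  \int[esd A]_x f x = n%:R^-1 * \sum_(x <- eigenvalues A) f x.
Proof.
move=> cf; have mf : measurable_fun setT f by exact: continuous_measurable_fun.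
have mEf : measurable_fun setT (EFin \o f) by exact/measurable_EFinP.
rewrite /Rintegral integralE.
rewrite ge0_integral_esd//; last exact: measurable_funepos.
rewrite ge0_integral_esd//; last exact: measurable_funeneg.
under eq_bigr do rewrite funeposE/= -EFin_max.
under [in X in (_ - X)%E]eq_bigr do rewrite funenegE/= -EFin_max.
rewrite !sumEFin -!EFinM -EFinB/= -mulrBr -sumrB; congr (_ * _).
rewrite (big_nth 0) big_mkord; apply: eq_bigr => k _.
by case: (ltgtP (f (eigenvalues A)`_k) 0) => [lt0|gt0|->];
  rewrite ?oppr0 ?maxxx ?subr0//; [rewrite (max_idPl _) ?sub0r ?opprK// oppr_ge0 ltW
  |rewrite (max_idPr _) ?subr0// oppr_le0 ltW].
Qed.

End EsdIntegral.

(** * From moments to the semicircle law *)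

(** The numbers x, q, p are the integrals of a function, of its approximation and
of the majorant of the error against a spectral distribution, and sx, sq, sp those
against the semicircle distribution. As p < 2 e, the distances from x to q, from
q to sq and from sq to sx are at most 3 e, e and 2 e. *)
Lemma four_term_bound (R : realFieldType) (x q p sx sq sp e eps : R) :
  eps = 6 * e -> `|q - sq| < e -> `|p - sp| < e ->
  `|x - q| <= e + p -> `|sx - sq| <= e + sp -> sp <= e -> `|x - sx| < eps.
Proof.
move=> ->; rewrite !ltr_norml !ler_norml.
move=> /andP[? ?] /andP[? ?] /andP[? ?] /andP[? ?] ?.
by apply/andP; split; lra.
Qed.

Section MomentMethod.
Context {d : measure_display} {T : measurableType d} {R : realType}
  {P : probability T R} (N : (nat -> R) -> Prop) (nN : null_class N).
Variable A : forall n, T -> 'M[R]_n.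
Hypotheses (A_sym : forall n t, (A n t)^T = A n t)
  (mA : forall n k, measurable_fun setT (fun t => \tr (A n t ^+ k)))
  (tA : forall k, tends (P := P) N (fun n t => n%:R^-1 * \tr (A n t ^+ k)) (ballot k 0)%:R).

Let I (f : R -> R) n t := \int[esd (A n t)]_x f x.

Lemma esd_horner (q : {poly R}) n t :
  I (horner q) n t = \sum_(i < size q) q`_i * (n%:R^-1 * \tr (A n t ^+ i)).
Proof.
rewrite /I Rintegral_esd; last exact: continuous_horner.
under eq_bigr do rewrite horner_coef.
rewrite exchange_big/= mulr_sumr; apply: eq_bigr => i _.
by rewrite -sum_eigenvalues_expr// -mulr_sumr mulrCA.
Qed.

(** Every single matrix has a bounded spectrum, so the integral is a pointwise limit
of integrals of polynomials, which are combinations of traces of powers. *)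
Lemma measurable_esd_horner (q : {poly R}) n : measurable_fun setT (I (horner q) n).
Proof.
rewrite (_ : I _ n = fun t => \sum_(i < size q) q`_i * (n%:R^-1 * \tr (A n t ^+ i))).
  apply: measurable_sum => i; do 2 (apply: measurable_funM; first exact: measurable_cst).
  exact: mA.
by apply/funext => t; exact: esd_horner.
Qed.

Lemma tends_esd_horner (q : {poly R}) :
  tends (P := P) N (I (horner q)) (\sum_(i < size q) q`_i * (ballot i 0)%:R).
Proof.
have mY m n : measurable_fun setT
    (fun t => \sum_(i < m) q`_i * (n%:R^-1 * \tr (A n t ^+ i))).
  apply: measurable_sum => i; do 2 (apply: measurable_funM; first exact: measurable_cst).
  exact: mA.
have mZ i n : measurable_fun setT (fun t => n%:R^-1 * \tr (A n t ^+ i)).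
  by apply: measurable_funM; [exact: measurable_cst|exact: mA].
have -> : I (horner q) = fun n t => \sum_(i < size q) q`_i * (n%:R^-1 * \tr (A n t ^+ i)).
  by apply/funext => n; apply/funext => t; exact: esd_horner.
elim: (size q) => [|m IH].
  have -> : (fun n t => \sum_(i < 0) q`_i * (n%:R^-1 * \tr (A n t ^+ i))) =
      (fun n (t : T) => cst (0 : R) n).
    by apply/funext => n; apply/funext => t; rewrite big_ord0.
  rewrite big_ord0; apply: (tends_cst nN (tA 0 ltr01)).
  exact: cvg_cst.
have -> : (fun n t => \sum_(i < m.+1) q`_i * (n%:R^-1 * \tr (A n t ^+ i))) =
    (fun n t => (\sum_(i < m) q`_i * (n%:R^-1 * \tr (A n t ^+ i))) +
                q`_m * (n%:R^-1 * \tr (A n t ^+ m))).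
  by apply/funext => n; apply/funext => t; rewrite big_ord_recr.
rewrite big_ord_recr/=; apply: (tendsD nN (mY m) _ IH) => [n|].
  by apply: measurable_funM; [exact: measurable_cst|exact: mZ].
by apply: (tendsZ nN _ (mZ m)); exact: tA.
Qed.

Lemma semicircle_horner (q : {poly R}) :
  \int[semicircle]_x q.[x] = \sum_(i < size q) q`_i * (ballot i 0)%:R.
Proof.
have iX i : semicircle.-integrable [set: R] (EFin \o (fun x : R => x ^+ i)).
  by apply: integrable_semicircle; exact: exprn_continuous.
rewrite (_ : \int[semicircle]_x q.[x] =
  \int[semicircle]_x (\sum_(i < size q) q`_i * x ^+ i)); last first.
  by apply: eq_Rintegral => x _; rewrite horner_coef.
elim: (size q) => [|m IH].
  rewrite big_ord0; under eq_Rintegral do rewrite big_ord0.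
  by rewrite /Rintegral integral0.
rewrite big_ord_recr/= -IH -semicircle_moment -RintegralZl//.
rewrite -RintegralD//; last 2 first.
- apply: integrable_semicircle.
  rewrite (_ : (fun x => _) = horner (\poly_(i < m) q`_i)); first exact: continuous_horner.
  by apply/funext => x; rewrite horner_poly.
- apply: integrable_semicircle => x; apply: cvgMr; exact: exprn_continuous.
by apply: eq_Rintegral => x _; rewrite big_ord_recr.
Qed.

Lemma measurable_esd (f : R -> R) (M : R) n : continuous f -> (forall x, `|f x| <= M) ->
  measurable_fun setT (I f n).
Proof.
move=> cf fM.
have /choice[q qH] : forall j : nat, exists q : {poly R}, forall x,
    `|x| <= j.+1%:R -> `|f x - q.[x]| <= j.+1%:R^-1.
  by move=> j; apply: (weierstrass cf fM); rewrite ?invr_gt0 ltr0n.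
apply: (measurable_fun_cvg (h := fun j => I (horner (q j)) n)).
  by move=> j; exact: measurable_esd_horner.
move=> t _; rewrite /I Rintegral_esd//.
have -> : (fun j => \int[esd (A n t)]_x (q j).[x]) =
    (fun j => n%:R^-1 * \sum_(x <- eigenvalues (A n t)) (q j).[x]).
  by apply/funext => j; rewrite Rintegral_esd//; exact: continuous_horner.
apply: cvgMr; elim: (eigenvalues _) => [|x s IH].
  by under eq_fun do rewrite big_nil; rewrite big_nil; exact: cvg_cst.
under eq_fun do rewrite big_cons.
rewrite big_cons; apply: cvgD => //.
apply/cvgrPdist_le => e e0.
near=> j; apply: le_trans (qH j x _) _.
  have : `|x| <= j%:R by near: j; exact: nbhs_infty_ger.
  by move=> /le_trans; apply; rewrite ler_nat.
rewrite -[leRHS]invrK lef_pV2 ?posrE ?invr_gt0//.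
have : e^-1 <= j%:R by near: j; exact: nbhs_infty_ger.
by move=> /le_trans; apply; rewrite ler_nat.
Unshelve. all: end_near. Qed.

(** The error of the polynomial approximation is bounded through a multiple of one
even moment, whose convergence is part of the assumptions. *)
Theorem tends_esd (f : R -> R) (M : R) : continuous f -> (forall x, `|f x| <= M) ->
  tends (P := P) N (I f) (\int[semicircle]_x f x).
Proof.
move=> cf fM eps eps0.
have e0 : 0 < eps / 6 by rewrite divr_gt0.
set e := eps / 6 in e0.
have [q [c [m [c0 cm fq]]]] := poly_approx_majorant cf fM e0.
pose p : {poly R} := c *: 'X^(2 * m).
have pE x : p.[x] = c * x ^+ (2 * m) by rewrite !hornerE.
have tq := tends_esd_horner q; have tp := tends_esd_horner p.
rewrite -semicircle_horner in tq; rewrite -semicircle_horner in tp.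
apply: (tends2_le nN (measurable_esd_horner q) (measurable_esd_horner p)
  (fun n => measurable_esd n cf fM) e0 e0 tq tp).
have cq : continuous (horner q) by exact: continuous_horner.
have cp : continuous (horner p) by exact: continuous_horner.
have sp : \int[semicircle]_x p.[x] <= e.
  rewrite (_ : \int[semicircle]_x p.[x] = \int[semicircle]_x (c * x ^+ (2 * m))); last first.
    by apply: eq_Rintegral => x _; rewrite pE.
  rewrite RintegralZl//; last first.
    by apply: integrable_semicircle; exact: exprn_continuous.
  rewrite semicircle_moment; apply: le_trans cm; rewrite ler_wpM2l//.
  rewrite -[4](_ : 2 ^+ 2 = _ :> R); last by ring.
  by rewrite -exprM -natrX ler_nat ballot_le.
have iones : semicircle.-integrable [set: R] (EFin \o (fun=> e)).
  by apply: integrable_semicircle => x; exact: cvg_cst.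
have sone : \int[semicircle]_(x in [set: R]) e = e.
  have := @semicircle_moment R 0; rewrite /= => s1.
  rewrite -[LHS](_ : \int[semicircle]_(x in [set: R]) (e * x ^+ 0) = _); last first.
    by apply: eq_Rintegral => x _; rewrite expr0 mulr1.
  rewrite RintegralZl//; first by rewrite s1 mulr1.
  by apply: integrable_semicircle; exact: exprn_continuous.
have sf : `|\int[semicircle]_x f x - \int[semicircle]_x q.[x]| <=
    e + \int[semicircle]_x p.[x].
  rewrite -RintegralB//; [|exact: integrable_semicircle..].
  have ifq : semicircle.-integrable [set: R] (EFin \o (fun x => f x - q.[x])).
    by apply: integrable_semicircle => x; apply: cvgB; [exact: cf|exact: cq].
  apply: le_trans (le_normr_Rintegral _ ifq) _ => //.
  rewrite -[X in X + _]sone -RintegralD//; last exact: integrable_semicircle.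
  apply: le_Rintegral => //.
  - apply: integrable_semicircle => x.
    by apply: cvg_norm; apply: cvgB; [exact: cf|exact: cq].
  - apply: integrable_semicircle => x; apply: cvgD; [exact: cvg_cst|exact: cp].
  - by move=> x _; rewrite pE; exact: fq.
exists 1%N => // n /= n1 t Hq Hp.
have If : `|I f n t - I (horner q) n t| <= e + I (horner p) n t.
  rewrite /I !Rintegral_esd// -mulrBr -sumrB normrM ger0_norm ?invr_ge0//.
  apply: (@le_trans _ _ (n%:R^-1 * \sum_(x <- eigenvalues (A n t)) (e + p.[x]))).
    rewrite ler_wpM2l ?invr_ge0//; apply: le_trans (ler_norm_sum _ _ _) _.
    by apply: ler_sum => x _; rewrite pE; exact: fq.
  rewrite big_split/= mulrDr lerD2r big_const_seq count_predT size_eigenvalues//.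
  by rewrite iter_addr_0 -[e *+ n]mulr_natl mulrA mulVf ?mul1r// pnatr_eq0 -lt0n.
apply: (four_term_bound _ Hq Hp If sf sp).
by rewrite /e mulrC divfK.
Qed.

End MomentMethod.

(** * Moments of the band matrix *)

Section BandMoments.
Context {d : measure_display} {T : measurableType d} {R : realType}
  {P : probability T R}
  (a : forall n, 'I_n -> 'I_n -> {RV P >-> R})
  (C : nat -> R) (Cl : nat -> nat -> R) (ha : approx_uncorrelated a C Cl)
  (h : nat -> nat) (hh : halfwidths h) (h_oo : h n @[n --> \oo] --> \oo)
  (h_lim : (h n)%:R / n%:R @[n --> \oo] --> (0 : R)
        \/ (h n)%:R / n%:R @[n --> \oo] --> (1 : R)).
Local Notation bw := (@bw R h).
Variables (N : (nat -> R) -> Prop) (nN : null_class N).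
Hypotheses (N_nb : N (fun n => (n%:R * bw n)^-1))
  (N_b : exists2 z, (0 < z)%N & N (fun n => bw n ^- z))
  (N_Cl : forall l, (0 < l)%N -> N (Cl l)).

Let A n (t : T) : 'M[R]_n := nonperiodic_band_matrix a h n t.

Lemma band_matrix_sym n t : (A n t)^T = A n t.
Proof.
apply/matrixP => i j; rewrite !mxE -/(band (h n) j i) -/(band (h n) i j) band_sym.
by rewrite (scheme_sym ha).
Qed.

Lemma measurable_trace_band n k : measurable_fun setT (fun t => \tr (A n t ^+ k)).
Proof.
case: k => [|k]; first by under eq_fun do rewrite expr0; exact: measurable_cst.
under eq_fun do rewrite trace_expr.
apply: measurable_sum => w; apply: measurable_prod => q _.
under eq_fun do rewrite mxE.
by case: (_ <= _)%N; [apply: measurable_funM|exact: measurable_cst].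
Qed.

Lemma tree_density_cvg k :
  tree_density h n k @[n --> \oo] --> ((ballot k.+1 0)%:R : R).
Proof.
have dcvg : reducible_density h k n @[n --> \oo] --> ((ballot k.+1 0)%:R : R).
  exact: reducible_density_cvg.
have bV : (walk_const k.+1)%:R / Num.sqrt (bw n) @[n --> \oo] --> (0 : R).
  rewrite -[X in _ --> X](mulr0 (walk_const k.+1)%:R); apply: cvgMr.
  have sV : Num.sqrt ((h n)%:R^-1) @[n --> \oo] --> (0 : R).
    rewrite -sqrtr0; apply: cvg_comp (hV_cvg0 hh h_oo) _; exact: sqrt_continuous.
  apply: (@squeeze_cvgr _ _ _ _ (cst 0) (fun n => Num.sqrt ((h n)%:R^-1))) => //.
  - near=> n; have n0 : (0 < n)%N by near: n; exists 1%N.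
    have /andP[h1 _] := hh n0.
    have b0 : 0 < bw n := lt_le_trans ltr01 (bw_ge1 hh n0).
    have hn0 : 0 < (h n)%:R :> R by rewrite ltr0n.
    rewrite invr_ge0 sqrtr_ge0/= -sqrtrV ?(ltW b0)//.
    by rewrite ler_wsqrtr// lef_pV2 ?posrE// h_le_bw.
  - exact: cvg_cst.
have close : reducible_density h k n - tree_density h n k @[n --> \oo] --> (0 : R).
  apply/norm_cvg0P.
  apply: (@squeeze_cvgr _ _ _ _ (cst 0) (fun n => (walk_const k.+1)%:R / Num.sqrt (bw n))) => //.
  - near=> n; have n0 : (0 < n)%N by near: n; exists 1%N.
    by rewrite normr_ge0 (tree_density_close hh k n0).
  - exact: cvg_cst.
have -> : (fun n => tree_density h n k : R) =
    (fun n => reducible_density h k n - (reducible_density h k n - tree_density h n k)).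
  by apply/funext => n; rewrite subKr.
by rewrite -[X in _ --> X]subr0; exact: cvgB.
Unshelve. all: end_near. Qed.

Lemma tends_tree k : tends (P := P) N
  (fun n t => walk_part (n := n) a h k tree_doubled t - tree_density h n k) 0.
Proof.
have mY n : measurable_fun setT
    (fun t => walk_part (n := n) a h k tree_doubled t - tree_density h n k).
  by apply: measurable_funB; [exact: measurable_walk_part|exact: measurable_cst].
(* a doubled tree has even length; in even length the rates of both Cl apply *)
have [odd_k|even_k] := boolP (odd k.+1).
  have -> : (fun n t => walk_part (n := n) a h k tree_doubled t - tree_density h n k) =
      (fun n (t : T) => cst (0 : R) n).
    apply/funext => n; apply/funext => t.
    rewrite /walk_part /tree_density -mulrBr -sumrB big_pred0 ?mulr0// => w.
    rewrite /tree_doubled size_tuple; apply/negbTE; rewrite !negb_and negbK.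
    apply/orP; right; apply/orP; right; apply/negP => /eqP/(congr1 odd).
    by move: odd_k => /= odd_k; rewrite mul2n odd_double /= (negbTE odd_k).
  by apply: (tends_cst nN N_nb); exact: cvg_cst.
have half_k : (0 < (k.+1)./2)%N.
  by have := odd_double_half k.+1; rewrite (negbTE even_k) add0n; case: (_./2).
have abs_N u : N u -> N (fun n => `|u n|).
  by move=> Nu; apply: (null_le nN Nu); apply: nearW => n; rewrite normr_id.
apply: (tends_moment (z := 1) nN mY (u := fun n =>
  (walk_const k.+1)%:R ^+ 2 * (`|Cl k.+1 n| + 2 * `|Cl (k.+1)./2 n|) +
  (`|C (2 * k.+1)%N| + 2 * `|C k.+1| + 1) * (meet_const k * walk_const k.+1)%:R
  * (n%:R * bw n)^-1)).
  apply: (null_add nN); last exact: (null_scale nN).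
  apply: (null_scale nN); apply: (null_add nN); first exact/abs_N/N_Cl.
  by apply: (null_scale nN); exact/abs_N/N_Cl.
by exists 1%N => // n /= n0; exact: (mean_sqr_tree ha hh k n0).
Qed.

Lemma tends_single k : tends (P := P) N (fun n => walk_part (n := n) a h k has_single) 0.
Proof.
apply: (tends_moment (z := 1) nN _ (null_scale nN _ N_nb)) => [n|].
  exact: measurable_walk_part.
by exists 1%N => // n /= n0; exact: (mean_sqr_single ha hh k n0).
Qed.

Lemma tends_degenerate k : tends (P := P) N (fun n => walk_part (n := n) a h k degenerate) 0.
Proof.
have [z z0 Nz] := N_b.
apply: (tends_moment (z := z) nN _ (null_scale nN _ Nz)) => [n|].
  exact: measurable_walk_part.
by exists 1%N => // n /= n0; exact: (mean_pow_degenerate ha hh k n0 z0).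
Qed.

Lemma tends_eq (Y Z : nat -> T -> R) (l : R) : tends (P := P) N Y l ->
  (\forall n \near \oo, forall t, Y n t = Z n t) -> tends (P := P) N Z l.
Proof.
move=> tY YZ eps eps0; apply: (null_le nN (tY _ eps0)).
move: YZ; apply: filterS => n YZ.
by rewrite (_ : Z n = Y n)//; apply/funext => t; rewrite YZ.
Qed.

Lemma tends_moments k :
  tends (P := P) N (fun n t => n%:R^-1 * \tr (A n t ^+ k)) (ballot k 0)%:R.
Proof.
case: k => [|k].
  apply: (@tends_eq (fun n _ => 1)).
    by apply: (tends_cst nN N_nb); exact: cvg_cst.
  exists 1%N => // n /= n0 t; rewrite expr0 mxtrace1 mulVf// pnatr_eq0 -lt0n//.
have mS n : measurable_fun setT (walk_part (n := n) a h k has_single).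
  exact: measurable_walk_part.
have mD n : measurable_fun setT (walk_part (n := n) a h k degenerate).
  exact: measurable_walk_part.
have tdens : tends (P := P) N (fun n (_ : T) => tree_density h n k) (ballot k.+1 0)%:R.
  by apply: (tends_cst nN N_nb); exact: tree_density_cvg.
have mtree n : measurable_fun setT
    (fun t => walk_part (n := n) a h k tree_doubled t - tree_density h n k).
  by apply: measurable_funB; [exact: measurable_walk_part|exact: measurable_cst].
have t1 := tendsD nN mS mD (tends_single k) (tends_degenerate k).
have t2 := tendsD nN mtree (fun n => measurable_cst _) (tends_tree k) tdens.
have := tendsD nN (fun n => measurable_funD (mS n) (mD n))
  (fun n => measurable_funD (mtree n) (measurable_cst _)) t1 t2.
rewrite !add0r => t3; apply: (tends_eq t3).
exists 1%N => // n /= n0 t.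
by rewrite /A trace_band_matrix// walk_part_split subrK.
Qed.

Lemma tends_band_esd (f : R -> R) (M : R) : continuous f -> (forall x, `|f x| <= M) ->
  tends (P := P) N (fun n t => \int[esd (A n t)]_x f x) (\int[semicircle]_x f x).
Proof.
by apply: tends_esd => //; [exact: band_matrix_sym|exact: measurable_trace_band|
  exact: tends_moments].
Qed.

End BandMoments.

(** * Summability of the rates *)

Section PowerSummable.
Context {R : realType}.

(** With x n = n^(1/p), the n-th term is at most p times the decrease of 1 / x n
from the preceding index, which telescopes. *)
Lemma abs_summable_root p : (0 < p)%N ->
  abs_summable (fun n => (n%:R * n%:R `^ (p%:R^-1))^-1 : R).
Proof.
move=> p0; pose x n : R := n%:R `^ (p%:R^-1).
have xp n : x n ^+ p = n%:R.
  by rewrite -powR_mulrn ?powR_ge0// -powRrM mulVf ?powRr1 ?pnatr_eq0 -?lt0n.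
have x0 n : 0 <= x n by exact: powR_ge0.
have xgt0 n : (0 < n)%N -> 0 < x n by move=> n0; rewrite powR_gt0// ltr0n.
have xmono n : x n <= x n.+1.
  by rewrite ge0_ler_powR ?nnegrE ?ler_nat// invr_ge0.
have step n : (0 < n)%N -> (n.+1%:R * x n.+1)^-1 <= p%:R * ((x n)^-1 - (x n.+1)^-1).
  move=> n0; have a0 := xgt0 _ n0; have b0 := xgt0 n.+1 isT.
  have diff : 1 <= (x n.+1 - x n) * (p%:R * x n.+1 ^+ p.-1).
    have : x n.+1 ^+ p - x n ^+ p = 1 by rewrite !xp -natr1; ring.
    move=> diffp; rewrite -[leLHS]diffp subrXX ler_wpM2l ?subr_ge0//.
    have -> : p%:R * x n.+1 ^+ p.-1 = \sum_(i < p) x n.+1 ^+ p.-1.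
      by rewrite sumr_const card_ord mulr_natl.
    apply: ler_sum => i _.
    apply: (@le_trans _ _ (x n.+1 ^+ (p.-1 - i) * x n.+1 ^+ i)).
      by rewrite ler_wpM2l ?exprn_ge0// lerXn2r// nnegrE.
    by rewrite -exprD subnK//; have := ltn_ord i; lia.
  have -> : p%:R * ((x n)^-1 - (x n.+1)^-1) =
      p%:R * (x n.+1 - x n) / (x n * x n.+1) by field; rewrite !gt_eqF.
  rewrite ler_pdivlMr ?mulr_gt0// mulrC ler_pdivrMr ?mulr_gt0 ?ltr0n//.
  apply: (@le_trans _ _ (x n.+1 * x n.+1)); first by rewrite ler_wpM2r.
  have yE : n.+1%:R = x n.+1 * x n.+1 ^+ p.-1 by rewrite -exprS prednK.
  rewrite yE -[leLHS]mul1r.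
  have -> : p%:R * (x n.+1 - x n) * (x n.+1 * x n.+1 ^+ p.-1 * x n.+1) =
     (x n.+1 - x n) * (p%:R * x n.+1 ^+ p.-1) * (x n.+1 * x n.+1) by ring.
  by rewrite ler_wpM2r// mulr_ge0.
have main n : (0 < n)%N ->
    \sum_(i < n.+1) `|(i%:R * x i)^-1| <= 1 + p%:R * (1 - (x n)^-1).
  elim: n => // -[_ _|n IH _].
    by rewrite !big_ord_recr big_ord0/= mul0r invr0 normr0 !add0r /x powR1 mul1r
      invr1 normr1 subrr mulr0 addr0.
  rewrite big_ord_recr/=.
  apply: (@le_trans _ _ (1 + p%:R * (1 - (x n.+1)^-1) +
      p%:R * ((x n.+1)^-1 - (x n.+2)^-1))).
    by apply: lerD; [exact: IH|rewrite ger0_norm ?invr_ge0 ?mulr_ge0//; exact: step].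
  by rewrite le_eqVlt; apply/orP; left; apply/eqP; ring.
exists (1 + p%:R) => n.
apply: (@le_trans _ _ (\sum_(i < n.+1.+1) `|(i%:R * x i)^-1|)).
  by rewrite [leRHS]big_ord_recr [in leRHS]big_ord_recr/= -addrA lerDl addr_ge0.
apply: le_trans (main n.+1 isT) _.
by rewrite lerD2l ler_piMr// lerBlDr lerDl invr_ge0.
Qed.

End PowerSummable.

Section NullRates.
Context {R : realType} (h : nat -> nat) (hh : halfwidths h).
Local Notation bw := (@bw R h).

Let bw_gt0 n : (0 < n)%N -> 0 < bw n.
Proof. by move=> n0; apply: lt_le_trans (bw_ge1 hh n0). Qed.
Let h_gt0 n : (0 < n)%N -> 0 < (h n)%:R :> R.
Proof. by move=> n0; rewrite ltr0n; have /andP[] := hh n0. Qed.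

Let bwV_le n : (0 < n)%N -> (bw n)^-1 <= (h n)%:R^-1.
Proof. by move=> n0; rewrite lef_pV2 ?posrE ?bw_gt0 ?h_gt0// h_le_bw. Qed.

Lemma vanishing_bwV : (h n @[n --> \oo] --> \oo) -> vanishing (fun n : nat => bw n ^- 1).
Proof.
move=> h_oo; apply: (null_le vanishing_null (hV_cvg0 hh h_oo)).
exists 1%N => // n /= n0; rewrite expr1 !ger0_norm ?invr_ge0 ?(ltW (bw_gt0 n0))//.
exact: bwV_le.
Qed.

Lemma vanishing_nbwV : (h n @[n --> \oo] --> \oo) -> vanishing (fun n : nat => (n%:R * bw n)^-1).
Proof.
move=> h_oo; apply: (null_le vanishing_null (vanishing_bwV h_oo)).
exists 1%N => // n /= n0.
rewrite expr1 !ger0_norm ?invr_ge0 ?mulr_ge0 ?(ltW (bw_gt0 n0))//.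
by rewrite lef_pV2 ?posrE ?mulr_gt0 ?bw_gt0 ?ltr0n// ler_peMl ?ler1n ?(ltW (bw_gt0 n0)).
Qed.

Variable p : nat.
Hypotheses (p0 : (0 < p)%N) (hp : cvgn (series (fun n => (h n)%:R ^- p : R))).

Let hp_summable : abs_summable (fun n => (h n)%:R ^- p : R).
Proof.
apply: cvg_series_abs_summable => //.
by apply: nearW => n; rewrite invr_ge0 exprn_ge0.
Qed.

Lemma abs_summable_bwV : abs_summable (fun n => bw n ^- p).
Proof.
apply: (null_le abs_summable_null hp_summable).
exists 1%N => // n /= n0; rewrite !ger0_norm ?invr_ge0 ?exprn_ge0 ?(ltW (bw_gt0 n0))//.
by rewrite lef_pV2 ?posrE ?exprn_gt0 ?bw_gt0 ?h_gt0// lerXn2r ?nnegrE ?h_le_bw// ltW ?bw_gt0.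
Qed.

(** If h n >= n^(1/p), then 1 / (n b) is at most n^(-1-1/p); otherwise already 1 / n
is less than h^-p. *)
Lemma abs_summable_nbwV : abs_summable (fun n : nat => (n%:R * bw n)^-1).
Proof.
apply: (null_le abs_summable_null
  (null_add abs_summable_null (abs_summable_root p0) hp_summable)).
exists 1%N => // n /= n0.
have n0' : 0 < n%:R :> R by rewrite ltr0n.
have x0 : 0 < n%:R `^ (p%:R^-1) :> R by exact: powR_gt0.
have hn0 := h_gt0 n0.
rewrite !ger0_norm ?addr_ge0 ?invr_ge0 ?mulr_ge0 ?exprn_ge0 ?(ltW (bw_gt0 n0)) ?(ltW x0)//.
apply: (@le_trans _ _ (n%:R * (h n)%:R)^-1).
  by rewrite lef_pV2 ?posrE ?mulr_gt0 ?bw_gt0// ler_wpM2l// h_le_bw.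
have [xh|hx] := leP (n%:R `^ (p%:R^-1)) ((h n)%:R : R).
  rewrite ler_wpDr ?invr_ge0 ?exprn_ge0//.
  by rewrite lef_pV2 ?posrE ?mulr_gt0// ler_wpM2l.
rewrite ler_wpDl ?invr_ge0 ?mulr_ge0 ?(ltW x0)//.
rewrite lef_pV2 ?posrE ?mulr_gt0 ?exprn_gt0//.
apply: (@le_trans _ _ n%:R); last by rewrite ler_peMr// ler1n; have /andP[] := hh n0.
have -> : n%:R = (n%:R `^ (p%:R^-1)) ^+ p :> R.
  by rewrite -powR_mulrn ?powR_ge0// -powRrM mulVf ?powRr1 ?pnatr_eq0 -?lt0n.
by rewrite lerXn2r ?nnegrE ?(ltW x0)// ltW.
Qed.

End NullRates.

Section SquareRates.
Context {d : measure_display} {T : measurableType d} {R : realType}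
  {P : probability T R}
  (a : forall n, 'I_n -> 'I_n -> {RV P >-> R})
  (C : nat -> R) (Cl : nat -> nat -> R) (ha : approx_uncorrelated a C Cl).

(** As soon as n >= l there are l fundamentally different pairs, and then Cl l n
bounds an absolute value. *)
Lemma square_rate_ge0 l : (0 < l)%N -> \forall n \near \oo, 0 <= Cl l n.
Proof.
move=> l0; exists l => // n /= ln.
pose p (i : 'I_l) : 'I_n * 'I_n := (widen_ord ln i, widen_ord ln i).
have fd : fundamentally_different p.
  move=> i j; apply: contra => /eqP E; apply/eqP/val_inj => /=.
  have : widen_ord ln i \in [set widen_ord ln j; widen_ord ln j]%SET.
    by rewrite -E !inE eqxx.
  by rewrite !inE orbb => /eqP/(congr1 val).
by have := scheme_square ha l0 fd; rewrite -lee_fin; apply: le_trans; exact: abse_ge0.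
Qed.

End SquareRates.

(** * The two modes of convergence *)

Section Modes.
Context {d : measure_display} {T : measurableType d} {R : realType}
  {P : probability T R}.

Lemma tends_cvg_in_probability (Y : nat -> T -> R) (l : R) :
  (forall n, measurable_fun setT (Y n)) ->
  tends (P := P) vanishing Y l -> cvg_in_probability P Y l.
Proof.
move=> mY tY eps eps0; have := tY _ eps0 => H.
have mD n := measurable_deviation l eps (mY n).
apply/fine_cvgP; split => //.
by apply: nearW => n; exact: fin_num_measure.
Qed.

(** By the Borel-Cantelli lemma almost surely only finitely many deviations exceed
1 / m.+1, for all m at once. *)
Lemma tends_cvg_almost_surely (Y : nat -> T -> R) (l : R) :
  (forall n, measurable_fun setT (Y n)) ->
  tends (P := P) abs_summable Y l -> cvg_almost_surely P Y l.
Proof.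
move=> mY tY.
pose F (m n : nat) := [set t | m.+1%:R^-1 <= `|Y n t - l|].
have mF m n : measurable (F m n) by exact: measurable_deviation.
have F0 m : P (lim_sup_set (F m)) = 0%E.
  apply: lim_sup_set_cvg0 => //.
  have [M HM] := tY m.+1%:R^-1 ltac:(by rewrite invr_gt0).
  apply: (@le_lt_trans _ _ M%:E); last exact: ltry.
  apply: lime_le; first by apply: is_cvg_nneseries.
  apply: nearW => n.
  rewrite (eq_bigr (fun i => (fine (P (F m i)))%:E)); last first.
    by move=> i _; rewrite fineK// fin_num_measure.
  rewrite sumEFin lee_fin big_mkord; apply: le_trans (HM n).
  by apply: ler_sum => i _; exact: ler_norm.
have negF : P.-negligible (\bigcup_m lim_sup_set (F m)).
  apply: negligible_bigcup => m; exists (lim_sup_set (F m)).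
  split; [|exact: F0|by []].
  apply: bigcap_measurable => [|n _]; first by exists 0%N.
  by apply: bigcup_measurable.
apply: negligibleS negF => t /= ncvg; apply: contrapT => notin.
apply: ncvg; apply/cvgrPdist_lt => e e0.
have [m me] : exists m : nat, m.+1%:R^-1 < e.
  exists (Num.truncn e^-1); rewrite -[ltRHS]invrK ltf_pV2 ?posrE ?invr_gt0//.
  exact: truncnS_gt.
have : ~ lim_sup_set (F m) t by move=> tF; apply: notin; exists m.
rewrite /lim_sup_set => /existsNP[n /not_implyP[_ nF]].
exists n => // j /= nj; apply: lt_trans me; rewrite ltNge distrC; apply/negP => jF.
by apply: nF; exists j.
Qed.

End Modes.

(** * The semicircle law *)

Lemma bounded_fun_bound (R : realType) (f : R -> R) :
  [bounded f x | x in [set: R]] -> exists M, forall x, `|f x| <= M.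
Proof. by move=> [M [_ MH]]; exists (M + 1) => x; apply: MH; rewrite // ltrDl. Qed.

Theorem theorem13 (R : realType) (d : measure_display) (T : measurableType d)
    (P : probability T R)
    (a : forall n : nat, 'I_n -> 'I_n -> {RV P >-> R})
    (C : nat -> R) (Cl : nat -> nat -> R) (h : nat -> nat)
    (ha : approx_uncorrelated a C Cl)
    (hh : halfwidths h)
    (h_oo : h n @[n --> \oo] --> \oo)
    (h_lim : (h n)%:R / n%:R @[n --> \oo] --> (0 : R)
          \/ (h n)%:R / n%:R @[n --> \oo] --> (1 : R)) :
  semicircle_law_in_probability P (nonperiodic_band_matrix a h)
  /\ ((exists p : nat, (0 < p)%N /\ cvgn (series (fun n => (h n)%:R ^- p : R))) ->
      (forall l : nat, (0 < l)%N -> cvgn (series (Cl l))) ->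
      semicircle_law_almost_surely P (nonperiodic_band_matrix a h)).
Proof.
have mI f n : continuous f -> [bounded f x | x in [set: R]] ->
    measurable_fun setT (fun t => \int[esd (nonperiodic_band_matrix a h n t)]_x f x).
  move=> cf /bounded_fun_bound[M fM].
  exact: (@measurable_esd _ _ _ (nonperiodic_band_matrix a h) (band_matrix_sym ha h)
    (measurable_trace_band a h) f M n cf fM).
split=> [f cf bf|[p [p0 hp]] Cl_sum f cf bf].
- apply: tends_cvg_in_probability => [n|]; first exact: mI.
  have [M fM] := bounded_fun_bound bf.
  apply: (tends_band_esd ha hh h_oo h_lim vanishing_null _ _ _ cf fM).
  + exact: vanishing_nbwV.
  + by exists 1%N => //; exact: vanishing_bwV.
  + exact: (scheme_cvg ha).
- apply: tends_cvg_almost_surely => [n|]; first exact: mI.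
  have [M fM] := bounded_fun_bound bf.
  apply: (tends_band_esd ha hh h_oo h_lim abs_summable_null _ _ _ cf fM).
  + exact: (abs_summable_nbwV hh p0 hp).
  + by exists p => //; exact: (abs_summable_bwV hh hp).
  + move=> l l0; apply: cvg_series_abs_summable; last exact: Cl_sum.
    exact: (square_rate_ge0 ha l0).
Qed.
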